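(* Let $N=1$, let $k$ be a non-negative multiplicity function (on a reduced root system $\mathscr{R}$ on $\mathbb{R}$), and let $a>0$ be such that $\lambda_{k,a,0}=\frac{2\langle k\rangle-1}{a}>-1$. Then $$\mathscr{S}_{k,a}(\mathbb{R})=\{\,x\mapsto u(|x|^a)+x\,v(|x|^a)\;:\;u,v\in\mathscr{S}(\mathbb{R}_{\ge 0})\,\}.$$
   Context: $\mathbb{N}=\{0,1,2,\dots\}$, $\mathbb{R}_+=(0,\infty)$, $\mathbb{R}_{\ge0}=[0,\infty)$; functions are complex-valued; $\mathscr{S}(\mathbb{R}_{\ge0})=\{u|_{\mathbb{R}_{\ge0}}:u\in\mathscr{S}(\mathbb{R})\}$ with $\mathscr{S}(\mathbb{R})$ the classical Schwartz space. General setting ($N\ge1$). A reduced root system $\mathscr{R}$ on $\mathbb{R}^N$ is a finite (possibly empty) subset of $\mathbb{R}^N\setminus\{0\}$, stable under the orthogonal reflections $r_\alpha$ in $(\mathbb{R}\alpha)^\perp$ ($\alpha\in\mathscr{R}$), with $\mathscr{R}\cap\mathbb{R}\alpha=\{\pm\alpha\}$. A multiplicity function is a map $k:\mathscr{R}\to\mathbb{C}$ invariant under the group generated by the $r_\alpha$; it is non-negative if all $k_\alpha\ge0$. Put $\langle k\rangle=\frac12\sum_{\alpha\in\mathscr{R}}k_\alpha$. The Dunkl Laplacian is $\Delta_k=\sum_{j=1}^N T_j^2$ with $T_jf=\partial_jf+\frac12\sum_{\alpha\in\mathscr{R}}k_\alpha\alpha_j\frac{f(x)-f(r_\alpha x)}{\langle\alpha,x\rangle}$.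 Let $E_x=\sum_jx_j\partial_{x_j}$ and $w_{k,a}(x)=|x|^{a-2}\prod_{\alpha\in\mathscr{R}}|\langle\alpha,x\rangle|^{k_\alpha}$. Let $\mathcal{H}^m_k(S^{N-1})$ be the space of restrictions to $S^{N-1}$ of homogeneous polynomials $p$ of degree $m$ with $\Delta_kp=0$. For $p$ on $S^{N-1}$ and $f$ on $\mathbb{R}_+$, $(p\otimes f)(r\omega)=p(\omega)f(r)$. Let $\mathbf{h}=\begin{pmatrix}1&0\\0&-1\end{pmatrix}$, $\mathbf{e}^+=\begin{pmatrix}0&1\\0&0\end{pmatrix}$, $\mathbf{e}^-=\begin{pmatrix}0&0\\1&0\end{pmatrix}$. The Lie algebra representation $\omega_{k,a}$ of $\mathfrak{sl}(2,\mathbb{R})$ on $C^\infty(\mathbb{R}^N\setminus\{0\})$ is given by $\omega_{k,a}(\mathbf{h})=\frac2aE_x+\frac{2\langle k\rangle+a+N-2}{a}$, $\omega_{k,a}(\mathbf{e}^+)=\frac ia|x|^a$, $\omega_{k,a}(\mathbf{e}^-)=\frac ia|x|^{2-a}\Delta_k$. Put $\lambda_{k,a,m}=\frac{2m+2\langle k\rangle+N-2}{a}$, $L_l^\lambda(t)=\sum_{j=0}^l\frac{(-1)^j}{j!}\binom{\lambda+l}{l-j}t^j$, and $$f_{k,a,m;l}(r)=\Big(\tfrac{2^{\lambda_{k,a,m}+1}\Gamma(l+1)}{a^{\lambda_{k,a,m}}\Gamma(\lambda_{k,a,m}+l+1)}\Big)^{1/2}r^mL_l^{\lambda_{k,a,m}}(\tfrac2ar^a)e^{-r^a/a}.$$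 Let $W_{k,a}(\mathbb{R}^N)=\bigoplus_{m\in\mathbb{N}}\mathcal{H}^m_k(S^{N-1})\otimes\mathrm{span}_{\mathbb{C}}\{f_{k,a,m;l}:l\in\mathbb{N}\}$. For $k$ non-negative, $a>0$ and $\lambda_{k,a,0}>-1$, $\Omega_{k,a}$ is the unique unitary representation of the universal covering group $\widetilde{SL}(2,\mathbb{R})$ on $L^2(\mathbb{R}^N,w_{k,a}(x)\,dx)$ whose space of $\widetilde{SO}(2)$-finite vectors is $W_{k,a}(\mathbb{R}^N)$ and whose infinitesimal action on $W_{k,a}(\mathbb{R}^N)$ is $\omega_{k,a}$ (existence and uniqueness are known, due to Ben Saïd–Kobayashi–Ørsted). Here $\widetilde{SO}(2)$ is the Lie subgroup with Lie algebra $\mathfrak{so}(2)$. A vector $v$ of a unitary representation $(\pi,\mathcal{H})$ of a Lie group $G$ is smooth if $g\mapsto\pi(g)v$ is a smooth map $G\to\mathcal{H}$. The $(k,a)$-generalized Schwartz space $\mathscr{S}_{k,a}(\mathbb{R}^N)$ is the space of smooth vectors for $\Omega_{k,a}$. *)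

(* Defs.v *)
From HB Require Import structures.
From mathcomp Require Import all_boot all_order all_algebra finmap.
From mathcomp Require Import complex.
From mathcomp Require Import all_classical all_reals all_analysis.

Set Implicit Arguments.
Unset Strict Implicit.
Unset Printing Implicit Defensive.

Import Order.TTheory GRing.Theory Num.Theory.
Import numFieldNormedType.Exports.

Local Open Scope classical_set_scope.
Local Open Scope ring_scope.
Local Open Scope complex_scope.

(* The dimension is N = 1 throughout: the Euclidean space is R itself, its
   inner product is the product of R, and the unit sphere is {1, -1}. *)

Definition reflection (R : realType) (α x : R) : R :=
  x - 2 * (α * x) / (α * α) * α.

Definition reduced_root_system (R : realType) (S : {fset R}) : Prop :=
  [/\ 0 \notin S,
      (forall α β, α \in S -> β \in S -> reflection α β \in S) &
      (forall α t, α \in S -> (t * α \in S) = (t * α == α) || (t * α == - α))].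

(* Only the values of [k] on [S] matter.  Real values lose nothing, since
   the multiplicity functions considered are non-negative. *)
Definition nonneg_multiplicity (R : realType) (S : {fset R}) (k : R -> R) :
    Prop :=
  (forall α β, α \in S -> β \in S -> k (reflection α β) = k β) /\
  (forall α, α \in S -> 0 <= k α).

Definition half_sum (R : realType) (S : {fset R}) (k : R -> R) : R :=
  2^-1 * \sum_(α <- S) k α.

Definition cderive (R : realType) (f : R -> R[i]) (x : R) : R[i] :=
  derive1 (fun y => complex.Re (f y)) x +i* derive1 (fun y => complex.Im (f y)) x.

(* The value at [x = 0] is meaningless (division by zero) and is never used. *)
Definition dunkl (R : realType) (S : {fset R}) (k : R -> R)
    (f : R -> R[i]) (x : R) : R[i] :=
  cderive f x + (2^-1)%:C *
    \sum_(α <- S) (k α * α)%:C * ((f x - f (reflection α x)) / (α * x)%:C).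

Definition dunkl_laplacian (R : realType) (S : {fset R}) (k : R -> R)
    (f : R -> R[i]) : R -> R[i] :=
  dunkl S k (dunkl S k f).

Definition weight (R : realType) (S : {fset R}) (k : R -> R) (a x : R) : R :=
  `|x| `^ (a - 2) * \prod_(α <- S) `|α * x| `^ k α.

Definition omega_h (R : realType) (S : {fset R}) (k : R -> R) (a : R)
    (f : R -> R[i]) (x : R) : R[i] :=
  (2 / a)%:C * (x%:C * cderive f x)
  + ((2 * half_sum S k + a + 1 - 2) / a)%:C * f x.

Definition omega_eplus (R : realType) (a : R) (f : R -> R[i]) (x : R) : R[i] :=
  'i%C * (a^-1 * `|x| `^ a)%:C * f x.

Definition omega_eminus (R : realType) (S : {fset R}) (k : R -> R) (a : R)
    (f : R -> R[i]) (x : R) : R[i] :=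
  'i%C * (a^-1 * `|x| `^ (2 - a))%:C * dunkl_laplacian S k f x.

(* X = X00 h + X01 e^+ + X10 e^- for a traceless matrix X *)
Definition omega (R : realType) (S : {fset R}) (k : R -> R) (a : R)
    (X : 'M[R]_2) (f : R -> R[i]) (x : R) : R[i] :=
  (X 0 0)%:C * omega_h S k a f x + (X 0 1)%:C * omega_eplus a f x
  + (X 1 0)%:C * omega_eminus S k a f x.

Definition lambda (R : realType) (S : {fset R}) (k : R -> R) (a : R)
    (m : nat) : R :=
  (2 * m%:R + 2 * half_sum S k + 1 - 2) / a.

Definition Gamma (R : realType) (s : R) : R :=
  \int[lebesgue_measure]_(t in `]0, +oo[) (t `^ (s - 1) * expR (- t)).

Definition gbinom (R : realType) (s : R) (n : nat) : R :=
  (\prod_(i < n) (s - i%:R)) / n`!%:R.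

Definition laguerre (R : realType) (s : R) (l : nat) (t : R) : R :=
  \sum_(j < l.+1) (-1) ^+ j / j`!%:R * gbinom (s + l%:R) (l - j) * t ^+ j.

Definition radial (R : realType) (S : {fset R}) (k : R -> R) (a : R)
    (m l : nat) (r : R) : R :=
  let lam := lambda S k a m in
  Num.sqrt (2 `^ (lam + 1) * Gamma (l%:R + 1)
            / (a `^ lam * Gamma (lam + l%:R + 1)))
  * r ^+ m * laguerre lam l (2 / a * r `^ a) * expR (- (r `^ a / a)).

Definition homogeneous (R : realType) (m : nat) (P : {poly R[i]}) : Prop :=
  forall j, j != m -> P`_j = 0.

(* [p] represents a function on {1, -1}.  As the Dunkl Laplacian maps
   polynomials to polynomials, its vanishing need only be tested off 0. *)
Definition dunkl_harmonic (R : realType) (S : {fset R}) (k : R -> R) (m : nat)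
    (p : R -> R[i]) : Prop :=
  exists P : {poly R[i]},
    [/\ homogeneous m P,
        (forall x, x != 0 -> dunkl_laplacian S k (fun y => P.[y%:C]) x = 0) &
        (forall ω, `|ω| = 1 -> p ω = P.[ω%:C])].

Definition polar_tensor (R : realType) (p : R -> R[i]) (f : R -> R) (x : R) :
    R[i] :=
  p (x / `|x|) * (f `|x|)%:C.

Definition W (R : realType) (S : {fset R}) (k : R -> R) (a : R) :
    set (R -> R[i]) :=
  [set f | exists n (p : nat -> nat -> R -> R[i]),
     (forall m l, dunkl_harmonic S k m (p m l)) /\
     f = (fun x => \sum_(m < n) \sum_(l < n)
                     polar_tensor (p m l) (radial S k a m l) x)].

(* Elements of the Hilbert space L^2(R, w(x) dx) are represented by measurable functions; equality in L^2 is
   equality Lebesgue-almost everywhere, which for the weights used below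
   (positive off 0) is the same as equality w(x) dx-almost everywhere.
   [L2sq] is the squared norm. *)

Definition L2sq (R : realType) (w : R -> R) (f : R -> R[i]) : \bar R :=
  \int[lebesgue_measure]_x ((complex.Re (f x) ^+ 2 + complex.Im (f x) ^+ 2) * w x)%:E.

Definition memL2 (R : realType) (w : R -> R) (f : R -> R[i]) : Prop :=
  [/\ measurable_fun [set: R] (fun x => complex.Re (f x)),
      measurable_fun [set: R] (fun x => complex.Im (f x)) &
      (L2sq w f < +oo)%E].

Definition aeeq (R : realType) (f g : R -> R[i]) : Prop :=
  {ae lebesgue_measure, forall x : R, f x = g x}.

(* The element of L^2 represented by [f]; empty if [f] is not in L^2. *)
Definition L2class (R : realType) (w : R -> R) (f : R -> R[i]) :
    set (R -> R[i]) :=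
  [set g | memL2 w g /\ aeeq f g].

Definition L2cvg (R : realType) (w : R -> R) (T : Type) (F : T -> R -> R[i])
    (A : set_system T) (f : R -> R[i]) : Prop :=
  L2sq w (fun y => F t y - f y) @[t --> A] --> 0%E.

Definition L2continuous (R : realType) (w : R -> R)
    (F : 'rV[R]_3 -> R -> R[i]) : Prop :=
  forall x, L2cvg w F (nbhs x) (F x).

Definition L2partial (R : realType) (w : R -> R) (F : 'rV[R]_3 -> R -> R[i])
    (i : 'I_3) (x : 'rV[R]_3) (D : R -> R[i]) : Prop :=
  L2cvg w (fun (h : R) y => (h^-1)%:C * (F (x + h *: delta_mx 0 i) y - F x y))
    0^' D.

(* The universal covering group of SL(2,R), realized as the group of pairs
   (g, φ) where g is in SL(2,R) and φ : R -> R is a continuous lift of the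
   action of g on the circle of rays of R^2.  Each g has such a lift, unique
   up to translation by 2πZ, and the generator of the fundamental group Z of
   SL(2,R), the loop of rotations, lifts to a path joining the identity to
   the deck transformation φ = id + 2π. *)
Definition ray (R : realType) (t : R) : 'cV[R]_2 :=
  \col_i (if i == 0 then cos t else sin t).

Definition lifts (R : realType) (g : 'M[R]_2) (φ : R -> R) : Prop :=
  forall t, exists2 r, 0 < r & g *m ray t = r *: ray (φ t).

Record SL2cover (R : realType) := SL2Cover {
  cmat : 'M[R]_2;
  clift : R -> R;
  cmat_det : \det cmat = 1;
  clift_continuous : continuous clift;
  clift_lifts : lifts cmat clift
}.

Lemma lifts1 (R : realType) : lifts (1%:M : 'M[R]_2) id.
Proof. by move=> t; exists 1; rewrite ?ltr01 // mul1mx scale1r. Qed.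

Lemma liftsM (R : realType) (g h : 'M[R]_2) (φ ψ : R -> R) :
  lifts g φ -> lifts h ψ -> lifts (g *m h) (φ \o ψ).
Proof.
move=> Hg Hh t; have [r r0 hr] := Hh t; have [s s0 gs] := Hg (ψ t).
exists (r * s); first exact: mulr_gt0.
by rewrite -mulmxA hr -scalemxAr gs scalerA.
Qed.

Definition cone (R : realType) : SL2cover R :=
  SL2Cover (det1 R 2) (fun x => cvg_id : id @ x --> x) (@lifts1 R).

Lemma cmul_det (R : realType) (g h : SL2cover R) :
  \det (cmat g *m cmat h) = 1.
Proof. by rewrite det_mulmx !cmat_det mulr1. Qed.

Lemma cmul_continuous (R : realType) (g h : SL2cover R) :
  continuous (clift g \o clift h).
Proof.
by move=> x; apply: continuous_comp; apply: clift_continuous.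
Qed.

Definition cmul (R : realType) (g h : SL2cover R) : SL2cover R :=
  SL2Cover (cmul_det g h) (@cmul_continuous R g h)
    (liftsM (@clift_lifts R g) (@clift_lifts R h)).

(* The Iwasawa decomposition: (θ, t, s) are the coordinates of the element
   k(θ) exp(t h) exp(s e^+), where k(θ) is the rotation by θ with lift
   φ = id + θ.  This is a diffeomorphism of the covering group onto R^3 and
   serves to define its manifold structure: continuity and smoothness of
   maps on the group are continuity and smoothness in these coordinates. *)
Definition iwasawa (R : realType) (g : SL2cover R) : 'rV[R]_3 :=
  let A := cmat g in
  let n2 := A 0 0 ^+ 2 + A 1 0 ^+ 2 in
  \row_i [:: clift g 0; ln (Num.sqrt n2);
             (A 0 0 * A 0 1 + A 1 0 * A 1 1) / n2]`_i.

Definition continuous_on_group (R : realType) (w : R -> R)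
    (F : SL2cover R -> R -> R[i]) : Prop :=
  exists2 Φ : 'rV[R]_3 -> R -> R[i],
    (forall g, F g = Φ (iwasawa g)) & L2continuous w Φ.

(* [D s] is the iterated partial derivative along the word [s]. *)
Definition smooth_on_group (R : realType) (w : R -> R)
    (F : SL2cover R -> R -> R[i]) : Prop :=
  exists D : seq 'I_3 -> 'rV[R]_3 -> R -> R[i],
    [/\ (forall g, F g = D [::] (iwasawa g)),
        (forall s x, memL2 w (D s x)),
        (forall s, L2continuous w (D s)) &
        (forall s i x, L2partial w (D s) i x (D (i :: s) x))].

(* The derivative of [cmat] at 0 forces [γ t] to be exp(tX). *)
Definition one_parameter_subgroup (R : realType) (X : 'M[R]_2)
    (γ : R -> SL2cover R) : Prop :=
  [/\ (forall s t, γ (s + t) = cmul (γ s) (γ t)),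
      continuous (fun t => iwasawa (γ t)) &
      is_derive (0 : R) 1 (fun t => cmat (γ t)) X].

(* The connected Lie subgroup with Lie algebra so(2), as the image of the
   exponential map (so(2) is abelian). *)
Definition SO2cover (R : realType) : set (SL2cover R) :=
  [set g | exists X γ, [/\ X^T = - X, one_parameter_subgroup X γ & g = γ 1]].

Definition unitary_representation (R : realType) (w : R -> R)
    (π : SL2cover R -> (R -> R[i]) -> R -> R[i]) : Prop :=
  [/\ [/\ (forall g f, memL2 w f -> memL2 w (π g f)),
          (forall g (c : R[i]) f1 f2, memL2 w f1 -> memL2 w f2 ->
             aeeq (π g (fun x => c * f1 x + f2 x))
                  (fun x => c * π g f1 x + π g f2 x)),
          (forall g f, memL2 w f -> L2sq w (π g f) = L2sq w f) &
          (forall g f, memL2 w f ->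
             exists2 f', memL2 w f' & aeeq (π g f') f)],
      (forall f, memL2 w f -> aeeq (π (cone R) f) f),
      (forall g h f, memL2 w f -> aeeq (π (cmul g h) f) (π g (π h f))) &
      (forall f, memL2 w f -> continuous_on_group w (fun g => π g f))].

Definition smooth_vector (R : realType) (w : R -> R)
    (π : SL2cover R -> (R -> R[i]) -> R -> R[i]) : set (R -> R[i]) :=
  [set f | memL2 w f /\ smooth_on_group w (fun g => π g f)].

Definition SO2_finite (R : realType) (w : R -> R)
    (π : SL2cover R -> (R -> R[i]) -> R -> R[i]) : set (R -> R[i]) :=
  [set f | memL2 w f /\
     exists n (e : 'I_n -> R -> R[i]),
       (forall i, memL2 w (e i)) /\
       (forall g, SO2cover g -> exists c : 'I_n -> R[i],
          aeeq (π g f) (fun x => \sum_(i < n) c i * e i x))].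

Definition infinitesimal_action (R : realType) (w : R -> R)
    (π : SL2cover R -> (R -> R[i]) -> R -> R[i])
    (X : 'M[R]_2) (f f' : R -> R[i]) : Prop :=
  forall γ, one_parameter_subgroup X γ ->
    L2cvg w (fun (h : R) y => (h^-1)%:C * (π (γ h) f y - f y)) 0^' f'.

(* [Ω] is a version of Ω_{k,a}; elements of W_{k,a} are functions, so the
   space of SO(2)-finite vectors is compared with it up to a.e. equality. *)
Definition is_Omega (R : realType) (S : {fset R}) (k : R -> R) (a : R)
    (Ω : SL2cover R -> (R -> R[i]) -> R -> R[i]) : Prop :=
  [/\ unitary_representation (weight S k a) Ω,
      (forall f, memL2 (weight S k a) f ->
         SO2_finite (weight S k a) Ω f <-> exists2 g, W S k a g & aeeq f g) &
      (forall (X : 'M[R]_2) f, \tr X = 0 -> W S k a f ->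
         infinitesimal_action (weight S k a) Ω X f (omega S k a X f))].

Definition schwartz (R : realType) : set (R -> R[i]) :=
  [set u | (forall n x, derivable (fun y => complex.Re (iter n (@cderive R) u y)) x 1 /\
                        derivable (fun y => complex.Im (iter n (@cderive R) u y)) x 1) /\
           (forall m n, exists M : R, forall x,
              `|x%:C ^+ m * iter n (@cderive R) u x| <= M%:C)].

(* Functions on [0, +oo[ are represented by functions on R whose values on
   negative arguments are irrelevant. *)
Definition schwartz_half_line (R : realType) : set (R -> R[i]) :=
  [set u | exists2 U, schwartz U & forall t, 0 <= t -> u t = U t].

(* A set of elements of L^2, that is, of classes modulo a.e. equality. *)
Definition ka_schwartz (R : realType) (S : {fset R}) (k : R -> R) (a : R)
    (Ω : SL2cover R -> (R -> R[i]) -> R -> R[i]) : set (set (R -> R[i])) :=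
  [set L2class (weight S k a) f | f in smooth_vector (weight S k a) Ω].

(* Main.v *)
(** For N = 1 the space of the representation splits into even and odd
    functions, with orthogonal bases [L_l(tau) exp(- tau / 2)] and
    [x L_l(tau) exp(- tau / 2)], where [tau = (2 / a) |x|^a] and the Laguerre
    parameters are [lambda_{k,a,0}] and [lambda_{k,a,1}].  Both sides of the
    theorem consist of the sums of these bases with rapidly decreasing
    coefficients.
    - If [f = u(|x|^a) + x v(|x|^a)], then integrating by parts against the
      Laguerre equation gives rapidly decreasing coefficients.  Conversely,
      derivatives of the Laguerre functions grow polynomially in [l], so a
      series with such coefficients has one-sided derivatives of all orders on
      [[0, +oo[], and Seeley's reflection extends it to a Schwartz function.
    - If [f] is a smooth vector, pair the derivatives of
      [th |-> Omega(k(th)) f] with a basis element: that element is an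
      eigenvector of so(2) with eigenvalue of order [l], so all the
      derivatives are bounded only if the coefficients decrease rapidly.
      Conversely, [|| Omega(exp(hX)) f - f || <= C |h| || omega(X) f ||] holds
      on finite sums, so the known infinitesimal action on finite sums extends
      to rapidly decreasing ones; in Iwasawa coordinates the iterated partial
      derivatives are then explicit finite sums
      [r exp(p t) s^j Omega(g) f'] with [f'] of the same kind. *)

Require Import Defs.
From mathcomp Require Import all_boot all_order all_algebra finmap.
From mathcomp Require Import complex ring lra.
From mathcomp Require Import all_classical all_reals all_analysis.
From mathcomp Require Import measurable_realfun.

Set Implicit Arguments.
Unset Strict Implicit.
Unset Printing Implicit Defensive.
Import Order.TTheory GRing.Theory Num.Theory.
Import numFieldNormedType.Exports.
Local Open Scope classical_set_scope.
Local Open Scope ring_scope.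

(** * Laguerre functions *)

(** Polynomial growth in [l] comes from one identity: since [phi_l' = - phi_l / 2 - \sum_(j < l)
    phi_j], the derivative of [\sum_(l < n) phi_l ^ 2] is [- (\sum_(l < n) phi_l) ^ 2], so on the
    half line these sums are largest at 0, where [phi_l] is a binomial coefficient. Multiplication
    by [t] and differentiation act on the index [l], with coefficients of polynomial growth. The
    infinitesimal action is given only at the identity and for each finite sum separately, without
    uniformity. Unitarity supplies it: doubling the time at most doubles the norm of
    [Omega(exp(hX)) f - f], so halving [h] repeatedly compares the increment at [h] with the
    derivative at 0. The resulting bound involves only finitely many coefficient seminorms and
    survives truncation. That the Laguerre functions span also needs proof: orthogonality to all of
    them gives vanishing moments against [tau^m exp(- tau / 2)], then against all half lines, and
    Lebesgue differentiation concludes. Complex functions are handled as pairs of real ones, each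
    cut into an even part and [x] times an even function; the odd part is again a Laguerre problem,
    with exponent [s + 2] in place of [s]. *)

Section Laguerre.
Variable R : realType.
Implicit Types (s t : R) (l n : nat).

Lemma gbinom0 s : gbinom s 0 = 1.
Proof. by rewrite /gbinom big_ord0 fact0 divr1. Qed.

Lemma gbinom_absorb s n : n.+1%:R * gbinom (s + 1) n.+1 = (s + 1) * gbinom s n.
Proof.
rewrite /gbinom big_ord_recl subr0 factS natrM.
rewrite (eq_bigr (fun i : 'I_n => s - i%:R)); last first.
  by move=> i _; rewrite /= /bump/= natrD; ring.
have : n`!%:R != 0 :> R by rewrite pnatr_eq0 -lt0n fact_gt0.
have : n.+1%:R != 0 :> R by rewrite pnatr_eq0.
move: (n.+1%:R) (n`!%:R) => A B h1 h2; by field; rewrite ?h1 ?h2.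
Qed.

Lemma gbinom_pascal s n : gbinom (s + 1) n.+1 = gbinom s n.+1 + gbinom s n.
Proof.
have n0 : n.+1%:R != 0 :> R by rewrite pnatr_eq0.
apply: (mulfI n0); rewrite gbinom_absorb mulrDr.
have -> : n.+1%:R * gbinom s n.+1 = (s - n%:R) * gbinom s n.
  rewrite /gbinom big_ord_recr/= factS natrM.
  have : n`!%:R != 0 :> R by rewrite pnatr_eq0 -lt0n fact_gt0.
  move: n0; move: (n.+1%:R) (n`!%:R) => A B h1 h2; by field; rewrite ?h1 ?h2.
rewrite -natr1; ring.
Qed.

Definition lagp s l : {poly R} :=
  \poly_(j < l.+1) ((-1) ^+ j / j`!%:R * gbinom (s + l%:R) (l - j)).

Lemma laguerreE s l t : laguerre s l t = (lagp s l).[t].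
Proof. by rewrite /laguerre /lagp horner_poly. Qed.

Lemma deriv_lagpS s l : (lagp s l.+1)^`() = (lagp s l)^`() - lagp s l.
Proof.
apply/polyP => j; rewrite coefB !coef_deriv /lagp !coef_poly !ltnS subSS.
have f0 k : k`!%:R != 0 :> R by rewrite pnatr_eq0 -lt0n fact_gt0.
have E : (-1) ^+ j.+1 / j.+1`!%:R *+ j.+1 = - ((-1) ^+ j / j`!%:R) :> R.
  rewrite factS natrM exprS -mulr_natl; have := f0 j.
  have : j.+1%:R != 0 :> R by rewrite pnatr_eq0.
  move: (j.+1%:R) (j`!%:R) => A B h1 h2; by field; rewrite ?h1 ?h2.
have E' g : (-1) ^+ j.+1 / j.+1`!%:R * g *+ j.+1 = - ((-1) ^+ j / j`!%:R) * g :> R.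
  by rewrite -mulrnAl E.
have [ltjl|gtjl|Ejl] := ltngtP j l.
- rewrite !E' -addn1 natrD addrA -(subnSK ltjl).
  rewrite gbinom_pascal; ring.
- by rewrite !mul0rn subr0.
- rewrite E' Ejl subnn !gbinom0 mul0rn; ring.
Qed.

Lemma mulX_deriv_lagpS s l :
  'X * (lagp s l.+1)^`() = l.+1%:R *: lagp s l.+1 - (l.+1%:R + s) *: lagp s l.
Proof.
apply/polyP => j; rewrite coefXM coefB !coefZ !coef_deriv /lagp !coef_poly.
case: j => [|j] /=.
  rewrite subn0 expr0 fact0 divr1 !mul1r subn0 -[in s + _]natr1 addrA.
  by rewrite gbinom_absorb -natr1; ring.
rewrite !ltnS !subSS.
have [ltjl|gtjl|->] := ltngtP j l.
- rewrite -(subnSK ltjl); have := gbinom_absorb (s + l%:R) (l - j.+1).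
  rewrite -addrA natr1 subnSK // natrB 1?ltnW // => H.
  rewrite -mulr_natl; set c := _ / _; set G := gbinom _ (l - j) in H *.
  set g := gbinom _ _ in H *.
  transitivity (c * (l.+1%:R * G - (l%:R - j%:R) * G)); first by rewrite -!natr1; ring.
  by rewrite H; ring.
- by rewrite mul0rn !mulr0 subrr.
- by rewrite subnn !gbinom0 mulr0 subr0 -mulr_natl; ring.
Qed.

Definition phi s l t := (lagp s l).[t] * expR (- (t / 2)).

(* The n-th derivative of [phi s l], computed from
   [phi_l' = - phi_l / 2 - \sum_(j < l) phi_j]. *)
Fixpoint dphi s n l t : R :=
  if n is n'.+1 then - (2^-1 * dphi s n' l t) - \sum_(j < l) dphi s n' j t
  else phi s l t.

Lemma is_derive_phi s l t : is_derive t 1 (phi s l)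
  (((lagp s l)^`().[t] - 2^-1 * (lagp s l).[t]) * expR (- (t / 2))).
Proof.
rewrite /phi.
have He : is_derive t 1 (fun t : R => expR (- (t / 2))) (expR (- (t / 2)) * (- 2^-1)).
  apply: (@is_derive1_comp R expR (fun t => - (t / 2)) t).
  apply: (@is_derive_eq _ _ _ (fun t => - (t / 2))).
  by rewrite /GRing.scale /=; ring.
have H := is_deriveM (is_derive_poly (lagp s l) t) He.
apply: (is_derive_eq H).
rewrite /GRing.scale /=; ring.
Qed.

Lemma deriv_lagp s l : (lagp s l)^`() = - \sum_(j < l) lagp s j.
Proof.
elim: l => [|l IH]; last by rewrite deriv_lagpS IH big_ord_recr opprD.
rewrite big_ord0 oppr0 /lagp; apply/polyP => j.
by rewrite coef_deriv coef_poly coef0 mul0rn.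
Qed.

Lemma is_derive_phiS s l t :
  is_derive t 1 (phi s l) (dphi s 1 l t).
Proof.
apply: (is_derive_eq (is_derive_phi s l t)).
rewrite deriv_lagp /= /phi hornerN horner_sum -mulr_suml; ring.
Qed.

Lemma is_derive_dphi s n l t :
  is_derive t 1 (dphi s n l) (dphi s n.+1 l t).
Proof.
elim: n l => [|n IH] l; first exact: is_derive_phiS.
rewrite (_ : dphi s n.+1 l = (- 2^-1) *: dphi s n l - \sum_(j < l) dphi s n j); last first.
  by apply/funext => x /=; rewrite !fctE /GRing.scale/= fct_sumE; ring.
have H1 := is_deriveZ (- 2^-1) (IH l).
have H2 := is_derive_sum (fun i : 'I_l => IH i).
apply: (is_derive_eq (is_deriveB H1 H2)).
by rewrite /GRing.scale/=; congr (_ + _); ring.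
Qed.

(** The derivative of [phi_l ^ 2] is [- phi_l ^ 2 - 2 phi_l \sum_(j < l) phi_j], which is minus the
    increment of [(\sum_(j < l) phi_j) ^ 2] when the term [l] is added. *)
Lemma is_derive_cst_sum_sq s n t :
  is_derive t 1 (fun t => \sum_(l < n) phi s l t ^+ 2)
    (- (\sum_(l < n) phi s l t) ^+ 2).
Proof.
elim: n => [|n IH].
  rewrite big_ord0 expr0n oppr0 (_ : (fun _ => _) = cst 0); last first.
    by apply/funext => x; rewrite big_ord0.
  exact: is_derive_cst.
rewrite (_ : (fun _ => _) = (fun t => \sum_(l < n) phi s l t ^+ 2) + phi s n ^+ 2); last first.
  by apply/funext => x; rewrite big_ord_recr.
have H := is_deriveX 2 (is_derive_phiS s n t).
apply: (is_derive_eq (is_deriveD IH H)).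
have -> : dphi s 1 n t = - (2^-1 * phi s n t) - \sum_(j < n) phi s j t by [].
rewrite /GRing.scale /= big_ord_recr /=; set x := phi s n t; set y := \sum_(_ < _) _.
by rewrite expr1; field.
Qed.

Lemma phi_sq_sum_le s n t : 0 <= t ->
  \sum_(l < n) phi s l t ^+ 2 <= \sum_(l < n) phi s l 0 ^+ 2.
Proof.
rewrite le_eqVlt => /predU1P[<-//|t0].
have D x := is_derive_cst_sum_sq s n x.
apply: (@ler0_derive1_le_cc R (fun t => \sum_(l < n) phi s l t ^+ 2) 0 t) => //.
- by move=> x _; rewrite derive1E derive_val oppr_le0 sqr_ge0.
- apply: derivable_within_continuous => x _; exact: (@ex_derive _ _ _ _ _ _ _ (D x)).
- by rewrite in_itv/= lexx ltW.
- by rewrite in_itv/= lexx ltW.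
- exact: ltW.
Qed.

(** The base [l.+1] is at least 1, so bounds with different exponents can be merged
    ([pbound_wd]). *)
Definition pbound (f : nat -> R -> R) := exists (C : R) (P : nat), 0 <= C /\
  forall l t, 0 <= t -> `|f l t| <= C * l.+1%:R ^+ P.

Lemma pbound_wd (C : R) P (D : R) Q l : 0 <= C -> C <= D -> (P <= Q)%N ->
  C * l.+1%:R ^+ P <= D * l.+1%:R ^+ Q.
Proof.
move=> C0 CD PQ; apply: ler_pM => //.
by rewrite ?exprn_ge0 //; apply: ler_weXn2l => //; rewrite ler1n.
Qed.

Lemma pboundD f g : pbound f -> pbound g -> pbound (fun l t => f l t + g l t).
Proof.
move=> [C [P [C0 fC]]] [D [Q [D0 gD]]]; exists (C + D), (maxn P Q); split.
  exact: addr_ge0.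
move=> l t t0; rewrite (le_trans (ler_normD _ _))// mulrDl lerD//.
  apply: le_trans (fC l t t0) _; apply: pbound_wd => //; exact: leq_maxl.
apply: le_trans (gD l t t0) _; apply: pbound_wd => //; exact: leq_maxr.
Qed.

Lemma pboundM f g : pbound f -> pbound g -> pbound (fun l t => f l t * g l t).
Proof.
move=> [C [P [C0 fC]]] [D [Q [D0 gD]]]; exists (C * D), (P + Q)%N; split.
  exact: mulr_ge0.
move=> l t t0; rewrite normrM exprD mulrACA; apply: ler_pM => //.
  exact: fC.
exact: gD.
Qed.

Lemma pbound_cst (c : R) : pbound (fun _ _ => c).
Proof.
by exists `|c|, 0%N; split => // l t _; rewrite expr0 mulr1.
Qed.

Lemma pbound_nat : pbound (fun l _ => l%:R).
Proof.
exists 1, 1%N; split => // l t _; rewrite expr1 mul1r ger0_norm // ler_nat.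
exact: leqnSn.
Qed.

Lemma pboundS f : pbound f -> pbound (fun l => f l.+1).
Proof.
move=> [C [P [C0 fC]]]; exists (C * 2 ^+ P), P; split.
  by rewrite mulr_ge0// exprn_ge0.
move=> l t t0; apply: (le_trans (fC _ _ t0)); rewrite -mulrA ler_wpM2l//.
rewrite -exprMn lerXn2r ?nnegrE ?mulr_ge0//.
by rewrite -natrM ler_nat mulSn mul1n addSn addnS ltnS ltnS leq_addr.
Qed.

Lemma pbound_pred f : pbound f -> pbound (fun l t => if l is k.+1 then f k t else 0).
Proof.
move=> [C [P [C0 fC]]]; exists C, P; split => // -[|l] t t0.
  by rewrite normr0 mulr_ge0// exprn_ge0.
apply: (le_trans (fC _ _ t0)); rewrite ler_wpM2l// lerXn2r ?nnegrE//.
by rewrite ler_nat.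
Qed.

Lemma pbound_sum f : pbound f -> pbound (fun l t => \sum_(j < l) f j t).
Proof.
move=> [C [P [C0 fC]]]; exists C, P.+1; split => // l t t0.
apply: (le_trans (ler_norm_sum _ _ _)).
apply: (@le_trans _ _ (\sum_(j < l) C * l.+1%:R ^+ P)).
  apply: ler_sum => j _; apply: (le_trans (fC _ _ t0)).
  by rewrite ler_wpM2l// lerXn2r ?nnegrE// ler_nat ltnW// ltnS.
rewrite sumr_const card_ord -[_ *+ l]mulr_natr -mulrA exprSr ler_wpM2l //.
by rewrite ler_wpM2l ?exprn_ge0// ler_nat.
Qed.

Lemma eq_pbound f g : (forall l t, 0 <= t -> f l t = g l t) -> pbound g -> pbound f.
Proof.
move=> e [C [P [C0 gC]]]; exists C, P; split=> // l t t0; rewrite e//; exact: gC.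
Qed.

(** The value at 0 is the binomial coefficient of [s + l] over [l]. Consecutive values have ratio
    [(s + l + 1) / (l + 1)], of absolute value at most [1 + M / (l + 1)] with [M >= |s|], and by
    Bernoulli this is at most [((l + 2) / (l + 1)) ^ M]. *)
Lemma phi0_pbound s : pbound (fun l _ => phi s l 0).
Proof.
pose M := (Num.trunc `|s|).+1.
have sM : `|s| <= M%:R by rewrite ltW// Num.Theory.truncnS_gt.
have E l : phi s l 0 = gbinom (s + l%:R) l.
  rewrite /phi mul0r oppr0 expR0 mulr1 horner_coef0 /lagp coef_poly /=.
  by rewrite fact0 expr0 divr1 mul1r subn0.
exists 1, M; split => // l t _; rewrite E mul1r.
elim: l => [|l IH]; first by rewrite gbinom0 normr1 expr1n.
have l0 : (0 : R) < l.+1%:R by rewrite ltr0n.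
rewrite -(ler_pM2l l0) -{1}(ger0_norm (ltW l0)) -normrM -[in s + _]natr1 addrA.
rewrite gbinom_absorb normrM.
have : `|s + l%:R + 1| <= M%:R + l.+1%:R.
  by rewrite -addrA natr1 (le_trans (ler_normD _ _))// lerD// ger0_norm.
move=> H; apply: (@le_trans _ _ ((M%:R + l.+1%:R) * l.+1%:R ^+ M)).
  by apply: ler_pM.
have B : 1 + M%:R * l.+1%:R^-1 <= (1 + l.+1%:R^-1) ^+ M :> R.
  elim: (M) => [|k IHk]; first by rewrite mul0r addr0 expr0.
  rewrite exprS; apply: (@le_trans _ _ ((1 + l.+1%:R^-1) * (1 + k%:R * l.+1%:R^-1))).
    have : 0 <= k%:R * l.+1%:R^-1 * l.+1%:R^-1 :> R by rewrite !mulr_ge0// invr_ge0.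
    by rewrite -natr1; set x := _^-1; nra.
  by apply: ler_wpM2l => //; rewrite addr_ge0// invr_ge0.
have -> : l.+2%:R = l.+1%:R * (1 + l.+1%:R^-1) :> R.
  by rewrite mulrDr mulr1 divff ?gt_eqF// natr1.
rewrite exprMn; apply: (@le_trans _ _ (l.+1%:R * (l.+1%:R ^+ M * (1 + M%:R / l.+1%:R)))).
  rewrite le_eqVlt; apply/orP; left; apply/eqP.
  have := lt0r_neq0 l0; move: (l.+1%:R ^+ M : R) (l.+1%:R : R) (M%:R : R) => A B' D h.
  by field.
by rewrite ler_wpM2l// ler_wpM2l// exprn_ge0.
Qed.

(** One square is at most the sum of squares up to [l], which is largest at 0, where [phi0_pbound]
    applies to each term. A bound [D y] on a square with [y >= 1] gives [(1 + D) y] on the absolute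
    value. *)
Lemma phi_pbound s : pbound (phi s).
Proof.
have [C [P [C0 H]]] := pbound_sum (pboundS (pbound_cst 1)).
have [D [Q [D0 B]]] := pboundS (pbound_sum (pboundM (phi0_pbound s) (phi0_pbound s))).
exists (1 + D), Q; split; first by rewrite addr_ge0.
move=> l t t0.
have h : phi s l t ^+ 2 <= D * l.+1%:R ^+ Q.
  apply: le_trans _ (B l t t0); apply: le_trans _ (ler_norm _).
  apply: (@le_trans _ _ (\sum_(j < l.+1) phi s j t ^+ 2)).
    by rewrite big_ord_recr /= lerDr sumr_ge0// => i _; rewrite sqr_ge0.
  by rewrite (le_trans (phi_sq_sum_le _ _ t0))// ler_sum// => i _; rewrite expr2.
have : 1 <= l.+1%:R ^+ Q :> R by rewrite exprn_ege1// ler1n.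
rewrite ler_norml; set x := phi s l t in h *; set y := l.+1%:R ^+ Q in h *.
by move=> y1; apply/andP; split; nra.
Qed.

Lemma pboundZ (c : R) f : pbound f -> pbound (fun l t => c * f l t).
Proof. by move=> ?; apply: pboundM => //; exact: pbound_cst. Qed.

Lemma mulX_deriv_lagp s l t : t * (lagp s l)^`().[t] =
  l%:R * (lagp s l).[t] - (l%:R + s) * (if l is k.+1 then (lagp s k).[t] else 0).
Proof.
case: l => [|l].
  have -> : (lagp s 0)^`() = 0 by rewrite deriv_lagp big_ord0 oppr0.
  by rewrite horner0 !mulr0 mul0r subrr.
have := congr1 (horner^~ t) (mulX_deriv_lagpS s l).
by rewrite !hornerE.
Qed.

Lemma lagp_3term s l t :
  l.+1%:R * (lagp s l.+1).[t] =
  (2 * l%:R + s + 1 - t) * (lagp s l).[t]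
  - (l%:R + s) * (if l is k.+1 then (lagp s k).[t] else 0).
Proof.
have := mulX_deriv_lagp s l.+1 t; have := mulX_deriv_lagp s l t.
rewrite deriv_lagpS !hornerE mulrBr => -> /=; rewrite -!natr1 => H.
rewrite [LHS](_ : _ = (l%:R + 1) * (lagp s l.+1).[t] - (l%:R + 1 + s) * (lagp s l).[t] + (l%:R + 1 + s) * (lagp s l).[t]); last by ring.
by rewrite -H; ring.
Qed.

Definition phim1 s l t := if l is k.+1 then phi s k t else 0.

Lemma mulX_phi s l t : t * phi s l t =
  - l.+1%:R * phi s l.+1 t + (2 * l%:R + s + 1) * phi s l t - (l%:R + s) * phim1 s l t.
Proof.
rewrite /phim1 /phi mulrA mulrAC mulNr mulrA lagp_3term.
case: l => [|k]; ring.
Qed.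

(** Each factor [t] is traded, by [mulX_phi], for shifts of the index with coefficients affine in
    [l], so the decay in [t] is inherited from the uniform bound on [phi]. *)
Lemma mulXn_phi_pbound s m : pbound (fun l t => t ^+ m * phi s l t).
Proof.
elim: m => [|m IH].
  by apply: (eq_pbound _ (phi_pbound s)) => l t _; rewrite expr0 mul1r.
apply: (@eq_pbound _ (fun l t => (- 1) * (l.+1%:R * (t ^+ m * phi s l.+1 t)) +
   (2 * l%:R + (s + 1)) * (t ^+ m * phi s l t) + (- 1) *
   ((l%:R + s) * (if l is k.+1 then t ^+ m * phi s k t else 0)))).
  move=> l t _; rewrite exprSr -mulrA mulX_phi /phim1; case: l => [|k]; ring.
have h c : pbound (fun l _ => l%:R + c) by apply: pboundD; [exact: pbound_nat|exact: pbound_cst].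
apply: pboundD; first apply: pboundD.
- apply: pboundZ; apply: pboundM; first exact: (pboundS pbound_nat).
  exact: (pboundS IH).
- by apply: pboundM => //; apply: pboundD; [apply: pboundZ; exact: pbound_nat|exact: pbound_cst].
- by apply: pboundZ; apply: pboundM; [exact: h|exact: (pbound_pred IH)].
Qed.

Lemma mulXn_dphi_pbound s m n : pbound (fun l t => t ^+ m * dphi s n l t).
Proof.
elim: n => [|n IH]; first exact: mulXn_phi_pbound.
apply: (@eq_pbound _ (fun l t => (- 2^-1) * (t ^+ m * dphi s n l t)
   + (-1) * \sum_(j < l) t ^+ m * dphi s n j t)).
  by move=> l t _; rewrite /= -mulr_sumr; ring.
by apply: pboundD; apply: pboundZ => //; exact: (pbound_sum IH).
Qed.

(** Differentiate [mulX_deriv_lagpS] and eliminate the derivative of index [l] by [deriv_lagpS]. *)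
Lemma lagp_ode s l t :
  t * (lagp s l)^`()^`().[t] + (s + 1 - t) * (lagp s l)^`().[t]
  + l%:R * (lagp s l).[t] = 0.
Proof.
case: l => [|l].
  have -> : (lagp s 0)^`() = 0 by rewrite deriv_lagp big_ord0 oppr0.
  by rewrite linear0 horner0 !mulr0 mul0r !addr0.
have E := mulX_deriv_lagpS s l.
have := congr1 (fun p => (p^`()).[t]) E; have := congr1 (horner^~ t) E.
rewrite derivM derivX derivB !derivZ mul1r.
have -> : (lagp s l)^`() = (lagp s l.+1)^`() + lagp s l.
  by rewrite deriv_lagpS subrK.
rewrite !hornerE; set a := (lagp s l.+1)^`()^`().[t].
set b := (lagp s l.+1)^`().[t]; set c := (lagp s l.+1).[t].
set d := (lagp s l).[t]; set e := l.+1%:R.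
move=> H1 H2.
have -> : t * a = e * b - (e + s) * (b + d) - b by rewrite -H2; ring.
have -> : (s + 1 - t) * b = (s + 1) * b - (e * c - (e + s) * d).
  by rewrite -H1; ring.
ring.
Qed.

Lemma dphi2E s l t :
  dphi s 2 l t = ((lagp s l)^`()^`().[t] - (lagp s l)^`().[t] + 4^-1 * (lagp s l).[t])
    * expR (- (t / 2)).
Proof.
have H := is_derive_dphi s 1 l t.
have E : dphi s 1 l = (fun t => ((lagp s l)^`() - 2^-1 *: lagp s l).[t] * expR (- (t / 2))).
  apply/funext => x; have H1 := is_derive_phi s l x; have H2 := is_derive_phiS s l x.
  rewrite -(@derive_val _ _ _ _ _ _ _ H2) (@derive_val _ _ _ _ _ _ _ H1).
  by rewrite !hornerE.
rewrite -(@derive_val _ _ _ _ _ _ _ H) E.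
have He : is_derive t 1 (fun t : R => expR (- (t / 2))) (expR (- (t / 2)) * (- 2^-1)).
  apply: (@is_derive1_comp R expR (fun t => - (t / 2)) t).
  apply: (@is_derive_eq _ _ _ (fun t => - (t / 2))).
  by rewrite /GRing.scale /=; ring.
have H' := is_deriveM (is_derive_poly ((lagp s l)^`() - 2^-1 *: lagp s l) t) He.
rewrite (@derive_val _ _ _ _ _ _ _ H') /GRing.scale/= derivB derivZ !(hornerD, hornerN, hornerZ).
by field.
Qed.

Lemma dphi1E s l t :
  dphi s 1 l t = ((lagp s l)^`().[t] - 2^-1 * (lagp s l).[t]) * expR (- (t / 2)).
Proof.
have H1 := is_derive_phi s l t; have H2 := is_derive_phiS s l t.
by rewrite -(@derive_val _ _ _ _ _ _ _ H2) (@derive_val _ _ _ _ _ _ _ H1).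
Qed.

Lemma phi_ode s l t :
  t * dphi s 2 l t + (s + 1) * dphi s 1 l t =
  (t / 4 - (l%:R + (s + 1) / 2)) * phi s l t.
Proof.
rewrite dphi2E dphi1E /phi; have := lagp_ode s l t.
set a := (lagp s l)^`()^`().[t]; set b := (lagp s l)^`().[t]; set c := (lagp s l).[t].
move=> H; rewrite -[RHS]addr0 -(mul0r (expR (- (t / 2)))) -H; by field.
Qed.

(** In the variable [tau] the operator [omega(h)] becomes [2 t d/dt + s + 1]; this relation shows it
    as raising minus lowering. *)
Lemma euler_phi s l t :
  2 * (t * dphi s 1 l t) + (s + 1) * phi s l t =
  l.+1%:R * phi s l.+1 t - (l%:R + s) * phim1 s l t.
Proof.
rewrite dphi1E; have := mulX_deriv_lagp s l t.
set b := (lagp s l)^`().[t] => H.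
transitivity ((2 * (t * b) + (s + 1 - t) * (lagp s l).[t]) * expR (- (t / 2))).
  by rewrite /phi; field.
rewrite H /phi mulrA lagp_3term /phim1 /phi; case: l {b H} => [|l]; ring.
Qed.

End Laguerre.

(** * Rapidly decreasing series and Seeley's extension *)

Section AbsSums.
Variable R : realType.
Implicit Types (f g : nat -> R) (M : R).

Definition series_sum f : R := limn (series f).
Definition abs_sums_le f M := forall n, \sum_(k < n) `|f k| <= M.

Lemma abs_sums_le_cvg f M : abs_sums_le f M -> cvgn (series f).
Proof.
move=> fM; apply: normed_cvg; apply: nondecreasing_is_cvgn.
  by apply: nondecreasing_series => k _ _; exact: normr_ge0.
exists M => _ [n _ <-]; have := fM n; rewrite -(big_mkord xpredT (fun k => `|f k|)).
exact.
Qed.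

Lemma abs_sums_le_series_sum f M : abs_sums_le f M -> `|series_sum f| <= M.
Proof.
move=> fM; have cf := abs_sums_le_cvg fM.
have cn : (fun n => `|series f n|) @ \oo --> `|series_sum f| by exact: cvg_norm.
rewrite -(cvg_lim _ cn)//; apply: limr_le; first by apply: cvgP; exact: cn.
apply: nearW => n; rewrite /series/= big_mkord (le_trans (ler_norm_sum _ _ _))//.
Qed.

Lemma abs_sums_le_le f g M : (forall k, `|f k| <= `|g k|) -> abs_sums_le g M -> abs_sums_le f M.
Proof. by move=> fg gM n; apply: le_trans (gM n); apply: ler_sum. Qed.

Lemma abs_sums_leZ c f M : abs_sums_le f M -> abs_sums_le (fun k => c * f k) (`|c| * M).
Proof.
move=> fM n; rewrite (eq_bigr (fun k : 'I_n => `|c| * `|f k|)); last by move=> ?; rewrite normrM.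
by rewrite -mulr_sumr ler_wpM2l//; exact: fM.
Qed.

Lemma abs_sums_leS f M : abs_sums_le f M -> abs_sums_le (fun k => f k.+1) M.
Proof.
move=> fM n; apply: le_trans (fM n.+1).
by rewrite big_ord_recl/= lerDr.
Qed.

Lemma series_sumD f g : cvgn (series f) -> cvgn (series g) ->
  series_sum (fun k => f k + g k) = series_sum f + series_sum g.
Proof. exact: lim_seriesD. Qed.

Lemma series_sumZ c f : cvgn (series f) -> series_sum (fun k => c * f k) = c * series_sum f.
Proof. exact: lim_seriesZ. Qed.

Lemma series_sumB f g : cvgn (series f) -> cvgn (series g) ->
  series_sum (fun k => f k - g k) = series_sum f - series_sum g.
Proof. exact: lim_seriesB. Qed.

Lemma series_sumS f : cvgn (series f) -> series_sum f = f 0%N + series_sum (fun k => f k.+1).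
Proof.
move=> cf; rewrite /series_sum.
have E : series (fun k => f k.+1) = (fun n => series f n.+1 - f 0%N).
  apply/funext => n; rewrite /series/= !big_mkord big_ord_recl/=.
  by rewrite addrC addKr.
suff -> : limn (series (fun k => f k.+1)) = limn (series f) - f 0%N by rewrite subrKC.
rewrite E; apply/cvg_lim => //; apply: cvgB; last exact: cvg_cst.
by rewrite (cvg_shiftS (series f)).
Qed.

Lemma eq_series_sum f g : f =1 g -> series_sum f = series_sum g.
Proof. by move=> /funext ->. Qed.

Lemma series_sum_eventually0 f n : (forall k, (n <= k)%N -> f k = 0) ->
  series_sum f = \sum_(k < n) f k.
Proof.
move=> f0; apply/cvg_lim => //; apply: cvg_near_cst; exists n => //= m /= nm; apply/eqP.
rewrite /series/= -(big_mkord xpredT f) (@big_cat_nat _ _ _ n 0 m)//=.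
rewrite (_ : \sum_(n <= k < m) f k = 0).
  by rewrite addr0 big_mkord.
by rewrite big_nat big1// => k /andP[nk _]; rewrite f0.
Qed.

Lemma abs_sums_le_ratio f K : (forall k, (K <= k)%N -> `|f k.+1| <= 2^-1 * `|f k|) ->
  exists M, abs_sums_le f M.
Proof.
move=> fK; exists (\sum_(k < K) `|f k| + 2 * `|f K|) => n.
(* The partial sum plus twice the next term does not increase with [j]. *)
have H j : \sum_(k < j) `|f (K + k)%N| + 2 * `|f (K + j)%N| <= 2 * `|f K|.
  elim: j => [|j IH]; first by rewrite big_ord0 add0r addn0.
  apply: le_trans IH; rewrite big_ord_recr/= addnS.
  have := fK (K + j)%N (leq_addr _ _); lra.
apply: (@le_trans _ _ (\sum_(k < K + n) `|f k|)).
  rewrite -!(big_mkord xpredT (fun k => `|f k|)).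
  by rewrite (@big_cat_nat _ _ _ n 0 (K + n))//= ?leq_addl// lerDl sumr_ge0.
rewrite big_split_ord/= lerD2l; apply: le_trans (H n).
by rewrite lerDl mulr_ge0.
Qed.

Definition rapid f := forall P, exists C, forall l, `|f l| * l.+1%:R ^+ P <= C.

Lemma sum_inv_sq n : \sum_(k < n) (k.+1%:R ^+ 2)^-1 <= 2 :> R.
Proof.
(* The sharper bound is inductive, because [1 / (n+2)^2 <= 1 / (n+1) - 1 / (n+2)]. *)
suff : \sum_(k < n.+1) (k.+1%:R ^+ 2)^-1 <= 2 - n.+1%:R^-1 :> R.
  have : 0 <= (n.+1%:R ^+ 2)^-1 :> R by rewrite invr_ge0 exprn_ge0.
  have : 0 <= n.+1%:R^-1 :> R by rewrite invr_ge0.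
  by rewrite big_ord_recr/=; move: (n.+1%:R ^- 2) (n.+1%:R^-1) (\sum_(k < n) _) => A B D; lra.
elim: n => [|n IH]; first by rewrite big_ord_recl big_ord0 expr1n invr1; lra.
rewrite big_ord_recr/=; apply: (le_trans (lerD IH (lexx _))).
have : 0 < n.+1%:R :> R by [].
rewrite -[in n.+2%:R]natr1; move: (n.+1%:R : R) => x x0.
rewrite -subr_ge0 [leRHS](_ : _ = (x * (x + 1) ^+ 2)^-1); last first.
  by field; rewrite !gt_eqF//; lra.
by rewrite invr_ge0 mulr_ge0 ?exprn_ge0//; lra.
Qed.

Lemma rapid_pbound_abs_sums_le c h : rapid c -> pbound h ->
  exists M, forall t, 0 <= t -> abs_sums_le (fun l => c l * h l t) M.
Proof.
(* Two powers beyond the growth of [h] leave the summable factor [1 / (l+1)^2]. *)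
move=> rc [C [P [C0 hC]]]; have [D cD] := rc P.+2.
have D0 : 0 <= D by apply: le_trans (cD 0%N); rewrite mulr_ge0// exprn_ge0.
exists (D * C * 2) => t t0 n.
apply: (@le_trans _ _ (\sum_(k < n) (D * C) * (k.+1%:R ^+ 2)^-1)); last first.
  by rewrite -mulr_sumr ler_wpM2l ?mulr_ge0// sum_inv_sq.
apply: ler_sum => k _; rewrite normrM.
have k0 : (0 : R) < k.+1%:R ^+ 2 by rewrite exprn_gt0.
rewrite -(ler_pM2r k0) -[leRHS]mulrA mulVf ?gt_eqF// mulr1.
apply: (@le_trans _ _ (`|c k| * (C * k.+1%:R ^+ P) * k.+1%:R ^+ 2)).
  by rewrite ler_pM2r// ler_wpM2l// hC.
have := cD k; rewrite -addn2 exprD => H.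
rewrite [leLHS](_ : _ = (`|c k| * (k.+1%:R ^+ P * k.+1%:R ^+ 2)) * C); last by ring.
by rewrite ler_wpM2r.
Qed.

End AbsSums.

(** * Schwartz functions through one-sided Taylor estimates *)

Section HalfSchwartz.
Variable R : realType.

(* One-sided derivatives of all orders at 0, in the form of first-order Taylor
   estimates for the successive derivatives [v n]. *)
Definition half_schwartz (u : R -> R) := exists v : nat -> R -> R,
  [/\ (forall t : R, 0 <= t -> u t = v 0%N t),
      (forall n, exists C : R, forall s t : R, 0 <= s -> 0 <= t ->
         `|v n s - v n t - (s - t) * v n.+1 t| <= C * (s - t) ^+ 2) &
      (forall m n, exists C : R, forall t : R, 0 <= t -> `|t ^+ m * v n t| <= C)].

(** The successive derivatives are carried as a witness, so that each closure property only has to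
    name them. *)
Definition real_schwartz (u : R -> R) := exists v : nat -> R -> R,
  [/\ u = v 0%N, (forall n (x : R), is_derive x (1 : R) (v n) (v n.+1 x)) &
      (forall m n, exists C : R, forall x, `|x ^+ m * v n x| <= C)].

(** The mean value theorem is applied twice, at points between [x] and [y], hence still on the half
    line where [f2] is bounded. The constant is [G] rather than [G / 2]. *)
Lemma taylor2 (f f1 f2 : R -> R) (G : R) :
  (forall x : R, is_derive x (1 : R) f (f1 x)) -> (forall x : R, is_derive x (1 : R) f1 (f2 x)) ->
  (forall x : R, 0 <= x -> `|f2 x| <= G) ->
  forall x y : R, 0 <= x -> 0 <= y -> `|f x - f y - (x - y) * f1 y| <= G * (x - y) ^+ 2.
Proof.
move=> d1 d2 f2G x y x0 y0.
have G0 : 0 <= G by apply: le_trans (f2G 0 _).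
have mvt (g g1 : R -> R) (a b : R) : (forall x : R, is_derive x (1 : R) g (g1 x)) ->
    0 <= a -> 0 <= b ->
    exists c, [/\ 0 <= c, `|c - a| <= `|b - a| & g b - g a = g1 c * (b - a)].
  move=> dg a0 b0; have cg : continuous g.
    by move=> z; apply: differentiable_continuous; apply/derivable1_diffP; exact: (@ex_derive _ _ _ _ _ _ _ (dg z)).
  have [ab|ba] := leP a b.
    have [c] := MVT_segment ab (fun z _ => dg z) (continuous_subspaceT cg).
    rewrite in_itv/= => /andP[ac cb] E; exists c; split => //.
      exact: le_trans ac.
    by rewrite !ger0_norm ?subr_ge0 ?lerB.
  have [c] := MVT_segment (ltW ba) (fun z _ => dg z) (continuous_subspaceT cg).
  rewrite in_itv/= => /andP[ac cb] E; exists c; split => //.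
    exact: le_trans ac.
    have ba' := ltW ba; rewrite ler0_norm ?subr_le0// ler0_norm ?subr_le0//.
    by rewrite lerN2 lerB.
  by rewrite -[RHS]opprK -mulrN opprB -E opprB.
have [c [c0 cl ->]] := mvt _ _ y x d1 y0 x0.
have [e [e0 _ E]] := mvt _ _ y c d2 y0 c0.
rewrite -(real_normK (num_real (x - y))) [X in X - _]mulrC -mulrBr mulrC E !normrM expr2 mulrA.
by rewrite ler_wpM2r// ler_pM ?f2G.
Qed.

(** A Taylor estimate is linear in the function, so it can be summed term by term with the constants
    [G * l.+1 ^ P] coming from the second derivatives; this is how the series is differentiated. *)
Lemma phi_series_half_schwartz (s : R) (c : nat -> R) : rapid c ->
  half_schwartz (fun t => series_sum (fun l => c l * phi s l t)).
Proof.
move=> rc; have B n := rapid_pbound_abs_sums_le rc (mulXn_dphi_pbound s 0 n).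
have cv n t : 0 <= t -> cvgn (series (fun l => c l * dphi s n l t)).
  move=> t0; have [M H] := B n; apply: (@abs_sums_le_cvg _ _ M).
  by have := H t t0; under eq_fun do rewrite expr0 mul1r.
exists (fun n t => series_sum (fun l => c l * dphi s n l t)); split => // [n|m n].
- have [G [P [G0 HG]]] := mulXn_dphi_pbound s 0 n.+2.
  have [M HM] : exists M, forall t : R, 0 <= t -> abs_sums_le (fun l => c l * (G * l.+1%:R ^+ P)) M.
    apply: (@rapid_pbound_abs_sums_le _ _ (fun l _ => G * l.+1%:R ^+ P)) => //.
    by exists G, P; split => // l t _; rewrite ger0_norm// mulr_ge0// exprn_ge0.
  exists M => x y x0 y0.
  rewrite -series_sumB; [|exact: cv|exact: cv].
  rewrite -series_sumZ; last exact: cv.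
  rewrite -series_sumB; first last.
  - apply: is_cvg_seriesZ; exact: cv.
  - by apply: is_cvg_seriesB; exact: cv.
  rewrite mulrC -[X in X * M](ger0_norm (sqr_ge0 _)).
  apply: abs_sums_le_series_sum; apply: (@abs_sums_le_le _ _ (fun l => (x - y) ^+ 2 * (c l * (G * l.+1%:R ^+ P)))).
    move=> l.
    have := taylor2 (is_derive_dphi s n l) (is_derive_dphi s n.+1 l) _ x0 y0.
    move=> /(_ (G * l.+1%:R ^+ P)) T.
    rewrite [X in `|X| <= _](_ : _ = c l * (dphi s n l x - dphi s n l y - (x - y) * dphi s n.+1 l y)); last by ring.
    rewrite normrM mulrCA normrM ler_wpM2l// normrM [leRHS]mulrC.
    rewrite [X in _ <= X * _]ger0_norm; last by rewrite mulr_ge0// exprn_ge0.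
    rewrite [X in _ <= _ * X]ger0_norm ?sqr_ge0//; apply: T => z z0.
    by have := HG l z z0; rewrite expr0 mul1r.
  by apply: abs_sums_leZ; exact: (HM 0).
- have [M H] := rapid_pbound_abs_sums_le rc (mulXn_dphi_pbound s m n).
  exists M => t t0; rewrite -series_sumZ; last exact: cv.
  apply: abs_sums_le_series_sum; apply: abs_sums_le_le (H t t0) => l.
  by rewrite mulrCA.
Qed.

End HalfSchwartz.

(** * The coefficients of Seeley's reflection *)

Section Seeley.
Variable R : realType.

(* The coefficients satisfy
   [\sum_k seeley_a k * 4^(k n) = (-1)^n * \sum_k seeley_a k] for every [n].
   They come from the entire function [B z = \prod_(j >= 1) (1 - 4^-j z)], which
   has the coefficients [seeley_b k] and vanishes at [4^n] for [n > 0]. *)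
Fixpoint seeley_b (k : nat) : R :=
  if k is k'.+1 then - (4 ^- k / (1 - 4 ^- k)) * seeley_b k' else 1.

Definition seeley_a k : R := seeley_b k / (1 + 4 ^- k).

Lemma expV4_bounds k : 0 < 4 ^- k :> R /\ 4 ^- k.+1 <= 4^-1 :> R.
Proof.
split; first by rewrite invr_gt0 exprn_gt0.
by rewrite lef_pV2 ?posrE ?exprn_gt0// exprS ler_peMr// exprn_ege1// ler1n.
Qed.

Lemma seeley_b_ratio k :
  `|seeley_b k.+1| <= (4/3 * 4 ^- k.+1) * `|seeley_b k|.
Proof.
have [h1 _] := expV4_bounds k.+1; have [_ h2] := expV4_bounds k.
rewrite [seeley_b _]/= normrM ler_wpM2r// normrN ger0_norm; last first.
  by rewrite divr_ge0 ?subr_ge0; lra.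
by rewrite ler_pdivrMr; nra.
Qed.

Lemma seeley_abs_sums_le (n : nat) (g : nat -> R) : (forall k, `|g k| <= 1) ->
  exists M, abs_sums_le (fun k => seeley_b k * 4 ^+ k ^+ n * g k) M.
Proof.
move=> g1; have [M HM] : exists M, abs_sums_le (fun k => seeley_b k * 4 ^+ k ^+ n) M.
  (* For [k >= n] the ratio of consecutive terms is at most [4/3 * 4^-(k+1) * 4^n <= 1/3]. *)
  apply: (@abs_sums_le_ratio _ _ n) => k nk.
  rewrite (normrM (seeley_b k.+1)) (normrM (seeley_b k)).
  apply: (@le_trans _ _ (4/3 * 4 ^- k.+1 * `|seeley_b k| * `|4 ^+ k.+1 ^+ n|)).
    by rewrite ler_wpM2r// seeley_b_ratio.
  have pos m : `|4 ^+ m ^+ n| = 4 ^+ m ^+ n :> R by rewrite ger0_norm ?exprn_ge0.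
  rewrite !pos [in X in _ * X <= _]exprS exprMn.
  rewrite [leLHS](_ : _ = (4/3 * (4 ^- k.+1 * 4 ^+ n)) * (`|seeley_b k| * 4 ^+ k ^+ n)); last by ring.
  rewrite ler_wpM2r ?mulr_ge0 ?exprn_ge0//.
  have : 4 ^- k.+1 * 4 ^+ n <= 4^-1 :> R.
    rewrite exprS invfM -mulrA ler_piMr// ler_pdivrMl ?exprn_gt0// mulr1.
    by rewrite ler_weXn2l// ler1n.
  lra.
exists M; apply: abs_sums_le_le HM => k; rewrite normrM ler_piMr//.
Qed.

Lemma seeley_a_abs_sums_le (n : nat) (g : nat -> R) (C : R) : (forall k, `|g k| <= C) ->
  exists M, abs_sums_le (fun k => seeley_a k * 4 ^+ k ^+ n * g k) M.
Proof.
move=> gC.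
have C0 : 0 < C + 1 by apply: ltr_wpDl => //; apply: le_trans (gC 0%N).
have [|M HM] := @seeley_abs_sums_le n (fun k => g k / (C + 1) / (1 + 4 ^- k)).
  move=> k; have [h1 _] := expV4_bounds k; rewrite -mulrA -invfM normrM normfV.
  rewrite [X in _ / X]ger0_norm; last by rewrite mulr_ge0; lra.
  rewrite ler_pdivrMr; last by rewrite mulr_gt0//; lra.
  by rewrite mul1r (le_trans (gC k))//; nra.
exists (`|C + 1| * M); have := abs_sums_leZ (C + 1) HM.
apply: abs_sums_le_le => k; rewrite le_eqVlt; apply/orP; left; apply/eqP; congr `|_|.
have [h1 _] := expV4_bounds k.
by rewrite /seeley_a; field; rewrite !gt_eqF//=; lra.
Qed.

Lemma seeley_b_cvg n : cvgn (series (fun k => seeley_b k * 4 ^+ k ^+ n)).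
Proof.
have [|M] := @seeley_abs_sums_le n (fun _ => 1); first by move=> k; rewrite normr1.
by under eq_fun do rewrite mulr1; exact: abs_sums_le_cvg.
Qed.

Lemma seeley_a_cvg n : cvgn (series (fun k => seeley_a k * 4 ^+ k ^+ n)).
Proof.
have [|M] := @seeley_a_abs_sums_le n (fun _ => 1) 1; first by move=> k; rewrite normr1.
by under eq_fun do rewrite mulr1; exact: abs_sums_le_cvg.
Qed.

(** The recursion reads [seeley_b k.+1 * (4^(k+1) - 1) = - seeley_b k], which is the functional
    equation [B (4 z) = (1 - z) B z]. At [z = 1] it gives [B 4 = 0], and then [B] vanishes at all
    further powers of 4. *)
Lemma seeley_b_sum n : series_sum (fun k => seeley_b k * 4 ^+ k ^+ n.+1) = 0.
Proof.
have rec m : series_sum (fun k => seeley_b k * 4 ^+ k ^+ m.+1) =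
    (1 - 4 ^+ m) * series_sum (fun k => seeley_b k * 4 ^+ k ^+ m).
  suff : series_sum (fun k => seeley_b k * 4 ^+ k ^+ m.+1) -
         series_sum (fun k => seeley_b k * 4 ^+ k ^+ m) =
         - 4 ^+ m * series_sum (fun k => seeley_b k * 4 ^+ k ^+ m) by lra.
  rewrite -series_sumB; [|exact: seeley_b_cvg|exact: seeley_b_cvg].
  rewrite series_sumS; last by apply: is_cvg_seriesB; exact: seeley_b_cvg.
  rewrite -series_sumZ; last exact: seeley_b_cvg.
  rewrite expr0 !expr1n subrr add0r; apply: eq_series_sum => k.
  have [h1 _] := expV4_bounds k.+1; have [_ h2] := expV4_bounds k.
  rewrite [seeley_b _]/= (exprSr 4 k) exprS !exprMn.
  have e0 : 4 ^+ k != 0 :> R by rewrite expf_neq0.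
  have e1 : 4 ^+ k * 4 - 1 != 0 :> R.
    by rewrite -exprSr subr_eq0 gt_eqF// exprn_egt1// ltr1n.
  move: e0 e1; move: (4 ^+ k ^+ m) (4 ^+ m) => C B.
  by move: (4 ^+ k) => A e0 e1; field; rewrite e0 e1.
elim: n => [|n IH]; first by rewrite rec expr0 subrr mul0r.
by rewrite rec IH mulr0.
Qed.

Definition seeley_S := series_sum seeley_a.

(** Since [seeley_a k * (4^k + 1) = seeley_b k * 4^k], the sums of orders [n] and [n + 1] add up to
    [B (4^(n+1)) = 0], so the sign alternates. *)
Lemma seeley_a_sum n :
  series_sum (fun k => seeley_a k * 4 ^+ k ^+ n) = (-1) ^+ n * seeley_S.
Proof.
elim: n => [|n IH].
  by rewrite mul1r; apply: eq_series_sum => k; rewrite expr0 mulr1.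
suff : series_sum (fun k => seeley_a k * 4 ^+ k ^+ n.+1) +
       series_sum (fun k => seeley_a k * 4 ^+ k ^+ n) = 0.
  by rewrite IH exprS mulN1r mulNr => /eqP; rewrite addr_eq0 => /eqP.
rewrite -series_sumD; [|exact: seeley_a_cvg|exact: seeley_a_cvg].
rewrite -(seeley_b_sum n); apply: eq_series_sum => k.
have [h1 _] := expV4_bounds k; rewrite /seeley_a exprS.
have e0 : 4 ^+ k != 0 :> R by rewrite expf_neq0.
have e1 : 4 ^+ k + 1 != 0 :> R by rewrite gt_eqF// addr_gt0// exprn_gt0.
move: e0 e1; move: (4 ^+ k) => A e0 e1.
by field; rewrite e0 e1.
Qed.

(** The first two terms are [1/2] and [- 4/15], and the remaining ones sum to at most [1/6] in
    absolute value, by comparison with [1/9 * 3^-k]; so the sum is at least [1/15]. *)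
Lemma seeley_S_neq0 : seeley_S != 0.
Proof.
have [|M uM] := @seeley_a_abs_sums_le 0 (fun _ => 1) 1; first by move=> k; rewrite normr1.
have {}uM : abs_sums_le seeley_a M by move: uM; under eq_fun do rewrite expr0 !mulr1.
have ca := abs_sums_le_cvg uM; have cS := abs_sums_le_cvg (abs_sums_leS uM).
rewrite gt_eqF// /seeley_S series_sumS// series_sumS//.
have E1 : 4 ^- 1 / (1 - 4 ^- 1) = 3^-1 :> R.
  by rewrite expr1 (_ : 1 - 4^-1 = 3 * 4^-1) ?invfM ?invrK; lra.
have E2 : (1 + 4 ^- 1)^-1 = 4 / 5 :> R.
  by rewrite expr1 (_ : 1 + 4^-1 = 5 * 4^-1) ?invfM ?invrK; lra.
have bk k : `|seeley_b k.+2| <= 9^-1 * 3^-1 ^+ k.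
  elim: k => [|k IH].
    rewrite expr0 mulr1 (le_trans (seeley_b_ratio _))//.
    rewrite [seeley_b 1]/= normrM normr1 mulr1 normrN E1 ger0_norm//.
    by rewrite !exprS expr0; lra.
  rewrite (le_trans (seeley_b_ratio _))// [in leRHS]exprS.
  have [_ h] := expV4_bounds k.+2; have := normr_ge0 (seeley_b k.+2).
  move=> B0; apply: (@le_trans _ _ (3^-1 * `|seeley_b k.+2|)); last by lra.
  by rewrite ler_wpM2r//; lra.
have : `|series_sum (fun k => seeley_a k.+2)| <= 6^-1.
  apply: abs_sums_le_series_sum => n.
  apply: (@le_trans _ _ (\sum_(k < n) 9^-1 * 3^-1 ^+ k)).
    apply: ler_sum => k _; apply: le_trans (bk k).
    have [h1 _] := expV4_bounds k.+2.
    rewrite /seeley_a normrM ler_piMr// normfV gtr0_norm ?addr_gt0//.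
    by rewrite invf_le1; lra.
  suff -> : \sum_(k < n) 9^-1 * 3^-1 ^+ k = 6^-1 * (1 - 3^-1 ^+ n) :> R.
    have : 0 <= 3^-1 ^+ n :> R by rewrite exprn_ge0.
    by lra.
  elim: n => [|n IH]; first by rewrite big_ord0 expr0 subrr mulr0.
  by rewrite big_ord_recr/= IH exprS; field.
rewrite ler_norml => /andP[+ _].
have -> : seeley_a 0 = 2^-1 by rewrite /seeley_a/= expr0 invr1 mul1r.
have -> : seeley_a 1 = - 3^-1 * (4 / 5) by rewrite /seeley_a [seeley_b 1]/= E1 E2 mulr1.
by move: (series_sum _) => T hT; lra.
Qed.

End Seeley.

Section SeeleyExtension.
Variable R : realType.

Lemma is_derive_quad (f : R -> R) (x d C e : R) : 0 < e ->
  (forall y, `|y - x| < e -> `|f y - f x - (y - x) * d| <= C * (y - x) ^+ 2) ->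
  is_derive x (1 : R) f d.
Proof.
move=> e0 H; have C0 : 0 <= C + 1.
  have := H (x + e / 2); have -> : x + e / 2 - x = e / 2 by ring.
  have lte : `|e / 2| < e by rewrite ger0_norm; lra.
  move=> /(_ lte) h; have := le_trans (normr_ge0 _) h.
  by rewrite pmulr_lge0 ?exprn_gt0 ?divr_gt0//; lra.
suff h : (fun h : R => h^-1 *: ((f \o shift x) (h *: 1) - f x)) @ 0^' --> d.
  by apply: DeriveDef; [apply: cvgP; exact: h|exact: cvg_lim h].
apply/cvgrPdist_le => /= r r0; near=> h.
have h0 : h != 0 by near: h; exact: nbhs_dnbhs_neq.
have he : `|h| < e.
  by near: h; apply: dnbhs0_lt.
have hr : `|h| <= r / (C + 2).
  by near: h; apply: dnbhs0_le; rewrite divr_gt0//; lra.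
rewrite /GRing.scale/= mulr1.
have := H (h + x); rewrite addrK => /(_ he) T.
rewrite distrC.
have -> : h^-1 * (f (h + x) - f x) - d = h^-1 * (f (h + x) - f x - h * d) by field.
rewrite normrM normfV ler_pdivrMl ?normr_gt0//; apply: (le_trans T).
rewrite -(real_normK (num_real h)) expr2 mulrA mulrC ler_wpM2l//.
move: hr; rewrite ler_pdivlMr; last lra.
by move=> hr; have := normr_ge0 h; nra.
Unshelve. all: by end_near. Qed.

(** For [x < 0] the extension of [u] is the sum of [(seeley_a k / S) * u (- 4^k x)]; the power is
    the factor that the chain rule produces in its derivative of order [n]. *)
Definition seeley_coef (n k : nat) : R := seeley_a R k / seeley_S R * (- 4 ^+ k) ^+ n.

Lemma seeley_coef_abs_sums_le n (g : nat -> R) (C : R) p : (forall k, `|g k| <= C * 4 ^+ k ^+ p) ->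
  exists M, abs_sums_le (fun k => seeley_coef n k * g k) M.
Proof.
move=> gC; have [|M HM] := @seeley_a_abs_sums_le R (n + p) (fun k => g k / 4 ^+ k ^+ p) C.
  move=> k; have k0 : 0 < 4 ^+ k ^+ p :> R by rewrite !exprn_gt0.
  by rewrite normrM normfV (gtr0_norm k0) ler_pdivrMr.
exists (`|(seeley_S R)^-1| * M); have := abs_sums_leZ (seeley_S R)^-1 HM.
apply: abs_sums_le_le => k; rewrite le_eqVlt; apply/orP; left; apply/eqP.
rewrite /seeley_coef; move: (seeley_a R k) => S0; rewrite exprNn !normrM normrX normrN1 expr1n mul1r.
rewrite -!normrM; congr `|_|.
have e0 : 4 ^+ k ^+ p != 0 :> R by rewrite !expf_neq0.
rewrite exprD; move: e0; move: (4 ^+ k ^+ p) => A A0.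
have := seeley_S_neq0 R; move: (seeley_S R) => B B0.
by field; rewrite A0 B0.
Qed.

(** The sign in [seeley_a_sum] cancels the one in [(- 4^k)^n]. With [c] the value at 0 of the
    derivative of order [n], this is the matching of both sides at 0. *)
Lemma seeley_coef_sum n c : series_sum (fun k => seeley_coef n k * c) = c.
Proof.
have -> : (fun k => seeley_coef n k * c) =
    (fun k => ((-1) ^+ n / seeley_S R * c) * (seeley_a R k * 4 ^+ k ^+ n)).
  apply/funext => k; rewrite /seeley_coef exprNn.
  by move: (4 ^+ k ^+ n) => A; ring.
rewrite series_sumZ; last exact: seeley_a_cvg.
rewrite seeley_a_sum; have := sqrr_sign R n; rewrite expr2.
have := seeley_S_neq0 R; move: ((-1) ^+ n) (seeley_S R) => e B B0 ee.
by transitivity (e * e * c); [field|rewrite ee mul1r].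
Qed.

(** The two formulas for [V n] agree at 0, so each closed half line carries a Taylor estimate with
    the common value [V n.+1 0]; at 0 the two estimates together form a two-sided one, and
    [is_derive_quad] applies everywhere. *)
Lemma seeley_extension (u : R -> R) : half_schwartz u ->
  exists U, real_schwartz U /\ forall t, 0 <= t -> u t = U t.
Proof.
move=> [v [uv vT vB]].
pose V n (x : R) := if 0 <= x then v n x else series_sum (fun k => seeley_coef n k * v n (- 4 ^+ k * x)).
have Vpos n (x : R) : 0 <= x -> V n x = v n x by rewrite /V => ->.
have Vneg n (x : R) : x <= 0 -> V n x = series_sum (fun k => seeley_coef n k * v n (- 4 ^+ k * x)).
  move=> x0; rewrite /V; case: ifPn => // x0'.
  have -> : x = 0 by apply/eqP; rewrite eq_le x0 x0'.
  by under [in RHS]eq_fun do rewrite mulr0; rewrite seeley_coef_sum.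
have npos k (x : R) : x <= 0 -> 0 <= - 4 ^+ k * x :> R.
  by move=> x0; rewrite mulNr oppr_ge0 mulr_ge0_le0// exprn_ge0.
have cv n (x : R) : x <= 0 -> cvgn (series (fun k => seeley_coef n k * v n (- 4 ^+ k * x))).
  move=> x0; have [C HC] := vB 0%N n.
  have [|M] := @seeley_coef_abs_sums_le n (fun k => v n (- 4 ^+ k * x)) C 0.
    move=> k; have := HC _ (npos k x x0).
    by rewrite !expr0 mul1r mulr1.
  exact: abs_sums_le_cvg.
have T1 n : exists C : R, forall x y : R, 0 <= x -> 0 <= y ->
    `|V n y - V n x - (y - x) * V n.+1 x| <= C * (y - x) ^+ 2.
  have [C HC] := vT n; exists C => x y x0 y0; rewrite !Vpos//; exact: HC.
have T2 n : exists C : R, forall x y : R, x <= 0 -> y <= 0 ->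
    `|V n y - V n x - (y - x) * V n.+1 x| <= C * (y - x) ^+ 2.
  have [C HC] := vT n.
  have [|M HM] := @seeley_coef_abs_sums_le n (fun k => C * 4 ^+ k ^+ 2) `|C| 2.
    by move=> k; rewrite normrM [X in _ * X]ger0_norm// !exprn_ge0.
  exists M => x y x0 y0; rewrite !Vneg// -series_sumB; [|exact: cv|exact: cv].
  rewrite -series_sumZ; last exact: cv.
  rewrite -series_sumB; first last.
  - by apply: is_cvg_seriesZ; exact: cv.
  - by apply: is_cvg_seriesB; exact: cv.
  rewrite mulrC -[X in X * M](ger0_norm (sqr_ge0 _)).
  apply: abs_sums_le_series_sum; apply: abs_sums_le_le (abs_sums_leZ _ HM) => k.
  have -> : seeley_coef n.+1 k = seeley_coef n k * (- 4 ^+ k).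
    by rewrite /seeley_coef exprSr mulrA.
  have := HC _ _ (npos k y y0) (npos k x x0).
  set A := v n _; set B := v n _; set D := v n.+1 _ => h.
  rewrite [X in `|X| <= _](_ : _ = seeley_coef n k *
    (A - B - (- 4 ^+ k * y - - 4 ^+ k * x) * D)); last by ring.
  rewrite mulrCA [leLHS]normrM [leRHS]normrM ler_wpM2l//; apply: (le_trans h).
  by rewrite -mulrBr exprMn sqrrN mulrA mulrC ler_norm.
exists (V 0%N); split; last by move=> t t0; rewrite Vpos// uv.
exists V; split => // [n x|m n].
  have [C1 H1] := T1 n; have [C2 H2] := T2 n.
  have [x0|x0|x0] := ltgtP x 0.
  - apply: (@is_derive_quad _ _ _ C2 (- x)); first by rewrite oppr_gt0.
    move=> y yx; apply: H2; first exact: ltW.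
    by move: yx; rewrite ltr_norml => /andP[_]; lra.
  - apply: (@is_derive_quad _ _ _ C1 x) => // y yx; apply: H1; first exact: ltW.
    by move: yx; rewrite ltr_norml => /andP[]; lra.
  - apply: (@is_derive_quad _ _ _ (`|C1| + `|C2|) 1) => // y _.
    rewrite [leRHS]mulrDl; have [y0|y0] := leP 0 y.
      apply: (@le_trans _ _ (C1 * (y - x) ^+ 2)); first by apply: H1; rewrite ?x0.
      rewrite -[leLHS]addr0; apply: lerD; last by apply: mulr_ge0; rewrite ?sqr_ge0.
      by rewrite ler_wpM2r ?sqr_ge0// ler_norm.
    apply: (@le_trans _ _ (C2 * (y - x) ^+ 2)); first by apply: H2; rewrite ?x0// ltW.
    rewrite -[leLHS]add0r; apply: lerD; first by apply: mulr_ge0; rewrite ?sqr_ge0.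
    by rewrite ler_wpM2r ?sqr_ge0// ler_norm.
have [C HC] := vB m n.
have [|M HM] := @seeley_coef_abs_sums_le n (fun k => C) `|C| 0.
  by move=> k; rewrite expr0 mulr1.
exists (`|C| + M) => x; have M0 : 0 <= M by apply: le_trans (HM 0%N); rewrite big_ord0.
have [x0|x0] := leP 0 x.
  by rewrite Vpos// (le_trans (HC _ x0))// (le_trans (ler_norm _))// lerDl.
rewrite (Vneg _ _ (ltW x0)) -series_sumZ; last exact: (cv n x (ltW x0)).
apply: (@le_trans _ _ M); last by rewrite lerDr.
apply: abs_sums_le_series_sum; apply: abs_sums_le_le HM => k.
rewrite mulrCA !normrM ler_wpM2l//.
have := HC _ (npos k x (ltW x0)); set A := v n _ => h.
apply: (@le_trans _ _ `|C|); last by [].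
(* Since [|x| <= |4^k x|], a power of [x] is controlled by the same power of the reflected
   argument. *)
apply: le_trans (ler_norm _); apply: le_trans h.
rewrite normrM ler_wpM2r// !normrX lerXn2r ?nnegrE// mulNr normrN normrM.
rewrite ler_peMl// ger0_norm ?exprn_ge0// exprn_ege1// ler1n//.
Qed.

End SeeleyExtension.

(** * Integration and completeness on the half line *)

Section HalfLine.
Variable R : realType.
Local Notation mu := (@lebesgue_measure R).
Local Notation D := (`]0%R, +oo[%classic : set R).

Definition integrable_pos (f : R -> R) := mu.-integrable D (EFin \o f).
Definition integral_pos (f : R -> R) : R := \int[mu]_(x in D) f x.

Lemma mD : measurable D. Proof. exact: measurable_itv. Qed.
Hint Resolve mD : core.

Lemma D_gt0 x : D x = (0 < x). Proof. by rewrite /= in_itv/= andbT. Qed.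

(** These intervals avoid 0, where the integrands may be singular, and starting from 2 keeps every
    one of them nondegenerate, as the fundamental theorem of calculus requires. *)
Definition exhaust (n : nat) : set R := `[n.+2%:R^-1, n.+2%:R]%classic.

Lemma exhaust_gt0 n x : exhaust n x -> 0 < x.
Proof. by rewrite /exhaust /= in_itv/= => /andP[h _]; apply: lt_le_trans h. Qed.

Lemma exhaust_nd : nondecreasing_seq exhaust.
Proof.
move=> n m nm; rewrite subsetEset => x; rewrite /exhaust/= !in_itv/= => /andP[h1 h2].
apply/andP; split.
  by apply: le_trans h1; rewrite lef_pV2 ?posrE// ler_nat.
by apply: (le_trans h2); rewrite ler_nat.
Qed.

Lemma exhaust_in x : 0 < x -> \forall n \near \oo, exhaust n x.
Proof.
move=> x0; near=> n; rewrite /exhaust /= in_itv/=; apply/andP; split.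
  rewrite -[leRHS]invrK lef_pV2 ?posrE ?invr_gt0//.
  apply: (@le_trans _ _ n%:R); last by rewrite ler_nat -addn2 leq_addr.
  by near: n; exact: nbhs_infty_ger.
apply: (@le_trans _ _ n%:R); last by rewrite ler_nat -addn2 leq_addr.
by near: n; exact: nbhs_infty_ger.
Unshelve. all: by end_near. Qed.

Lemma exhaust_bigcup : \bigcup_n exhaust n = D.
Proof.
apply/seteqP; split => x.
  by move=> [n _ /exhaust_gt0]; rewrite D_gt0.
rewrite D_gt0 => /exhaust_in[n _ h]; exists n => //; exact: (h n (leqnn n)).
Qed.

Lemma FTC2_exhaust (F f : R -> R) n :
  (forall x : R, 0 < x -> is_derive x (1 : R) F (f x)) ->
  (forall x : R, 0 < x -> {for x, continuous f}) ->
  (\int[mu]_(x in exhaust n) (f x)%:E = (F n.+2%:R)%:E - (F n.+2%:R^-1)%:E)%E.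
Proof.
move=> dF cf.
have n0 : 0 < n.+2%:R^-1 :> R by [].
have nn : n.+2%:R^-1 < n.+2%:R :> R.
  by apply: (@lt_trans _ _ 1); rewrite ?invf_lt1// ltr1n.
have cF (x : R) : 0 < x -> {for x, continuous F}.
  move=> x0; apply: differentiable_continuous; apply/derivable1_diffP.
  exact: (@ex_derive _ _ _ _ _ _ _ (dF x x0)).
apply: continuous_FTC2 => //.
- apply: continuous_in_subspaceT => x; rewrite inE /= in_itv/= => /andP[h _].
  by apply: cf; apply: lt_le_trans h.
- split.
  + move=> x; rewrite in_itv/= => /andP[h _].
    exact: (@ex_derive _ _ _ _ _ _ _ (dF x (lt_trans n0 h))).
  + by apply: cvg_at_right_filter; apply: cF.
  + by apply: cvg_at_left_filter; apply: cF; apply: lt_trans nn.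
- move=> x; rewrite in_itv/= => /andP[h _].
  by rewrite derive1E; exact: (@derive_val _ _ _ _ _ _ _ (dF x (lt_trans n0 h))).
Qed.

Lemma continuous_at_measurable (f : R -> R) :
  (forall x : R, 0 < x -> {for x, continuous f}) -> measurable_fun D f.
Proof.
move=> cf; apply: subspace_continuous_measurable_fun; first exact: mD.
by apply: continuous_in_subspaceT => x; rewrite inE D_gt0; exact: cf.
Qed.

(** Over [exhaust n] the integral is a difference of two values of [F], hence at most [2 M];
    monotone convergence gives the same bound on the half line. *)
Lemma ge0_integrable_pos_primitive (F f : R -> R) (M : R) :
  (forall x : R, 0 < x -> is_derive x (1 : R) F (f x)) ->
  (forall x : R, 0 < x -> {for x, continuous f}) ->
  (forall x : R, 0 < x -> 0 <= f x) -> (forall x : R, 0 < x -> `|F x| <= M) ->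
  integrable_pos f.
Proof.
move=> dF cf f0 FM.
have mf := continuous_at_measurable cf.
have mfE n : measurable_fun (exhaust n) (EFin \o f).
  apply: (@measurable_funS _ _ _ _ D) => //.
    by move=> x /exhaust_gt0; rewrite D_gt0.
  exact/measurable_EFinP.
apply/integrableP; split; first exact/measurable_EFinP.
apply: (@le_lt_trans _ _ (\int[mu]_(x in D) (f x)%:E)%E).
  rewrite le_eqVlt; apply/orP; left; apply/eqP; apply: eq_integral => x.
  by rewrite inE D_gt0 => x0; rewrite /= ger0_norm// f0.
apply: (@le_lt_trans _ _ (M + M)%:E); last exact: ltry.
rewrite -exhaust_bigcup.
have h : (\int[mu]_(x in exhaust i) (f x)%:E)%E @[i --> \oo] -->
    (\int[mu]_(x in \bigcup_n exhaust n) (f x)%:E)%E.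
  apply: ge0_nondecreasing_set_cvg_integral => //.
  - exact: exhaust_nd.
  - by move=> i; exact: measurable_itv.
  - by move=> i x /exhaust_gt0 /f0; rewrite lee_fin.
rewrite -(cvg_lim _ h)//; apply: lime_le; first by apply: cvgP; exact: h.
apply: nearW => n; rewrite (FTC2_exhaust n dF cf) -EFinB lee_fin.
have H (x : R) : 0 < x -> F x <= M /\ - F x <= M.
  by move=> /FM; rewrite ler_norml lerNl => /andP[].
by have [h1 _] := H n.+2%:R ltac:(by []); have [_ h2] := H n.+2%:R^-1 ltac:(by []); lra.
Qed.

Lemma integrable_pos_cvg_exhaust (f : R -> R) : integrable_pos f ->
  (\int[mu]_(x in exhaust n) (f x)%:E)%E @[n --> \oo] --> (\int[mu]_(x in D) (f x)%:E)%E.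
Proof.
move=> intf; have mf := measurable_int _ intf.
have E n : (\int[mu]_(x in exhaust n) (f x)%:E = \int[mu]_(x in D) (f x * \1_(exhaust n) x)%:E)%E.
  have sub : exhaust n `<=` D by move=> x /exhaust_gt0; rewrite D_gt0.
  rewrite -[in LHS](setIidr sub) integral_mkcondr; apply: eq_integral => x _.
  by rewrite patchE indicE; case: ifPn => _; rewrite ?mulr1 ?mulr0.
have mfn n : measurable_fun D (fun x => (f x * \1_(exhaust n) x)%:E).
  apply/measurable_EFinP; apply: measurable_funM; first exact/measurable_EFinP.
  by apply: measurable_funTS; apply: measurable_indic; exact: measurable_itv.
rewrite (_ : (fun n => _) = (fun n => \int[mu]_(x in D) (f x * \1_(exhaust n) x)%:E)%E); last first.
  by apply/funext => n; exact: E.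
apply: (@dominated_cvg _ _ _ mu D mD (fun n x => (f x * \1_(exhaust n) x)%:E)
  (EFin \o f) (fun x => `|(f x)%:E|%E)) => //.
- move=> x; rewrite D_gt0 => x0; apply: cvg_near_cst.
  have := exhaust_in x0; apply: filterS => n xn.
  by rewrite indicE mem_set// mulr1.
- exact: integrable_abse.
- move=> n x _; rewrite /= lee_fin normrM ler_piMr//.
  by rewrite indicE; case: (_ \in _); rewrite ?normr1 ?normr0.
Qed.

Lemma integral_pos_derive_eq0 (F f : R -> R) : integrable_pos f ->
  (forall x : R, 0 < x -> is_derive x (1 : R) F (f x)) ->
  (forall x : R, 0 < x -> {for x, continuous f}) ->
  F n.+2%:R @[n --> \oo] --> (0 : R) -> F n.+2%:R^-1 @[n --> \oo] --> (0 : R) ->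
  integral_pos f = 0.
Proof.
move=> intf dF cf Fy F0.
have h := integrable_pos_cvg_exhaust intf.
have h2 : (\int[mu]_(x in exhaust n) (f x)%:E)%E @[n --> \oo] --> 0%E.
  under eq_fun do rewrite (FTC2_exhaust _ dF cf) -EFinB.
  apply: cvg_EFin; first by apply: nearW.
  by rewrite -[X in _ --> X](subr0 0); apply: cvgB.
by rewrite /integral_pos /Rintegral (cvg_unique _ h h2).
Qed.

Implicit Types (f g : R -> R).

Lemma integrable_posZ c f : integrable_pos f -> integrable_pos (fun x => c * f x).
Proof.
move=> h; have := @integrableZl _ _ _ mu D mD c _ h.
by apply: eq_integrable.
Qed.

Lemma integrable_posD f g : integrable_pos f -> integrable_pos g -> integrable_pos (fun x => f x + g x).
Proof. by move=> hf hg; have := @integrableD _ _ _ mu D mD _ _ hf hg; apply: eq_integrable. Qed.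

Lemma integrable_posB f g : integrable_pos f -> integrable_pos g -> integrable_pos (fun x => f x - g x).
Proof. by move=> hf hg; have := @integrableB _ _ _ mu D mD _ _ hf hg; apply: eq_integrable. Qed.

Lemma integrable_pos_measurable f : integrable_pos f -> measurable_fun D f.
Proof. by move=> /measurable_int/measurable_EFinP. Qed.

Lemma le_integrable_pos (f g : R -> R) : measurable_fun D f -> integrable_pos g ->
  (forall x : R, 0 < x -> `|f x| <= g x) -> integrable_pos f.
Proof.
move=> mf hg fg; apply: le_integrable hg => //; first exact/measurable_EFinP.
move=> x; rewrite D_gt0 => x0; rewrite /= lee_fin (le_trans (fg x x0))//.
exact: ler_norm.
Qed.

Lemma eq_integrable_pos f g : (forall x : R, 0 < x -> f x = g x) -> integrable_pos f -> integrable_pos g.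
Proof.
move=> e; apply: eq_integrable => // x; rewrite inE D_gt0 => x0 /=.
by rewrite e.
Qed.

Lemma integrable_pos_sum n (f : 'I_n -> R -> R) : (forall i, integrable_pos (f i)) ->
  integrable_pos (fun x => \sum_(i < n) f i x).
Proof.
elim: n f => [|n IH] f h.
  apply: (@eq_integrable_pos (fun _ => 0)); first by move=> x _; rewrite big_ord0.
  exact: integrable0.
apply: (@eq_integrable_pos (fun x => \sum_(i < n) f (widen_ord (leqnSn n) i) x + f ord_max x)).
  by move=> x _; rewrite big_ord_recr.
by apply: integrable_posD => //; apply: IH.
Qed.

Lemma integral_posZ c f : integrable_pos f -> integral_pos (fun x => c * f x) = c * integral_pos f.
Proof. by move=> h; rewrite /integral_pos RintegralZl. Qed.

Lemma integral_posD f g : integrable_pos f -> integrable_pos g -> integral_pos (fun x => f x + g x) = integral_pos f + integral_pos g.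
Proof. by move=> hf hg; rewrite /integral_pos RintegralD. Qed.

Lemma integral_posB f g : integrable_pos f -> integrable_pos g -> integral_pos (fun x => f x - g x) = integral_pos f - integral_pos g.
Proof. by move=> hf hg; rewrite /integral_pos RintegralB. Qed.

Lemma eq_integral_pos f g : (forall x : R, 0 < x -> f x = g x) -> integral_pos f = integral_pos g.
Proof. by move=> e; apply: eq_Rintegral => x; rewrite inE D_gt0; exact: e. Qed.

Lemma integral_pos0 : integral_pos (fun _ => 0) = 0.
Proof. by rewrite /integral_pos /Rintegral integral0_eq. Qed.

Lemma integral_pos_sum n (f : 'I_n -> R -> R) : (forall i, integrable_pos (f i)) ->
  integral_pos (fun x => \sum_(i < n) f i x) = \sum_(i < n) integral_pos (f i).
Proof.
elim: n f => [|n IH] f h.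
  by rewrite big_ord0 -[RHS]integral_pos0; apply: eq_integral_pos => x _; rewrite big_ord0.
rewrite big_ord_recr/= -IH// -integral_posD//.
  by apply: eq_integral_pos => x _; rewrite big_ord_recr.
by apply: integrable_pos_sum.
Qed.

Lemma le_integral_pos f g : integrable_pos f -> integrable_pos g -> (forall x : R, 0 < x -> f x <= g x) ->
  integral_pos f <= integral_pos g.
Proof.
move=> hf hg fg; apply: le_Rintegral => // x; rewrite D_gt0; exact: fg.
Qed.

Lemma norm_integral_pos f : integrable_pos f -> `|integral_pos f| <= integral_pos (fun x => `|f x|).
Proof. by move=> h; apply: le_normr_Rintegral. Qed.

Lemma is_derive_continuous (f : R -> R) (x d : R) :
  is_derive x (1 : R) f d -> {for x, continuous f}.
Proof.
move=> df; apply: differentiable_continuous; apply/derivable1_diffP.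
exact: (@ex_derive _ _ _ _ _ _ _ df).
Qed.

Lemma continuous_powR_pos (s x : R) : 0 < x -> {for x, continuous (fun y => y `^ s)}.
Proof. by move=> x0; apply: is_derive_continuous (is_derive1_powR s x0). Qed.

Lemma powR_pred (p x : R) : 0 < x -> x `^ p = x `^ (p - 1) * x.
Proof.
move=> x0; rewrite -{3}[x]powRr1 ?ltW// -powRD ?subrK//.
by apply/implyP => _; rewrite gt_eqF.
Qed.

(** A bounded primitive is [(x / (1 + x))^(s+1) / (s + 1)]. The function behaves like [x^s] near 0
    and like [x^-2] at infinity, which makes it a convenient dominating function. *)
Lemma integrable_pos_pow_ratio (s : R) : -1 < s ->
  integrable_pos (fun x => x `^ s * (1 + x) `^ (- (s + 2))).
Proof.
move=> s1; pose p := s + 1; have p0 : 0 < p by rewrite /p; lra.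
have d1 (q x : R) : 0 < x -> is_derive x (1 : R) (fun y : R => (1 + y) `^ q)
    (q * (1 + x) `^ (q - 1)).
  move=> x0; have x1 : 0 < 1 + x by rewrite addr_gt0.
  have h1 := is_derive1_powR q x1.
  have h2 : is_derive x (1 : R) (fun y : R => 1 + y) 1.
    have := is_deriveD (is_derive_cst (1 : R) x (1 : R)) (is_derive_id x (1 : R)).
    by rewrite add0r.
  by have := is_derive1_comp h1 h2; rewrite mulr1.
apply: (@ge0_integrable_pos_primitive (fun x => p^-1 * (x `^ p * (1 + x) `^ (- p))) _ p^-1).
- move=> x x0; have H := is_deriveZ p^-1 (is_deriveM (is_derive1_powR p x0) (d1 (- p) x x0)).
  apply: (is_derive_eq H); rewrite /GRing.scale/=.
  have x1 : 0 < 1 + x by rewrite addr_gt0.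
  rewrite (_ : - (s + 2) = - p - 1); last by rewrite /p; ring.
  rewrite (_ : s = p - 1); last by rewrite /p; ring.
  rewrite (powR_pred p x0) (powR_pred (- p) x1).
  by field; rewrite gt_eqF.
- move=> x x0; apply: cvgM; first exact: continuous_powR_pos.
  exact: is_derive_continuous (d1 _ x x0).
- by move=> x x0; rewrite mulr_ge0 ?powR_ge0.
- move=> x x0; have x1 : 0 < 1 + x by rewrite addr_gt0.
  have x0' := ltW x0; have x1' := ltW x1; have p0' := ltW p0.
  rewrite ger0_norm ?mulr_ge0 ?powR_ge0 ?invr_ge0//.
  rewrite -[leRHS]mulr1 ler_wpM2l ?invr_ge0//.
  rewrite powRN ler_pdivrMr ?powR_gt0// mul1r.
  by rewrite ge0_ler_powR ?nnegrE// ler_wpDl.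
Qed.

(** The exponent and the dominating function are chosen before [f], and the bound is linear in [C]:
    norm estimates uniform in the coefficients rest on this ([expand_dominated]). *)
Lemma decay_dominated (a s : R) : 0 < a -> -1 < s -> exists (M : nat) (G : R -> R),
  integrable_pos G /\ forall (f : R -> R) (C : R),
    (forall x : R, 0 < x -> `|f x| <= C * x `^ s) ->
    (forall x : R, 0 < x -> `|f x| * (x `^ a) ^+ M <= C * x `^ s) ->
    forall x : R, 0 < x -> `|f x| <= C * G x.
Proof.
move=> a0 s1.
(* With [a M >= s + 2] the second hypothesis yields decay like [x^-2] for [x >= 1]. *)
pose M := (Num.trunc ((s + 2) / a)).+1.
have aM : s + 2 <= a * M%:R.
  by rewrite mulrC -ler_pdivrMr// ltW// Num.Theory.truncnS_gt.
exists M, (fun x => 2 `^ (s + 2) * (x `^ s * (1 + x) `^ (- (s + 2)))); split.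
  by apply: integrable_posZ; exact: integrable_pos_pow_ratio.
move=> f C HC0 HC1 x x0; have x1 : 0 < 1 + x by rewrite addr_gt0.
have xs : 0 < x `^ s by rewrite powR_gt0.
have C0 : 0 <= C by rewrite -(pmulr_lge0 _ xs); apply: le_trans (HC0 x x0).
suff : `|f x| <= C * x `^ s * (2 `^ (s + 2) / (1 + x) `^ (s + 2)).
  move=> h; apply: (le_trans h); rewrite powRN le_eqVlt; apply/orP; left; apply/eqP; ring.
have s2 : 0 <= s + 2 by lra.
have [xle|xgt] := leP x 1.
  apply: (le_trans (HC0 x x0)).
  rewrite -[leLHS]mulr1 ler_wpM2l ?mulr_ge0 ?powR_ge0//.
  rewrite ler_pdivlMr ?powR_gt0// mul1r ge0_ler_powR ?nnegrE//; lra.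
apply: (@le_trans _ _ (C * x `^ s / x `^ (s + 2))).
  rewrite ler_pdivlMr ?powR_gt0//; apply: le_trans (HC1 x x0).
  rewrite ler_wpM2l// -powR_mulrn ?powR_ge0// -powRrM ler_powR//; exact: ltW.
rewrite ler_wpM2l ?mulr_ge0 ?powR_ge0//.
rewrite ler_pdivlMr ?powR_gt0// mulrC ler_pdivrMr ?powR_gt0//.
rewrite -powRM//; last exact: ltW.
by rewrite ge0_ler_powR ?nnegrE//; lra.
Qed.

Lemma integrable_pos_decay (a s : R) (f : R -> R) : 0 < a -> -1 < s -> measurable_fun D f ->
  (forall m, exists C, forall x : R, 0 < x -> `|f x| * (x `^ a) ^+ m <= C * x `^ s) ->
  integrable_pos f.
Proof.
move=> a0 s1 mf H; have [M [G [hG domG]]] := decay_dominated a0 s1.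
have [C0 HC0] := H 0%N; have [C1 HC1] := H M.
have le1 (x C : R) : 0 < x -> C <= `|C0| + `|C1| -> C * x `^ s <= (`|C0| + `|C1|) * x `^ s.
  by move=> x0 h; rewrite ler_wpM2r ?powR_ge0.
apply: (le_integrable_pos mf (integrable_posZ (`|C0| + `|C1|) hG)) => x x0; apply: domG => // y y0.
  have := HC0 y y0; rewrite expr0 mulr1 => h; apply: (le_trans h); apply: le1 => //.
  by rewrite (le_trans (ler_norm _))// lerDl.
apply: (le_trans (HC1 y y0)); apply: le1 => //.
by rewrite (le_trans (ler_norm _))// lerDr.
Qed.

Lemma ae_mono (P Q : R -> Prop) : (forall x, P x -> Q x) ->
  {ae mu, forall x, P x} -> {ae mu, forall x, Q x}.
Proof. by move=> PQ; apply: filterS => //; exact: (ae_filter_ringOfSetsType mu). Qed.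

Lemma ae_and (P Q : R -> Prop) : {ae mu, forall x, P x} ->
  {ae mu, forall x, Q x} -> {ae mu, forall x, P x /\ Q x}.
Proof. by apply: filterI; exact: (ae_filter_ringOfSetsType mu). Qed.

Lemma integral_pos_dominated (fn : nat -> R -> R) (f g : R -> R) :
  (forall n, measurable_fun D (fn n)) ->
  (forall x : R, 0 < x -> fn n x @[n --> \oo] --> f x) ->
  integrable_pos g -> (forall n (x : R), 0 < x -> `|fn n x| <= g x) ->
  integral_pos (fn n) @[n --> \oo] --> integral_pos f.
Proof.
move=> mfn cf hg fg.
have mf : measurable_fun D f.
  apply: (measurable_fun_cvg mfn) => x; rewrite D_gt0; exact: cf.
have hf : integrable_pos f.
  apply: le_integrable_pos mf hg _ => x x0.
  have c : (fun n => `|fn n x|) @ \oo --> `|f x| by apply: cvg_norm; exact: cf.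
  rewrite -(cvg_lim _ c)//; apply: limr_le; first by apply: cvgP; exact: c.
  by apply: nearW => n; exact: fg.
have h : (\int[mu]_(x in D) (fn n x)%:E)%E @[n --> \oo] --> (\int[mu]_(x in D) (f x)%:E)%E.
  apply: (@dominated_cvg _ _ _ mu D mD (fun n => EFin \o fn n) (EFin \o f) (EFin \o g)) => //.
  - by move=> n; apply/measurable_EFinP; exact: mfn.
  - by move=> x; rewrite D_gt0 => x0; apply: cvg_EFin; [exact: nearW|exact: cf].
  - by move=> n x; rewrite D_gt0 => x0; rewrite /= lee_fin fg.
by apply: fine_cvg; rewrite fineK//; exact: integrable_fin_num.
Qed.

Lemma integral_pos_dominated_eq0 (fn : nat -> R -> R) (f g : R -> R) :
  (forall n, measurable_fun D (fn n)) ->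
  (forall x : R, 0 < x -> fn n x @[n --> \oo] --> f x) ->
  integrable_pos g -> (forall n (x : R), 0 < x -> `|fn n x| <= g x) ->
  (forall n, integral_pos (fn n) = 0) -> integral_pos f = 0.
Proof.
move=> mfn cf hg fg f0; have := integral_pos_dominated mfn cf hg fg.
rewrite (_ : (fun n => integral_pos (fn n)) = (fun _ => 0)); last by apply/funext.
by move=> h; apply/esym; apply: (cvg_unique _ (cvg_cst (0 : R)) h).
Qed.

(** Vanishing tails make the indefinite integral of [H] constant on the positive half line; almost
    everywhere its derivative is [H]. *)
Lemma integral_pos_tails_ae0 (H : R -> R) : integrable_pos H ->
  (forall c : R, 0 < c -> integral_pos (fun x => H x * (c < x)%R%:R) = 0) ->
  {ae mu, forall x : R, 0 < x -> H x = 0}.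
Proof.
move=> hH tail; pose h := (H \_ D).
have hE (x : R) : 0 < x -> h x = H x by move=> x0; rewrite /h patchE mem_set// D_gt0.
have h0 (x : R) : x <= 0 -> h x = 0.
  move=> x0; rewrite /h patchE memNset// D_gt0; apply/negP; rewrite -leNgt//.
have ih : mu.-integrable setT (EFin \o h).
  have := (@integrable_mkcond _ _ _ mu D (EFin \o H) mD).1 hH.
  by rewrite -restrict_EFin.
pose F x := \int[mu]_(t in [set` `]-oo, x]]) h t.
have Fc (x : R) : 0 < x -> F x = integral_pos H.
  move=> x0; rewrite -[RHS]subr0 -(tail x x0) -integral_posB//; last first.
    apply: (le_integrable_pos _ (integrable_abse hH)) => //.
      apply: measurable_funM; first exact: integrable_pos_measurable.
      apply: measurable_funTS.
      rewrite (_ : (fun _ => _) = \1_(`]x, +oo[%classic : set R)).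
        by apply: measurable_indic; exact: measurable_itv.
      by apply/funext => y; rewrite indicE mem_setE in_itv/= andbT.
    by move=> y _; rewrite normrM ler_piMr//; case: (_ < _); rewrite ?normr1 ?normr0.
  rewrite /F Rintegral_mkcond /integral_pos [RHS]Rintegral_mkcond.
  apply: eq_Rintegral => y _; rewrite !patchE.
  have [y0|y0] := ltP 0 y.
    rewrite [y \in D]mem_set ?D_gt0// hE//.
    have [xy|yx] := ltP x y.
      rewrite memNset ?mulr1 ?subrr//= in_itv/=; apply/negP; rewrite -ltNge//.
    by rewrite mem_set/= ?in_itv//= mulr0 subr0.
  rewrite [y \in D]memNset ?D_gt0; last by apply/negP; rewrite -leNgt.
  by case: ifP => // _; rewrite h0.
have ihy y : mu.-integrable `]-oo, y] (EFin \o h).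
  by apply: integrableS ih => //; exact: measurable_itv.
have := FTC1Ny ihy (open_integrable_locally openT ih).
apply: ae_mono => x [dF Fx] x0; rewrite -hE// -Fx derive1E.
suff Hd : is_derive x (1 : R) F 0 by exact: (@derive_val _ _ _ _ _ _ _ Hd).
apply: (@is_derive_quad _ _ _ _ 0 x) => // y yx.
have y0 : 0 < y by move: yx; rewrite ltr_norml => /andP[]; lra.
by rewrite !Fc// subrr mulr0 subr0 normr0 mul0r.
Qed.

Lemma onemXn_le (y : R) N : 0 <= y <= 1 -> 1 - (1 - y) ^+ N <= N%:R * y.
Proof.
move=> /andP[y0 y1]; elim: N => [|k IHk]; first by rewrite mul0r expr0 subrr.
rewrite exprS -natr1.
have : (1 - y) ^+ k <= 1 by rewrite exprn_ile1//; lra.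
have : 0 <= (1 - y) ^+ k by rewrite exprn_ge0//; lra.
by move: IHk; move: (_ ^+ k) (k%:R : R) => A B; nra.
Qed.

(* The moments of [G] against [T^m exp(- p0 T)] determine those against
   [exp(- p T)] for [p >= p0], by expanding in powers of [p - p0] in steps
   smaller than [p0]; the functions [(1 - exp(- b n T))^(2^n)] of these
   exponentials converge to the indicator function of a half line. *)
Section Moments.
Variables (T G : R -> R) (p0 : R).
Hypothesis T0 : forall x : R, 0 < x -> 0 < T x.
Hypothesis Tinc : forall x y : R, 0 < x -> x < y -> T x < T y.
Hypothesis mT : measurable_fun D T.
Hypothesis mG : measurable_fun D G.
Hypothesis hG : forall m (e : R), 0 < e -> integrable_pos (fun x => G x * T x ^+ m * expR (- (e * T x))).
Hypothesis p0_gt0 : 0 < p0.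

Let moments0 p := forall m, integral_pos (fun x => G x * T x ^+ m * expR (- (p * T x))) = 0.

Let meT (p : R) : measurable_fun D (fun x => expR (- (p * T x))).
Proof.
apply: measurableT_comp => //; apply: measurableT_comp => //.
by apply: measurable_funM.
Qed.

Let mGTe m p : measurable_fun D (fun x => G x * T x ^+ m * expR (- (p * T x))).
Proof.
apply: measurable_funM => //; apply: measurable_funM => //.
exact: measurable_funX.
Qed.

(** The Taylor partial sums of [exp(- q T)] are bounded by [exp(q T)], so in front of [exp(- p T)]
    they are dominated by [exp(- (p - q) T)]. This is integrable against [G T^m] precisely because
    the step is smaller than [p]. *)
Lemma moments_shift (p q : R) : 0 <= q -> q < p -> moments0 p -> moments0 (p + q).
Proof.
move=> q0 qp mp m.
have p_gt0 : 0 < p by apply: le_lt_trans qp.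
pose S n (y : R) := series (exp_coeff y) n.
have SE n y : S n y = \sum_(k < n) y ^+ k / k`!%:R by rewrite /S /series/= big_mkord.
apply: (@integral_pos_dominated_eq0 (fun n x => G x * T x ^+ m * expR (- (p * T x)) * S n (- (q * T x)))
  _ (fun x => `|G x * T x ^+ m * expR (- ((p - q) * T x))|)).
- move=> n; apply: measurable_funM => //.
  rewrite (_ : (fun _ => _) = (fun x => \sum_(k < n) (- (q * T x)) ^+ k / k`!%:R)); last first.
    by apply/funext => x; rewrite SE.
  apply: measurable_sum => k.
  apply: measurable_funM => //; apply: measurable_funX.
  by apply: measurableT_comp => //; apply: measurable_funM.
- move=> x x0.
  rewrite (_ : - ((p + q) * T x) = - (p * T x) + - (q * T x)); last by ring.
  rewrite expRD mulrA; apply: cvgMl_tmp.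
  exact: is_cvg_series_exp_coeff.
- have := hG m (_ : 0 < p - q); rewrite subr_gt0 => /(_ qp) h.
  exact: integrable_norm h.
- move=> n x x0; have t0 := ltW (T0 x0); have qt : 0 <= q * T x by rewrite mulr_ge0.
  rewrite normrM [leRHS]normrM (normrM (G x * _)) -mulrA ler_wpM2l//.
  rewrite [leRHS]ger0_norm ?expR_ge0// ger0_norm ?expR_ge0//.
  rewrite (_ : - ((p - q) * T x) = - (p * T x) + q * T x); last by ring.
  rewrite expRD ler_wpM2l ?expR_ge0//.
  apply: (@le_trans _ _ (S n (q * T x))).
    rewrite !SE (le_trans (ler_norm_sum _ _ _))// ler_sum// => k _.
    by rewrite normrM normfV normrX normrN !ger0_norm// ltW// ltr0n fact_gt0.
  apply: nondecreasing_cvgn_le; last exact: is_cvg_series_exp_coeff.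
  by apply: nondecreasing_series => k _ _; exact: exp_coeff_ge0.
- move=> n.
  rewrite (@eq_integral_pos _ (fun x => \sum_(k < n) ((- q) ^+ k / k`!%:R) *
     (G x * T x ^+ (m + k) * expR (- (p * T x))))); last first.
    move=> x _; rewrite SE mulr_sumr; apply: eq_bigr => k _.
    by rewrite -[- (q * T x)]mulNr exprMn exprD; ring.
  rewrite integral_pos_sum; last by move=> k; apply: integrable_posZ; exact: hG.
  by rewrite big1// => k _; rewrite integral_posZ ?mp ?mulr0//; exact: hG.
Qed.

Hypothesis mom0 : moments0 p0.

Lemma moments_all (p : R) : p0 <= p -> moments0 p.
Proof.
move=> p0p.
have H n : forall p, p0 <= p -> p <= p0 * (3 / 2) ^+ n -> moments0 p.
  elim: n => [|n IH] r r0 rn.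
    by have -> : r = p0; [apply/eqP; rewrite eq_le r0 -[p0]mulr1 rn|].
  have r_gt0 : 0 < r by apply: lt_le_trans r0.
  (* As [r' >= 2 r / 3], the step [r - r'] is at most [r / 3], hence smaller than [r']. *)
  have [r' [h1 h2 h3 h4]] : exists r', [/\ p0 <= r', r * (2 / 3) <= r', r' <= r &
      r' <= p0 * (3 / 2) ^+ n].
    exists (Num.max p0 (r * (2 / 3))); split.
    - by rewrite le_max lexx.
    - by rewrite le_max lexx orbT.
    - by rewrite ge_max r0/=; lra.
    - rewrite ge_max; apply/andP; split.
        by rewrite ler_peMr ?(ltW p0_gt0)// exprn_ege1//; lra.
      by move: rn; rewrite exprSr; move: (_ ^+ n) => A; lra.
  have -> : r = r' + (r - r') by ring.
  by apply: moments_shift; [lra|lra|exact: IH].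
have [n hn] : exists n, p / p0 <= (3 / 2) ^+ n.
  exists (Num.trunc (2 * (p / p0))).+1; set k := (Num.trunc _).+1.
  apply: (@le_trans _ _ (1 + k%:R / 2)).
    have : 2 * (p / p0) < k%:R by exact: Num.Theory.truncnS_gt.
    by lra.
  elim: k => [|k IHk]; first by rewrite mul0r addr0 expr0.
  rewrite exprS -natr1; have : 0 <= k%:R :> R by []. 
  move: IHk; move: (_ ^+ k) (k%:R : R) => A B; lra.
by apply: (H n) => //; rewrite mulrC -ler_pdivrMr.
Qed.

Lemma moments_poly (c : R) N (p : R) : 0 <= c -> p0 <= p ->
  integral_pos (fun x => G x * expR (- (p * T x)) * (1 - expR (- (c * T x))) ^+ N) = 0.
Proof.
move=> c0.
suff : forall p, p0 <= p ->
    integrable_pos (fun x => G x * expR (- (p * T x)) * (1 - expR (- (c * T x))) ^+ N) /\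
    integral_pos (fun x => G x * expR (- (p * T x)) * (1 - expR (- (c * T x))) ^+ N) = 0.
  by move=> H /H[].
elim: N => [|N IH] r r0.
  have r_gt0 : 0 < r by apply: lt_le_trans r0.
  have e (x : R) : 0 < x -> G x * T x ^+ 0 * expR (- (r * T x)) =
      G x * expR (- (r * T x)) * (1 - expR (- (c * T x))) ^+ 0.
    by move=> _; rewrite !expr0 !mulr1.
  split; first by apply: eq_integrable_pos e _; exact: hG.
  by rewrite -(eq_integral_pos e); exact: moments_all.
have e (x : R) : 0 < x -> G x * expR (- (r * T x)) * (1 - expR (- (c * T x))) ^+ N
    - G x * expR (- ((r + c) * T x)) * (1 - expR (- (c * T x))) ^+ N =
   G x * expR (- (r * T x)) * (1 - expR (- (c * T x))) ^+ N.+1.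
  move=> _; rewrite (_ : - ((r + c) * T x) = - (r * T x) + - (c * T x)); last by ring.
  by rewrite expRD exprS; ring.
have [h1 z1] := IH r r0; have [|h2 z2] := IH (r + c); first by rewrite ler_wpDr.
split; first by apply: (eq_integrable_pos e); exact: integrable_posB.
by rewrite -(eq_integral_pos e) integral_posB// z1 z2 subrr.
Qed.

(** The rate [b] satisfies [exp(- b T c) = 1/2]. With [N = n 2^n] and [u = exp(- n b T x)], the
    product [N u] is [n exp(- n (b T x - ln 2))], which tends to 0 if [x > c] and to infinity if
    [x <= c]; so [(1 - u)^N] tends to 1 or 0 accordingly. The factor [n] in the exponent decides the
    case [x = c]. *)
Lemma moments_tail (c : R) : 0 < c ->
  integral_pos (fun x => G x * expR (- (p0 * T x)) * (c < x)%R%:R) = 0.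
Proof.
move=> c0; have Tc := T0 c0.
pose b := ln 2 / T c.
have ln2 : 0 < ln 2 :> R by rewrite ln_gt0// ltr1n.
have b0 : 0 < b by rewrite divr_gt0.
have b0' := ltW b0.
pose u n x := expR (- (n%:R * b * T x)).
have u01 n (x : R) : 0 < x -> 0 <= u n x <= 1.
  move=> x0; have t0 := ltW (T0 x0).
  rewrite /u expR_ge0 /= -[leRHS]expR0 ler_expR oppr_le0.
  by apply: mulr_ge0 => //; apply: mulr_ge0.
have E n (x : R) : (n * 2 ^ n)%:R * u n x = n%:R * expR (- (n%:R * (b * T x - ln 2))).
  have -> : - (n%:R * (b * T x - ln 2)) = n%:R * ln 2 + - (n%:R * b * T x) by ring.
  rewrite expRD mulrC [n%:R * ln 2]mulrC expRM lnK ?posrE// powR_mulrn//.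
  by rewrite natrM natrX /u; ring.
apply: (@integral_pos_dominated_eq0 (fun n x => G x * expR (- (p0 * T x)) *
   (1 - expR (- ((n%:R * b) * T x))) ^+ (n * 2 ^ n)) _
   (fun x => `|G x * T x ^+ 0 * expR (- (p0 * T x))|)).
- move=> n; apply: measurable_funM; first exact: measurable_funM.
  apply: measurable_funX; apply: measurable_funB => //.
- move=> x x0; apply: cvgMl_tmp.
  have [cx|xc] := ltP c x.
    pose r := b * T x - ln 2.
    have r0 : 0 < r.
      by rewrite subr_gt0 /b mulrAC ltr_pdivlMr// ltr_pM2l// Tinc.
    apply/cvgrPdist_le => /= e e0; near=> n.
    have n0 : 0 < n%:R :> R by rewrite ltr0n; near: n; exact: nbhs_infty_gt.
    have e0' := ltW e0; have r0' := ltW r0; have n0' := ltW n0.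
    have /andP[u0 u1] := u01 n x x0.
    rewrite ger0_norm; last first.
      by rewrite subr_ge0 exprn_ile1// ?subr_ge0// lerBlDr lerDl.
    apply: (@le_trans _ _ ((n * 2 ^ n)%:R * u n x)).
      by apply: onemXn_le; rewrite u0.
    rewrite E -/r.
    (* A quadratic lower bound of the exponential is what beats the factor [n]. *)
    have := @expR_ge1Dxn R (n%:R * r) 1; rewrite mulr_ge0// => /(_ isT) h.
    rewrite expRN ler_pdivrMr ?expR_gt0//.
    have hn : 2 / (r ^+ 2 * e) <= n%:R by near: n; exact: nbhs_infty_ger.
    move: hn; rewrite ler_pdivrMr ?mulr_gt0 ?exprn_gt0// => hn.
    apply: (@le_trans _ _ (e * ((n%:R * r) ^+ 2 / 2))).
      move: n0 hn; move: (n%:R : R) => N N0; rewrite exprMn.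
      move=> hn; have : N * 2 <= N * (N * (r ^+ 2 * e)) by rewrite ler_pM2l.
      rewrite (_ : N * (N * (r ^+ 2 * e)) = e * (N ^+ 2 * r ^+ 2)); last by ring.
      by lra.
    by rewrite ler_wpM2l//; apply: le_trans h; rewrite lerDr.
  apply/cvgrPdist_le => /= e e0; near=> n.
  have n0 : 0 < n%:R :> R by rewrite ltr0n; near: n; exact: nbhs_infty_gt.
  have /andP[u0 u1] := u01 n x x0.
  rewrite sub0r normrN ger0_norm; last by rewrite exprn_ge0// subr_ge0.
  apply: (@le_trans _ _ (expR (- ((n * 2 ^ n)%:R * u n x)))).
    rewrite -/(u n x) (_ : - (_ * u n x) = - u n x * (n * 2 ^ n)%:R); last by ring.
    rewrite expRM_natr.
    by rewrite lerXn2r ?nnegrE ?subr_ge0 ?expR_ge0// expR_ge1Dx.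
  rewrite E; apply: (@le_trans _ _ (expR (- n%:R))).
    rewrite ler_expR lerN2 ler_peMr ?(ltW n0)// -[leLHS]expR0 ler_expR.
    rewrite oppr_ge0 mulr_ge0_le0 ?(ltW n0)// subr_le0.
    rewrite /b mulrAC ler_pdivrMr// ler_pM2l//.
    by move: xc; rewrite le_eqVlt => /predU1P[->//|]; move=> h; apply: ltW; exact: Tinc.
  rewrite expRN -[leRHS]invrK lef_pV2 ?posrE ?expR_gt0 ?invr_gt0//.
  apply: (@le_trans _ _ n%:R).
    by near: n; exact: nbhs_infty_ger.
  by apply: le_trans (expR_ge1Dx _); rewrite lerDr.
- by apply: integrable_norm; exact: hG.
- move=> n x x0; have /andP[u0 u1] := u01 n x x0.
  rewrite expr0 mulr1 normrM ler_piMr// ger0_norm ?exprn_ge0 ?exprn_ile1 ?subr_ge0//.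
- move=> n; apply: moments_poly => //; rewrite mulr_ge0.
Unshelve. all: by end_near. Qed.

Lemma moments_ae0 : {ae mu, forall x : R, 0 < x -> G x = 0}.
Proof.
have h : integrable_pos (fun x => G x * expR (- (p0 * T x))).
  by apply: (@eq_integrable_pos (fun x => G x * T x ^+ 0 * expR (- (p0 * T x)))); [move=> x _; rewrite expr0 mulr1|exact: hG].
have := integral_pos_tails_ae0 h moments_tail.
apply: ae_mono => x H x0; have /eqP := H x0.
by rewrite mulf_eq0 [X in _ || X]gt_eqF ?expR_gt0// orbF => /eqP.
Qed.

End Moments.
End HalfLine.

(** * The Laguerre basis on the half line *)

Section LaguerreBasis.
Variable R : realType.
Variables a s : R.
Hypothesis a0 : 0 < a.
Hypothesis s1 : -1 < s.
Local Notation mu := (@lebesgue_measure R).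

Definition tau (x : R) := 2 / a * x `^ a.
Definition lam := (s + 1) / a - 1.

Lemma tau_gt0 (x : R) : 0 < x -> 0 < tau x.
Proof. by move=> x0; rewrite mulr_gt0 ?divr_gt0 ?powR_gt0. Qed.

Lemma tau_ge0 x : 0 <= tau x.
Proof. by rewrite mulr_ge0 ?powR_ge0// divr_ge0// ltW. Qed.

Lemma tau_inc (x y : R) : 0 < x -> x < y -> tau x < tau y.
Proof.
move=> x0 xy; rewrite ltr_pM2l ?divr_gt0// gt0_ltr_powR// ?nnegrE; apply: ltW => //.
exact: lt_trans xy.
Qed.

Lemma powa_tau x : x `^ a = a / 2 * tau x.
Proof. by rewrite /tau; field; rewrite gt_eqF. Qed.

Lemma measurable_tau : measurable_fun setT tau.
Proof. by apply: measurable_funM => //; exact: measurable_powR. Qed.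

Definition fast_decay (f : R -> R) := forall m, exists C : R, forall t : R, 0 <= t -> `|t ^+ m * f t| <= C.

Lemma fast_decayM f g : fast_decay f -> fast_decay g -> fast_decay (fun t => f t * g t).
Proof.
move=> df dg m; have [C hC] := df m; have [B hB] := dg 0%N.
exists (C * B) => t t0; rewrite mulrA normrM ler_pM ?hC//.
by have := hB t t0; rewrite expr0 mul1r.
Qed.

Lemma fast_decayD f g : fast_decay f -> fast_decay g -> fast_decay (fun t => f t + g t).
Proof.
move=> df dg m; have [C hC] := df m; have [B hB] := dg m.
exists (C + B) => t t0; rewrite mulrDr (le_trans (ler_normD _ _))// lerD ?hC ?hB//.
Qed.

Lemma fast_decayZ c f : fast_decay f -> fast_decay (fun t => c * f t).
Proof.
move=> df m; have [C hC] := df m.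
by exists (`|c| * C) => t t0; rewrite mulrCA normrM ler_wpM2l ?hC.
Qed.

Lemma fast_decayX f : fast_decay f -> fast_decay (fun t => t * f t).
Proof.
move=> df m; have [C hC] := df m.+1.
by exists C => t t0; rewrite mulrA -exprSr hC.
Qed.

Lemma fast_decayB f g : fast_decay f -> fast_decay g -> fast_decay (fun t => f t - g t).
Proof.
move=> df dg; have := fast_decayD df (fast_decayZ (-1) dg).
by under eq_fun do rewrite mulN1r.
Qed.

Lemma fast_decay_dphi (l0 : R) n l : fast_decay (dphi l0 n l).
Proof.
move=> m; have [C [P [C0 H]]] := mulXn_dphi_pbound l0 m n.
by exists (C * l.+1%:R ^+ P) => t t0; exact: H.
Qed.

Lemma fast_decay_integrable_pos_pow (r : R) f : -1 < r -> fast_decay f ->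
  measurable_fun (`]0%R, +oo[%classic : set R) (f \o tau) ->
  integrable_pos (fun x => f (tau x) * x `^ r).
Proof.
move=> r1 df mf; apply: (integrable_pos_decay a0 r1).
  apply: measurable_funM => //.
  by apply: measurable_funTS; exact: measurable_powR.
move=> m; have [C hC] := df m; exists ((a / 2) ^+ m * C) => x x0.
have := hC _ (tau_ge0 x); rewrite (powa_tau x).
have := tau_ge0 x; move: (tau x) => t t0.
rewrite exprMn !normrM (ger0_norm (powR_ge0 x r)) (ger0_norm (exprn_ge0 m t0)) => h.
rewrite [leLHS](_ : _ = (a / 2) ^+ m * (t ^+ m * `|f t|) * x `^ r); last by ring.
by rewrite ler_wpM2r ?powR_ge0// ler_wpM2l// exprn_ge0// divr_ge0// ltW.
Qed.

Lemma fast_decay_integrable_pos f : fast_decay f ->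
  measurable_fun (`]0%R, +oo[%classic : set R) (f \o tau) ->
  integrable_pos (fun x => f (tau x) * x `^ s).
Proof. exact: fast_decay_integrable_pos_pow. Qed.

Lemma is_derive_tau (x : R) : 0 < x -> is_derive x (1 : R) tau (2 * x `^ (a - 1)).
Proof.
move=> x0; have h := is_deriveZ (2 / a) (is_derive1_powR a x0).
apply: (is_derive_eq h); rewrite /GRing.scale/=; field.
by rewrite gt_eqF.
Qed.

Lemma dphi_continuous (l0 : R) n l : continuous (dphi l0 n l).
Proof. by move=> t; exact: is_derive_continuous (is_derive_dphi l0 n l t). Qed.

Lemma measurable_comp_tau (f : R -> R) (A : set R) : measurable_fun setT f ->
  measurable_fun A (f \o tau).
Proof.
move=> mf; apply: measurable_funTS; apply: measurableT_comp => //.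
exact: measurable_tau.
Qed.

Lemma measurable_dphi (l0 : R) n l : measurable_fun setT (dphi l0 n l).
Proof. by apply: continuous_measurable_fun; exact: dphi_continuous. Qed.

(* The Laguerre operator conjugated by [exp(- t / 2)]. *)
Definition laguerre_op (t u u1 u2 : R) := t / 4 * u - (t * u2 + (lam + 1) * u1).

Lemma laguerre_op_phi l t : laguerre_op t (phi lam l t) (dphi lam 1 l t) (dphi lam 2 l t) =
  (l%:R + (lam + 1) / 2) * phi lam l t.
Proof. by rewrite /laguerre_op phi_ode; ring. Qed.

Lemma lam_gtN1 : -1 < lam.
Proof.
have h : 0 < s + 1 by have := s1; lra.
have : 0 < (s + 1) / a by rewrite divr_gt0.
rewrite /lam; lra.
Qed.

Lemma cvg_pow_fast_decay (h : R -> R) : fast_decay h ->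
  (n.+2%:R `^ (s + 1) * h (tau n.+2%:R)) @[n --> \oo] --> (0 : R).
Proof.
move=> dh; pose M := (Num.trunc ((s + 2) / a)).+1.
have aM : s + 2 <= a * M%:R.
  by rewrite mulrC -ler_pdivrMr// ltW// Num.Theory.truncnS_gt.
have [C hC] := dh M; pose B := (a / 2) ^+ M * `|C|.
have B0 : 0 <= B by rewrite mulr_ge0// exprn_ge0// divr_ge0// ltW.
have H n : `|n.+2%:R `^ (s + 1) * h (tau n.+2%:R)| <= B / n.+2%:R.
  set x := n.+2%:R; have x0 : 0 < x by [].
  have x1 : 1 <= x by rewrite ler1n.
  rewrite ler_pdivlMr// normrM ger0_norm ?powR_ge0// mulrAC.
  have -> : x `^ (s + 1) * x = x `^ (s + 2).
    by rewrite [RHS]powR_pred// (_ : s + 2 - 1 = s + 1)//; ring.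
  apply: (@le_trans _ _ ((x `^ a) ^+ M * `|h (tau x)|)).
    by rewrite ler_wpM2r// -powR_mulrn ?powR_ge0// -powRrM ler_powR.
  have := hC _ (tau_ge0 x); rewrite (powa_tau x); have := tau_ge0 x.
  move: (tau x) => t t0; rewrite normrM (ger0_norm (exprn_ge0 _ t0)) => h1.
  have ca0 : 0 <= (a / 2) ^+ M by rewrite exprn_ge0// divr_ge0// ltW.
  by rewrite exprMn -mulrA ler_wpM2l//; exact: le_trans h1 (ler_norm _).
apply/norm_cvg0P; apply: (squeeze_cvgr (f := fun _ => 0) (h := fun n => B / n.+2%:R)).
- by apply: nearW => n; rewrite normr_ge0 H.
- exact: cvg_cst.
- rewrite -[X in _ --> X](mulr0 B); apply: cvgMl_tmp.
  have := @cvg_harmonic R; rewrite -(cvg_shiftS (@harmonic R)); apply: cvg_trans.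
  by apply: near_eq_cvg; apply: nearW.
Qed.

Lemma cvg_pow_fast_decay0 (h : R -> R) : fast_decay h ->
  (n.+2%:R^-1 `^ (s + 1) * h (tau n.+2%:R^-1)) @[n --> \oo] --> (0 : R).
Proof.
move=> dh; have [C hC] := dh 0%N.
have p0 : 0 < s + 1 by have := s1; lra.
have cx : (n.+2%:R^-1 `^ (s + 1)) @[n --> \oo] --> (0 : R).
  apply/cvgrPdist_le => /= e e0; near=> n.
  rewrite sub0r normrN ger0_norm ?powR_ge0//.
  rewrite [leRHS](_ : e = (e `^ (s + 1)^-1) `^ (s + 1)); last first.
    by rewrite -powRrM mulVf ?gt_eqF// powRr1// ltW.
  rewrite ge0_ler_powR ?nnegrE ?powR_ge0 ?(ltW p0)//.
  rewrite -[leRHS]invrK lef_pV2 ?posrE ?invr_gt0 ?powR_gt0//.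
  apply: (@le_trans _ _ n%:R); last by rewrite ler_nat -addn2 leq_addr.
  by near: n; exact: nbhs_infty_ger.
apply/norm_cvg0P; apply: (squeeze_cvgr (f := fun _ => 0) (h := fun n => `|C| * n.+2%:R^-1 `^ (s + 1))).
- apply: nearW => n; rewrite normr_ge0/= normrM [X in X * _]ger0_norm ?powR_ge0// mulrC ler_wpM2r ?powR_ge0//.
  have := hC _ (tau_ge0 n.+2%:R^-1); rewrite expr0 mul1r => h1; exact: le_trans h1 (ler_norm _).
- exact: cvg_cst.
- by rewrite -[X in _ --> X](mulr0 `|C|); apply: cvgMl_tmp.
Unshelve. all: by end_near. Qed.

(** In the variable [x] the integrand is the derivative of [- a^-1 x^(s+1) (f1 g - f g1)(tau x)];
    the boundary terms vanish by decay at infinity and by [s + 1 > 0] at 0. *)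
Lemma laguerre_op_sym (f f1 f2 g g1 g2 : R -> R) :
  (forall t : R, 0 < t -> is_derive t (1 : R) f (f1 t)) ->
  (forall t : R, 0 < t -> is_derive t (1 : R) f1 (f2 t)) ->
  (forall t : R, 0 < t -> {for t, continuous f2}) ->
  (forall t : R, 0 < t -> is_derive t (1 : R) g (g1 t)) ->
  (forall t : R, 0 < t -> is_derive t (1 : R) g1 (g2 t)) ->
  (forall t : R, 0 < t -> {for t, continuous g2}) ->
  fast_decay f -> fast_decay f1 -> fast_decay f2 -> fast_decay g -> fast_decay g1 -> fast_decay g2 ->
  integral_pos (fun x => (laguerre_op (tau x) (f (tau x)) (f1 (tau x)) (f2 (tau x)) * g (tau x)
              - f (tau x) * laguerre_op (tau x) (g (tau x)) (g1 (tau x)) (g2 (tau x))) * x `^ s) = 0.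
Proof.
move=> df df1 cf2 dg dg1 cg2 ef ef1 ef2 eg eg1 eg2.
pose h t := f1 t * g t - f t * g1 t.
pose h' t := f2 t * g t - f t * g2 t.
pose q t := a * ((lam + 1) * h t + t * h' t).
have dh (t : R) : 0 < t -> is_derive t (1 : R) h (h' t).
  move=> t0; have H := is_deriveB (is_deriveM (df1 t t0) (dg t t0)) (is_deriveM (df t t0) (dg1 t t0)).
  by apply: (is_derive_eq H); rewrite /GRing.scale/= /h'; ring.
have eh : fast_decay h by apply: fast_decayB; apply: fast_decayM.
have eh' : fast_decay h' by apply: fast_decayB; apply: fast_decayM.
have eq' : fast_decay q by apply: fast_decayZ; apply: fast_decayD; [apply: fast_decayZ|apply: fast_decayX].
have cq (t : R) : 0 < t -> {for t, continuous q}.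
  move=> t0; apply: cvgM; first exact: cvg_cst.
  apply: cvgD; first by apply: cvgM; [exact: cvg_cst|exact: is_derive_continuous (dh t t0)].
  apply: cvgM; first exact: cvg_id.
  apply: cvgB; apply: cvgM.
  - exact: cf2.
  - exact: is_derive_continuous (dg t t0).
  - exact: is_derive_continuous (df t t0).
  - exact: cg2.
have cJ (x : R) : 0 < x -> {for x, continuous (fun y => q (tau y) * y `^ s)}.
  move=> x0; apply: cvgM; last exact: continuous_powR_pos.
  apply: (continuous_comp (f := tau) (g := q)).
    exact: is_derive_continuous (is_derive_tau x0).
  by apply: cq; exact: tau_gt0.
have hJ : integrable_pos (fun x => q (tau x) * x `^ s).
  apply: fast_decay_integrable_pos => //; apply: continuous_at_measurable => x x0.
  apply: (continuous_comp (f := tau) (g := q)).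
    exact: is_derive_continuous (is_derive_tau x0).
  by apply: cq; exact: tau_gt0.
have E (x : R) : 0 < x -> - a^-1 * (q (tau x) * x `^ s) =
  (laguerre_op (tau x) (f (tau x)) (f1 (tau x)) (f2 (tau x)) * g (tau x)
              - f (tau x) * laguerre_op (tau x) (g (tau x)) (g1 (tau x)) (g2 (tau x))) * x `^ s.
  move=> _; rewrite /laguerre_op /q /h /h'; move: (tau x) (x `^ s) => t z.
  by field; rewrite gt_eqF.
rewrite -(eq_integral_pos E) integral_posZ//.
suff -> : integral_pos (fun x => q (tau x) * x `^ s) = 0 by rewrite mulr0.
apply: (@integral_pos_derive_eq0 _ (fun x => x `^ (s + 1) * h (tau x))) => //.
- move=> x x0; have t0 := tau_gt0 x0.
  have dht := is_derive1_comp (dh _ t0) (is_derive_tau x0).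
  have H := is_deriveM (is_derive1_powR (s + 1) x0) dht.
  apply: (is_derive_eq H); rewrite /GRing.scale/=.
  rewrite (_ : s + 1 - 1 = s); last by ring.
  have -> : x `^ (s + 1) = x `^ s * x by rewrite (powR_pred (s + 1) x0) addrK.
  have ta : tau x * a = 2 * (x `^ (a - 1) * x).
    by rewrite -(powR_pred a x0) /tau; field; rewrite gt_eqF.
  have la : a * (lam + 1) = s + 1 by rewrite /lam; field; rewrite gt_eqF.
  have -> : q (tau x) = a * (lam + 1) * h (tau x) + tau x * a * h' (tau x).
    by rewrite /q; move: (tau x) => t; ring.
  by rewrite la ta; ring.
- exact: cvg_pow_fast_decay.
- exact: cvg_pow_fast_decay0.
Qed.

Definition basis l x := phi lam l (tau x).
Definition nrm l := integral_pos (fun x => basis l x ^+ 2 * x `^ s).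
Definition eigen l : R := l%:R + (lam + 1) / 2.

Lemma integrable_pos_fast_decay2 f g : fast_decay f -> fast_decay g -> measurable_fun setT f -> measurable_fun setT g ->
  integrable_pos (fun x => f (tau x) * g (tau x) * x `^ s).
Proof.
move=> df dg mf mg; apply: (@fast_decay_integrable_pos (fun t => f t * g t)); first exact: fast_decayM.
by apply: measurable_comp_tau; apply: measurable_funM.
Qed.

Lemma integrable_pos_basis2 l j : integrable_pos (fun x => basis l x * basis j x * x `^ s).
Proof.
apply: (integrable_pos_fast_decay2 (fast_decay_dphi lam 0 l) (fast_decay_dphi lam 0 j)); exact: (measurable_dphi lam 0).
Qed.

Lemma laguerre_op_basis_sym (u u1 u2 : R -> R) l :
  (forall t : R, is_derive t (1 : R) u (u1 t)) ->
  (forall t : R, is_derive t (1 : R) u1 (u2 t)) ->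
  continuous u2 -> fast_decay u -> fast_decay u1 -> fast_decay u2 ->
  integral_pos (fun x => laguerre_op (tau x) (u (tau x)) (u1 (tau x)) (u2 (tau x)) * basis l x * x `^ s) =
  eigen l * integral_pos (fun x => u (tau x) * basis l x * x `^ s).
Proof.
move=> du du1 cu2 eu eu1 eu2.
have mu0 : measurable_fun setT u.
  by apply: continuous_measurable_fun => t; exact: is_derive_continuous (du t).
have mu1 : measurable_fun setT u1.
  by apply: continuous_measurable_fun => t; exact: is_derive_continuous (du1 t).
have mu2 : measurable_fun setT u2 by apply: continuous_measurable_fun.
have mphi : measurable_fun setT (phi lam l) := measurable_dphi lam 0 l.
have ephi : fast_decay (phi lam l) := fast_decay_dphi lam 0 l.
pose Ku t := laguerre_op t (u t) (u1 t) (u2 t).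
have KE : Ku = (fun t => 4^-1 * (t * u t) - (t * u2 t + (lam + 1) * u1 t)).
  by apply/funext => t; rewrite /Ku /laguerre_op; ring.
have eK : fast_decay Ku.
  rewrite KE; apply: fast_decayB; first by apply: fast_decayZ; exact: fast_decayX.
  by apply: fast_decayD; [exact: fast_decayX|exact: fast_decayZ].
have mK : measurable_fun setT Ku.
  rewrite KE; apply: measurable_funB; first by do 2!apply: measurable_funM => //.
  by apply: measurable_funD; apply: measurable_funM.
have h1 : integrable_pos (fun x => Ku (tau x) * basis l x * x `^ s) by exact: integrable_pos_fast_decay2.
have h2 : integrable_pos (fun x => u (tau x) * basis l x * x `^ s) by exact: integrable_pos_fast_decay2.
apply/eqP; rewrite -subr_eq0 -integral_posZ// -integral_posB//; last exact: integrable_posZ.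
have S := @laguerre_op_sym u u1 u2 (phi lam l) (dphi lam 1 l) (dphi lam 2 l)
  (fun t _ => du t) (fun t _ => du1 t) (fun t _ => cu2 t)
  (fun t _ => is_derive_dphi lam 0 l t) (fun t _ => is_derive_dphi lam 1 l t)
  (fun t _ => @dphi_continuous lam 2 l t) eu eu1 eu2
  (fast_decay_dphi lam 0 l) (fast_decay_dphi lam 1 l) (fast_decay_dphi lam 2 l).
apply/eqP; rewrite -[RHS]S; apply: eq_integral_pos => x _.
by rewrite laguerre_op_phi -/(eigen l) /basis /Ku; ring.
Qed.

Lemma basis_ortho l j : l != j -> integral_pos (fun x => basis l x * basis j x * x `^ s) = 0.
Proof.
move=> lj.
have := @laguerre_op_basis_sym (phi lam l) (dphi lam 1 l) (dphi lam 2 l) j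
  (is_derive_dphi lam 0 l) (is_derive_dphi lam 1 l) (@dphi_continuous lam 2 l)
  (fast_decay_dphi lam 0 l) (fast_decay_dphi lam 1 l) (fast_decay_dphi lam 2 l).
rewrite (@eq_integral_pos _ _ (fun x => eigen l * (basis l x * basis j x * x `^ s))); last first.
  by move=> x _; rewrite laguerre_op_phi -/(eigen l) /basis; ring.
rewrite integral_posZ; last exact: integrable_pos_basis2.
move=> /eqP; rewrite -subr_eq0 -mulrBl mulf_eq0 => /orP[|/eqP//].
rewrite /eigen (_ : _ - _ = l%:R - j%:R); last by ring.
by rewrite subr_eq0 eqr_nat (negbTE lj).
Qed.

Lemma mul_tau_basis l x : tau x * basis l x =
  - l.+1%:R * basis l.+1 x + (2 * l%:R + lam + 1) * basis l x
  - (l%:R + lam) * (if l is k.+1 then basis k x else 0).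
Proof. by rewrite /basis mulX_phi /phim1; case: l. Qed.

(** The integral of [tau * basis l * basis l.+1] is computed twice, expanding [tau * basis l] and
    then [tau * basis l.+1] by the three-term relation; orthogonality leaves one norm each time. *)
Lemma nrm_rec l : l.+1%:R * nrm l.+1 = (l.+1%:R + lam) * nrm l.
Proof.
have nE k : nrm k = integral_pos (fun x => basis k x * basis k x * x `^ s).
  by apply: eq_integral_pos => x _; rewrite expr2.
have E1 : integral_pos (fun x => tau x * basis l x * basis l.+1 x * x `^ s) = - l.+1%:R * nrm l.+1.
  rewrite (@eq_integral_pos _ _ (fun x => \sum_(i < 3) (if i == 0 :> nat then - l.+1%:R * (basis l.+1 x * basis l.+1 x * x `^ s)
     else if i == 1%N :> nat then (2 * l%:R + lam + 1) * (basis l x * basis l.+1 x * x `^ s)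
     else - (l%:R + lam) * (if l is k.+1 then basis k x * basis l.+1 x * x `^ s else 0)))); last first.
    by move=> x _; rewrite mul_tau_basis !big_ord_recl big_ord0/=; case: (l) => [|k]; ring.
  rewrite integral_pos_sum; last first.
    case=> [[|[|i]]] hi /=; apply: integrable_posZ; rewrite ?integrable_pos_basis2//.
    case: (l) => [|k]; last exact: integrable_pos_basis2.
    exact: integrable0.
  rewrite !big_ord_recl big_ord0/= addr0 !integral_posZ ?integrable_pos_basis2//; last first.
    case: (l) => [|k]; last exact: integrable_pos_basis2.
    exact: integrable0.
  rewrite [X in _ + (_ * X + _)]basis_ortho ?(ltn_eqF (ltnSn l))// mulr0 add0r nE.
  case: (l) => [|k]; first by rewrite integral_pos0 mulr0 addr0.
  by rewrite (@basis_ortho k k.+2) ?mulr0 ?addr0// ltn_eqF// ltnS leqnSn.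
have E2 : integral_pos (fun x => tau x * basis l.+1 x * basis l x * x `^ s) = - (l.+1%:R + lam) * nrm l.
  rewrite (@eq_integral_pos _ _ (fun x => - l.+2%:R * (basis l.+2 x * basis l x * x `^ s) +
     ((2 * l.+1%:R + lam + 1) * (basis l.+1 x * basis l x * x `^ s) +
      - (l.+1%:R + lam) * (basis l x * basis l x * x `^ s)))); last first.
    by move=> x _; rewrite mul_tau_basis; ring.
  rewrite !integral_posD ?integral_posZ; try (do ?[exact: integrable_posZ (integrable_pos_basis2 _ _)|exact: integrable_pos_basis2|apply: integrable_posD; exact: integrable_posZ (integrable_pos_basis2 _ _)]).
  rewrite (@basis_ortho l.+2 l) ?(@basis_ortho l.+1 l) ?mulr0 ?add0r ?nE//.
    by rewrite gtn_eqF// ltnS leqnSn.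
  by rewrite gtn_eqF.
have : - l.+1%:R * nrm l.+1 = - (l.+1%:R + lam) * nrm l.
  by rewrite -E1 -E2; apply: eq_integral_pos => x _; ring.
by rewrite !mulNr => /oppr_inj.
Qed.

Lemma not_ae_neg : ~ {ae mu, forall x : R, ~ (0 < x)}.
Proof.
move=> H; have : mu.-negligible (`]0%R, +oo[%classic : set R).
  by apply: negligibleS H => x; rewrite D_gt0 => x0 /=; apply.
move=> /negligibleP => /(_ (measurable_itv _)).
move=> h0; have : mu (`]0%R, +oo[%classic : set R) = +oo%E.
  by rewrite lebesgue_measure_itv/= ltry.
by rewrite [LHS]h0.
Qed.

Lemma integral_pos_ge0_eq0 (f : R -> R) : integrable_pos f -> (forall x : R, 0 < x -> 0 <= f x) ->
  integral_pos f = 0 -> {ae mu, forall x : R, 0 < x -> f x = 0}.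
Proof.
move=> hf f0 If.
have H : (\int[mu]_(x in `]0%R, +oo[) `|(EFin \o f) x|)%E = 0%E.
  transitivity (\int[mu]_(x in `]0%R, +oo[) (f x)%:E)%E.
    by apply: eq_integral => x; rewrite inE D_gt0 => x0; rewrite /= ger0_norm// f0.
  have finite_coefs : (\int[mu]_(x in `]0%R, +oo[) (f x)%:E)%E \is a fin_num.
    by apply: integrable_fin_num => //; exact: measurable_itv.
  by rewrite -[LHS](fineK finite_coefs); move: If; rewrite /integral_pos /Rintegral => ->.
have := (@ae_eq_integral_abs _ _ _ mu _ (measurable_itv _) (EFin \o f) (measurable_int _ hf)).1 H.
by apply: ae_mono => x; rewrite D_gt0 => h /h [].
Qed.

Lemma integral_pos_gt0 (f : R -> R) : integrable_pos f -> (forall x : R, 0 < x -> 0 < f x) -> 0 < integral_pos f.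
Proof.
move=> hf f0; have f0' (x : R) : 0 < x -> 0 <= f x by move=> /f0/ltW.
rewrite lt_neqAle; apply/andP; split; last first.
  by apply: Rintegral_ge0 => x; rewrite D_gt0; exact: f0'.
apply/eqP => /esym /(integral_pos_ge0_eq0 hf f0'); move=> H; apply: not_ae_neg.
by apply: ae_mono H => x h x0; have := f0 x x0; rewrite h// ltxx.
Qed.

Lemma nrm_gt0 l : 0 < nrm l.
Proof.
elim: l => [|l IH].
  apply: integral_pos_gt0.
    by apply: eq_integrable_pos (integrable_pos_basis2 0 0) => x _; rewrite expr2.
  move=> x x0; rewrite mulr_gt0 ?powR_gt0// exprn_gt0// /basis /phi.
  by rewrite -laguerreE /laguerre big_ord_recl big_ord0 addr0 !expr0 gbinom0 fact0 divr1 !mulr1 mul1r expR_gt0.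
have l0 : 0 < l.+1%:R :> R by [].
rewrite -(pmulr_rgt0 _ l0) nrm_rec mulr_gt0//.
by have := lam_gtN1; have : 1 <= l.+1%:R :> R; [rewrite ler1n|lra].
Qed.

(** By [nrm_rec] and [lam > -1], the product [(l + 1) * nrm (l + 1)] does not decrease in [l]; only
    the value at index 0 has to be added to the minimum. *)
Lemma nrm_lower : exists2 c, 0 < c & forall l, c <= nrm l * l.+1%:R.
Proof.
have h0 : 0 < nrm 0 by exact: nrm_gt0.
have h1 : 0 < 1 + lam by have := lam_gtN1; lra.
pose c := Num.min (nrm 0) (nrm 1); exists c; first by rewrite lt_min !nrm_gt0.
case=> [|l]; first by rewrite mulr1 ge_min lexx.
apply: (@le_trans _ _ (nrm l.+1 * l.+1%:R)); last first.
  by rewrite ler_wpM2l ?ler_nat// ltW// nrm_gt0.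
elim: l => [|l IH]; first by rewrite mulr1 ge_min lexx orbT.
apply: (le_trans IH); rewrite [leRHS]mulrC nrm_rec mulrC ler_wpM2r//.
  by rewrite ltW// nrm_gt0.
by have := lam_gtN1; rewrite -natr1; lra.
Qed.

(** The three-term relation extends the orthogonality to all [tau^m * basis l]. Since [basis 0] is
    [exp(- tau / 2)], these contain the moments that [moments_ae0] needs, with [p0 = 1/2] and
    [G = g * x^s]. *)
Lemma basis_complete (g : R -> R) :
  measurable_fun (`]0%R, +oo[%classic : set R) g ->
  integrable_pos (fun x => g x ^+ 2 * x `^ s) ->
  (forall l, integral_pos (fun x => g x * basis l x * x `^ s) = 0) ->
  {ae mu, forall x : R, 0 < x -> g x = 0}.
Proof.
move=> mg hg H.
have mxs : measurable_fun (`]0%R, +oo[%classic : set R) (fun x : R => x `^ s).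
  by apply: measurable_funTS; exact: measurable_powR.
have hgf (f : R -> R) : fast_decay f -> measurable_fun setT f ->
    integrable_pos (fun x => g x * f (tau x) * x `^ s).
  move=> df mf; apply: (@le_integrable_pos _ _ (fun x => g x ^+ 2 * x `^ s + f (tau x) * f (tau x) * x `^ s)).
  - apply: measurable_funM => //; apply: measurable_funM => //.
    exact: measurable_comp_tau.
  - by apply: integrable_posD => //; exact: integrable_pos_fast_decay2.
  - move=> x x0; rewrite -mulrDl normrM [X in _ * X]ger0_norm ?powR_ge0//.
    rewrite ler_wpM2r ?powR_ge0// ler_norml; move: (g x) (f (tau x)) => A B.
    by apply/andP; split; nra.
have texp (m : nat) (e : R) : 0 < e -> fast_decay (fun t => t ^+ m * expR (- (e * t))).
  move=> e0 j; exists ((j + m)`!%:R / e ^+ (j + m)) => t t0.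
  rewrite mulrA -exprD ger0_norm ?mulr_ge0 ?exprn_ge0 ?expR_ge0//.
  rewrite expRN ler_pdivrMr ?expR_gt0//.
  have k0 : 0 < e ^+ (j + m) by rewrite exprn_gt0.
  rewrite mulrAC ler_pdivlMr// -exprMn mulrC -ler_pdivrMl ?ltr0n ?fact_gt0//.
  rewrite mulrC [t * e]mulrC.
  have et : 0 <= e * t by rewrite mulr_ge0// ltW.
  case: (j + m)%N => [|i].
    by rewrite expr0 fact0 invr1 mulr1 -[leLHS]expR0 ler_expR.
  by rewrite [leLHS]mulrC; apply: (le_trans _ (expR_ge1Dxn i et)); rewrite lerDr.
have H2 m l : integral_pos (fun x => g x * (tau x ^+ m * basis l x) * x `^ s) = 0.
  have hh m' l' : integrable_pos (fun x => g x * (tau x ^+ m' * basis l' x) * x `^ s).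
    apply: (hgf (fun t => t ^+ m' * phi lam l' t)).
      elim: m' => [|m' IHm']; first by under eq_fun do rewrite expr0 mul1r; exact: (fast_decay_dphi lam 0).
      by under eq_fun do rewrite exprS -mulrA; exact: fast_decayX.
    by apply: measurable_funM; [exact: measurable_funX|exact: (measurable_dphi lam 0)].
  elim: m l => [|m IH] l.
    by rewrite -[RHS](H l); apply: eq_integral_pos => x _; rewrite expr0 mul1r.
  rewrite (@eq_integral_pos _ _ (fun x => - l.+1%:R * (g x * (tau x ^+ m * basis l.+1 x) * x `^ s)
    + ((2 * l%:R + lam + 1) * (g x * (tau x ^+ m * basis l x) * x `^ s)
    + - (l%:R + lam) * (if l is k.+1 then g x * (tau x ^+ m * basis k x) * x `^ s else 0)))); last first.
    move=> x _; rewrite (_ : tau x ^+ m.+1 * basis l x = tau x ^+ m * (tau x * basis l x)); last first.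
      by rewrite exprSr mulrA.
    by rewrite mul_tau_basis; move: (tau x) => t; case: (l) => [|k]; ring.
  have h3 : integrable_pos (fun x => if l is k.+1 then g x * (tau x ^+ m * basis k x) * x `^ s else 0).
    by case: (l) => [|k]; [exact: integrable0|exact: hh].
  rewrite integral_posD; [|exact: integrable_posZ|by apply: integrable_posD; apply: integrable_posZ].
  rewrite integral_posD; [|exact: integrable_posZ|exact: integrable_posZ].
  rewrite !integral_posZ// !IH !mulr0 !add0r.
  by case: (l) => [|k]; rewrite ?integral_pos0 ?IH mulr0.
have := @moments_ae0 R tau (fun x => g x * x `^ s) 2^-1 tau_gt0 tau_inc.
move=> Hm.
have {}Hm : {ae mu, forall x : R, 0 < x -> g x * x `^ s = 0}.
  apply: Hm => //.
  - by apply: measurable_funTS; exact: measurable_tau.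
  - exact: measurable_funM.
  - move=> m e e0; apply: (@eq_integrable_pos _ (fun x => g x * (tau x ^+ m * expR (- (e * tau x))) * x `^ s)).
      by move=> x _; ring.
    apply: (hgf (fun t => t ^+ m * expR (- (e * t)))); first exact: texp.
    apply: measurable_funM; first exact: measurable_funX.
    by apply: measurableT_comp => //; apply: measurableT_comp.
  - move=> m; rewrite -[RHS](H2 m 0%N); apply: eq_integral_pos => x _.
    rewrite /basis /phi -laguerreE /laguerre big_ord_recl big_ord0 addr0 !expr0 gbinom0 fact0 divr1 !mulr1 mul1r.
    by rewrite [2^-1 * _]mulrC; ring.
apply: ae_mono Hm => x h x0; have /eqP := h x0.
by rewrite mulf_eq0 [X in _ || X]gt_eqF ?powR_gt0// orbF => /eqP.
Qed.

(** * Laguerre coefficients of Schwartz functions *)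

Lemma real_schwartzD (u v : R -> R) : real_schwartz u -> real_schwartz v ->
  real_schwartz (fun t => u t + v t).
Proof.
move=> [U [-> dU bU]] [V [-> dV bV]]; exists (fun n t => U n t + V n t); split => //.
  by move=> n x; exact: (is_deriveD (dU n x) (dV n x)).
move=> m n; have [C hC] := bU m n; have [B hB] := bV m n.
by exists (C + B) => x; rewrite mulrDr (le_trans (ler_normD _ _))// lerD ?hC ?hB.
Qed.

Lemma real_schwartzZ c (u : R -> R) : real_schwartz u -> real_schwartz (fun t => c * u t).
Proof.
(* The Leibniz formula; at [n = 0] the meaningless [U n.-1] is multiplied by 0. *)
move=> [U [-> dU bU]]; exists (fun n t => c * U n t); split => //.
  by move=> n x; exact: (is_deriveZ c (dU n x)).
move=> m n; have [C hC] := bU m n; exists (`|c| * C) => x.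
by rewrite mulrCA normrM ler_wpM2l ?hC.
Qed.

Lemma real_schwartzX (u : R -> R) : real_schwartz u -> real_schwartz (fun t => t * u t).
Proof.
move=> [U [-> dU bU]]; exists (fun n t => t * U n t + n%:R * U n.-1 t); split.
- by apply/funext => t; rewrite mul0r addr0.
- move=> n x; have h1 := is_deriveM (is_derive_id x (1 : R)) (dU n x).
  have [d hd Ed] : exists2 d, is_derive x (1 : R) (U n.-1) d & n%:R * d = n%:R * U n x.
    case: n {h1} => [|n]; last by exists (U n.+1 x).
    by exists (U 1%N x) => //; rewrite !mul0r.
  apply: (is_derive_eq (is_deriveD h1 (is_deriveZ n%:R hd))).
  by rewrite /GRing.scale/= Ed -natr1; ring.
- move=> m n; have [C hC] := bU m.+1 n; have [B hB] := bU m n.-1.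
  exists (C + n%:R * B) => x; rewrite mulrDr (le_trans (ler_normD _ _))// lerD//.
    by rewrite mulrA -exprSr hC.
  by rewrite mulrCA normrM ger0_norm// ler_wpM2l ?hB.
Qed.

Lemma real_schwartz_derive (u : R -> R) : real_schwartz u ->
  exists u1, (forall t, is_derive t (1 : R) u (u1 t)) /\ real_schwartz u1.
Proof.
move=> [U [-> dU bU]]; exists (U 1%N); split; first exact: dU.
by exists (fun n => U n.+1); split.
Qed.

Lemma real_schwartz_fast_decay u : real_schwartz u -> fast_decay u.
Proof. by move=> [U [-> _ bU]] m; have [C hC] := bU m 0%N; exists C. Qed.

Lemma real_schwartz_continuous (u : R -> R) : real_schwartz u -> continuous u.
Proof. by move=> [U [-> dU _]] t; exact: is_derive_continuous (dU 0%N t). Qed.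

(** Each factor [eigen l] is moved from the basis to [u] by the symmetry of the Laguerre operator,
    which maps Schwartz functions to Schwartz functions. *)
Lemma schwartz_eigen_pow (u : R -> R) P : real_schwartz u ->
  exists2 w, real_schwartz w & forall l,
    eigen l ^+ P * integral_pos (fun x => u (tau x) * basis l x * x `^ s) =
    integral_pos (fun x => w (tau x) * basis l x * x `^ s).
Proof.
elim: P u => [|P IH] u su; first by exists u => // l; rewrite expr0 mul1r.
have [u1 [d1 s1u]] := real_schwartz_derive su.
have [u2 [d2 s2u]] := real_schwartz_derive s1u.
have [|w sw H] := IH (fun t => laguerre_op t (u t) (u1 t) (u2 t)).
  rewrite (_ : (fun t => _) = (fun t => 4^-1 * (t * u t) + ((-1) * (t * u2 t) + (- (lam + 1)) * u1 t))).
    by apply: real_schwartzD; [|apply: real_schwartzD]; apply: real_schwartzZ => //; apply: real_schwartzX.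
  by apply/funext => t; rewrite /laguerre_op; ring.
exists w => // l; rewrite -H exprSr -mulrA -(laguerre_op_basis_sym l d1 d2)//;
  try exact: real_schwartz_fast_decay; exact: real_schwartz_continuous.
Qed.

Definition coef (g : R -> R) l := integral_pos (fun x => g x * basis l x * x `^ s) / nrm l.

Lemma eigen_lower : exists2 e, 0 < e & forall l, e * l.+1%:R <= eigen l.
Proof.
have l0 : 0 < (lam + 1) / 2 by rewrite divr_gt0//; have := lam_gtN1; lra.
exists (Num.min 1 ((lam + 1) / 2)); first by rewrite lt_min ltr01.
move=> l; rewrite -[l.+1%:R]natr1 mulrDr mulr1 /eigen lerD//; last by rewrite ge_min lexx orbT.
by rewrite ler_piMl// ge_min lexx.
Qed.

Lemma basis_bound : exists (C : R) (P : nat), 0 <= C /\ forall l x, `|basis l x| <= C * l.+1%:R ^+ P.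
Proof.
have [C [P [C0 H]]] := phi_pbound lam.
by exists C, P; split => // l x; apply: H; exact: tau_ge0.
Qed.

Lemma schwartz_coef_rapid u : real_schwartz u -> rapid (coef (u \o tau)).
Proof.
move=> su P.
have [C [Q [C0 bb]]] := basis_bound.
have [c c0 nl] := nrm_lower.
have [e e0 el] := eigen_lower.
(* [P] powers are wanted, [Q] absorb the growth of the basis functions and one absorbs the division
   by [nrm l]. *)
have [w sw Hw] := @schwartz_eigen_pow u (P + Q + 1) su.
have mw : measurable_fun setT w by apply: continuous_measurable_fun; exact: real_schwartz_continuous.
have hw : integrable_pos (fun x => `|w (tau x) * x `^ s|).
  apply: integrable_norm; apply: (fast_decay_integrable_pos (real_schwartz_fast_decay sw)).
  exact: measurable_comp_tau.
pose A := integral_pos (fun x => `|w (tau x) * x `^ s|).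
have HA l : `|integral_pos (fun x => w (tau x) * basis l x * x `^ s)| <= C * l.+1%:R ^+ Q * A.
  have hwb : integrable_pos (fun x => w (tau x) * basis l x * x `^ s).
    by apply: integrable_pos_fast_decay2 => //; [exact: real_schwartz_fast_decay|exact: (fast_decay_dphi lam 0)|exact: (measurable_dphi lam 0)].
  apply: (le_trans (norm_integral_pos hwb)); rewrite /A -integral_posZ//; apply: le_integral_pos.
  - exact: integrable_norm.
  - exact: integrable_posZ.
  - move=> x _; rewrite [leLHS](_ : _ = `|basis l x| * `|w (tau x) * x `^ s|).
      by rewrite ler_wpM2r.
    by rewrite -normrM; congr `|_|; ring.
exists (C * A / (e ^+ (P + Q + 1) * c)) => l; rewrite /coef /comp.
set I := integral_pos _; have L0 : 0 < l.+1%:R :> R by [].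
have eg : 0 < e * l.+1%:R by rewrite mulr_gt0.
have n0 := nrm_gt0 l.
rewrite normrM normfV (ger0_norm (ltW n0)).
have H1 : (e * l.+1%:R) ^+ (P + Q + 1) * `|I| <= C * l.+1%:R ^+ Q * A.
  apply: le_trans (HA l); rewrite -Hw normrM ler_wpM2r// ger0_norm.
    by rewrite lerXn2r ?nnegrE ?(ltW eg)//; apply: le_trans (el l); exact: ltW.
  by rewrite exprn_ge0//; apply: le_trans (el l); exact: ltW.
rewrite ler_pdivlMr ?mulr_gt0 ?exprn_gt0//.
have -> : `|I| / nrm l * l.+1%:R ^+ P * (e ^+ (P + Q + 1) * c) =
   (`|I| * e ^+ (P + Q + 1) * l.+1%:R ^+ P) * (c / nrm l) by ring.
apply: (@le_trans _ _ ((`|I| * e ^+ (P + Q + 1) * l.+1%:R ^+ P) * l.+1%:R)).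
  rewrite ler_wpM2l ?mulr_ge0 ?exprn_ge0 ?(ltW e0)//.
  by rewrite ler_pdivrMr// mulrC.
have Lq : 0 < l.+1%:R ^+ Q :> R by rewrite exprn_gt0.
rewrite -(ler_pM2r Lq); apply: le_trans (le_trans H1 _).
  by rewrite exprMn !exprD expr1 le_eqVlt; apply/orP; left; apply/eqP; ring.
by rewrite le_eqVlt; apply/orP; left; apply/eqP; ring.
Qed.

(** Compared with [rapid_pbound_abs_sums_le], the constants are independent of the coefficients and
    the bound is linear in their seminorm [M]. *)
Lemma expand_abs_sums_le m : exists (A : R) (P : nat), 0 <= A /\ forall (c : nat -> R) (M : R),
  (forall l, `|c l| * l.+1%:R ^+ P <= M) ->
  forall t : R, 0 <= t -> abs_sums_le (fun l => t ^+ m * (c l * phi lam l t)) (A * M).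
Proof.
have [C [P [C0 H]]] := mulXn_phi_pbound lam m.
exists (2 * C), P.+2; split; first by rewrite mulr_ge0.
move=> c M hM t t0 n.
apply: (@le_trans _ _ (\sum_(k < n) (C * M) * (k.+1%:R ^+ 2)^-1)); last first.
  have M0 : 0 <= M by apply: le_trans (hM 0%N); rewrite mulr_ge0// exprn_ge0.
  rewrite -mulr_sumr (_ : 2 * C * M = C * M * 2); last by ring.
  by rewrite ler_wpM2l ?mulr_ge0// sum_inv_sq.
apply: ler_sum => k _.
have k0 : (0 : R) < k.+1%:R ^+ 2 by rewrite exprn_gt0.
rewrite -(ler_pM2r k0) -[leRHS]mulrA mulVf ?gt_eqF// mulr1.
rewrite [X in `|X|](_ : _ = c k * (t ^+ m * phi lam k t)); last by ring.
rewrite normrM.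
apply: (@le_trans _ _ (`|c k| * (C * k.+1%:R ^+ P) * k.+1%:R ^+ 2)).
  by rewrite ler_pM2r// ler_wpM2l// H.
have := hM k; rewrite -addn2 exprD => h.
rewrite [leLHS](_ : _ = C * (`|c k| * (k.+1%:R ^+ P * k.+1%:R ^+ 2))); last by ring.
by rewrite ler_wpM2l.
Qed.

Definition expand (c : nat -> R) (x : R) := series_sum (fun l => c l * basis l x).

End LaguerreBasis.

(** * Even and odd expansions on the line *)

Section WholeLine.
Variable R : realType.
Local Notation mu := (@lebesgue_measure R).
Local Notation D := (`]0%R, +oo[%classic : set R).

Lemma measurable_opp : measurable_fun [set: measurableTypeR R] (-%R : measurableTypeR R -> measurableTypeR R).
Proof. exact: (@oppr_measurable R). Qed.

(** By uniqueness it suffices to compare both measures on intervals, and reflection only exchanges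
    the open and the closed end. *)
Lemma lebesgue_measure_opp (A : set (measurableTypeR R)) : measurable A ->
  mu A = pushforward mu (-%R : measurableTypeR R -> measurableTypeR R) A.
Proof.
move=> mA.
unshelve refine (@lebesgue_measure_unique R (pushforward mu (-%R : measurableTypeR R -> measurableTypeR R)) _ A mA).
  exact: measurable_opp.
move=> X [[a b] _ <-] /=.
rewrite /pushforward (_ : _ @^-1` _ = `[-b, -a[%classic).
  by rewrite !lebesgue_measure_itv /= !lte_fin ltrN2; case: ifP => // _; rewrite -!EFinB opprK addrC.
by apply/seteqP; split => x /=; rewrite !in_itv/= => /andP[h1 h2]; apply/andP; split; lra.
Qed.

Lemma ge0_integral_opp (f : R -> \bar R) (A : set R) : measurable A ->
  measurable_fun A f -> (forall x, A x -> (0 <= f x)%E) ->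
  (\int[mu]_(x in A) f x = \int[mu]_(x in -%R @^-1` A) f (- x)%R)%E.
Proof.
move=> mA mf f0.
rewrite -[RHS](@ge0_integral_pushforward _ _ (measurableTypeR R) (measurableTypeR R) R _ measurable_opp mu A f mA mf); last first.
  by move=> x; rewrite inE; exact: f0.
apply: eq_measure_integral => B mB _; exact: lebesgue_measure_opp.
Qed.

Lemma ge0_fold (f : R -> R) : measurable_fun setT f -> (forall x, 0 <= f x) ->
  (\int[mu]_x (f x)%:E = \int[mu]_(x in D) (f x + f (- x))%:E)%E.
Proof.
move=> mf f0.
have mfo : measurable_fun setT (fun x : R => f (- x)).
  by apply: measurableT_comp => //; exact: measurable_opp.
have -> : [set: R] = D `|` `]-oo, 0].
  apply/seteqP; split => x //= _; rewrite !in_itv/= andbT.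
  by have [h|h] := ltP 0 x; [left|right].
rewrite ge0_integral_setU//=; last 3 first.
- by apply/measurable_EFinP; apply: measurable_funTS.
- by move=> x _; rewrite lee_fin.
- apply/disj_setPS => x [] /=; rewrite !in_itv/= andbT => h1 h2.
  by have := lt_le_trans h1 h2; rewrite ltxx.
under [RHS]eq_integral do rewrite EFinD.
rewrite ge0_integralD//=; last 4 first.
- by move=> x _; rewrite lee_fin.
- by apply/measurable_EFinP; apply: measurable_funTS.
- by move=> x _; rewrite lee_fin.
- by apply/measurable_EFinP; apply: measurable_funTS.
congr (_ + _)%E.
rewrite -integral_itv_bndo_bndc; last by apply/measurable_EFinP; apply: measurable_funTS.
rewrite (@ge0_integral_opp (EFin \o f))//; last 2 first.
- by apply/measurable_EFinP; apply: measurable_funTS.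
- by move=> x _; rewrite lee_fin.
rewrite (_ : -%R @^-1` `]-oo, 0[%classic = D)//.
by apply/seteqP; split => x /=; rewrite !in_itv/= andbT; lra.
Qed.

End WholeLine.

Section WeightedLine.
Variable R : realType.
Local Notation mu := (@lebesgue_measure R).
Local Notation D := (`]0%R, +oo[%classic : set R).
Implicit Types f g h : R -> R.

Lemma ae_opp (P : R -> Prop) : {ae mu, forall x, P x} -> {ae mu, forall x, P (- x)}.
Proof.
move=> [A [mA A0 sA]]; exists (-%R @^-1` A); split.
- rewrite -[X in measurable X]setTI; exact: (@measurable_opp R).
- by have := lebesgue_measure_opp mA; rewrite /pushforward => <-.
- by move=> x /= nP; exact: sA.
Qed.

Lemma ae_neq0 : {ae mu, forall x : R, x != 0}.
Proof.
exists [set 0]; split => //; first exact: lebesgue_measure_set1.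
by move=> x /= /negP; rewrite negbK => /eqP.
Qed.

Lemma ae_split (P : R -> Prop) : {ae mu, forall x : R, 0 < x -> P x} ->
  {ae mu, forall x : R, 0 < x -> P (- x)} -> {ae mu, forall x, P x}.
Proof.
move=> h1 /ae_opp h2.
apply: ae_mono (ae_and (ae_and h1 h2) ae_neq0) => x [[H1 H2] x0].
have [xp|xn|E] := ltgtP 0 x; first exact: H1.
  by have := H2; rewrite opprK; apply; rewrite oppr_gt0.
by rewrite -E eqxx in x0.
Qed.

Definition integrable_line f := mu.-integrable setT (EFin \o f).
Definition integral_line f : R := \int[mu]_x f x.

Lemma fold_integrable_line f : measurable_fun setT f -> integrable_pos (fun x => `|f x| + `|f (- x)|) -> integrable_line f.
Proof.
move=> mf hf; apply/integrableP; split; first exact/measurable_EFinP.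
rewrite (@ge0_fold R (fun x => `|f x|))//; last exact: measurableT_comp.
by apply: integrable_lty hf; exact: measurable_itv.
Qed.

Lemma integrable_line_measurable f : integrable_line f -> measurable_fun setT f.
Proof. by move=> /measurable_int/measurable_EFinP. Qed.

Lemma integrable_lineZ c f : integrable_line f -> integrable_line (fun x => c * f x).
Proof. by move=> h; have := @integrableZl _ _ _ mu setT measurableT c _ h; apply: eq_integrable. Qed.

Lemma integrable_lineD f g : integrable_line f -> integrable_line g -> integrable_line (fun x => f x + g x).
Proof. by move=> hf hg; have := @integrableD _ _ _ mu setT measurableT _ _ hf hg; apply: eq_integrable. Qed.

Lemma integrable_lineB f g : integrable_line f -> integrable_line g -> integrable_line (fun x => f x - g x).
Proof. by move=> hf hg; have := @integrableB _ _ _ mu setT measurableT _ _ hf hg; apply: eq_integrable. Qed.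

Lemma le_integrable_line f g : measurable_fun setT f -> integrable_line g -> (forall x, `|f x| <= g x) -> integrable_line f.
Proof.
move=> mf hg fg; apply: le_integrable hg => //; first exact/measurable_EFinP.
by move=> x _; rewrite /= lee_fin (le_trans (fg x))// ler_norm.
Qed.

Lemma integrable_lineN f : integrable_line f -> integrable_line (fun x => `|f x|).
Proof. exact: integrable_norm. Qed.

Lemma integral_lineZ c f : integrable_line f -> integral_line (fun x => c * f x) = c * integral_line f.
Proof. by move=> h; rewrite /integral_line RintegralZl. Qed.

Lemma integral_lineD f g : integrable_line f -> integrable_line g -> integral_line (fun x => f x + g x) = integral_line f + integral_line g.
Proof. by move=> hf hg; rewrite /integral_line RintegralD. Qed.

Lemma integral_lineB f g : integrable_line f -> integrable_line g -> integral_line (fun x => f x - g x) = integral_line f - integral_line g.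
Proof. by move=> hf hg; rewrite /integral_line RintegralB. Qed.

Lemma integral_line_ge0 f : (forall x, 0 <= f x) -> 0 <= integral_line f.
Proof. by move=> f0; apply: Rintegral_ge0. Qed.

Lemma integrable_line_integrable_pos f : integrable_line f -> integrable_pos f.
Proof. by apply: integrableS => //; exact: measurable_itv. Qed.

Lemma integrable_line_opp f : integrable_line f -> integrable_line (fun x => f (- x)).
Proof.
move=> hf; have mf := integrable_line_measurable hf.
apply/integrableP; split; first by apply/measurable_EFinP; apply: measurableT_comp.
have := @ge0_integral_opp R (fun x => `|(f x)%:E|%E) setT measurableT.
rewrite preimage_setT => <-; first by have /integrableP[] := hf.
  by apply: measurableT_comp => //; exact/measurable_EFinP.
by move=> x _; exact: abse_ge0.
Qed.

(** The nonnegative case is [ge0_fold]; in general [2 f] is the difference of the nonnegative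
    functions [|f| + f] and [|f| - f]. *)
Lemma integral_line_fold f : integrable_line f -> integral_line f = integral_pos (fun x => f x + f (- x)).
Proof.
have pos g : integrable_line g -> (forall x, 0 <= g x) -> integral_line g = integral_pos (fun x => g x + g (- x)).
  by move=> hg g0; rewrite /integral_line /Rintegral ge0_fold//; exact: integrable_line_measurable.
move=> hf; have hn := integrable_lineN hf; have hD := integrable_lineD hn hf; have hB := integrable_lineB hn hf.
have e1 : integral_line (fun x => `|f x| + f x) = integral_pos (fun x => (`|f x| + f x) + (`|f (- x)| + f (- x))).
  by apply: pos => // x; have := ler_norm (- f x); rewrite normrN; lra.
have e2 : integral_line (fun x => `|f x| - f x) = integral_pos (fun x => (`|f x| - f x) + (`|f (- x)| - f (- x))).
  by apply: pos => // x; rewrite subr_ge0 ler_norm.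
have hs g : integrable_line g -> integrable_pos (fun x => g x + g (- x)).
  by move=> hg; apply: integrable_posD; apply: integrable_line_integrable_pos => //; exact: integrable_line_opp.
have : 2 * integral_line f = 2 * integral_pos (fun x => f x + f (- x)).
  have -> : 2 * integral_line f = integral_line (fun x => `|f x| + f x) - integral_line (fun x => `|f x| - f x).
    by rewrite integral_lineD// integral_lineB//; ring.
  rewrite e1 e2 -integral_posB; [|exact: (hs _ hD)|exact: (hs _ hB)].
  by rewrite -integral_posZ; [apply: eq_integral_pos => x _; ring|exact: hs].
by move=> /(mulfI (lt0r_neq0 (ltr0Sn _ 1))).
Qed.

(** * Parity decomposition of L^2 for a weight that is a multiple of a power off 0 *)

Variables a s cw : R.
Variable w : R -> R.
Hypothesis a0 : 0 < a.
Hypothesis s1 : -1 < s.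
Hypothesis cw0 : 0 < cw.
Hypothesis wE : forall x : R, x != 0 -> w x = cw * `|x| `^ s.
Hypothesis w_ge0 : forall x, 0 <= w x.
Hypothesis mw : measurable_fun setT w.

(* [b] is the degree of the harmonic polynomial, 1 or x; on its component the
   weight becomes [x `^ parity_exp b] on the half line. *)
Definition parity_exp (b : bool) := if b then s + 2 else s.
Definition parity_mon (b : bool) (x : R) := if b then x else 1.
Definition parity_sign (b : bool) : R := if b then -1 else 1.

Lemma parity_exp_gtN1 b : -1 < parity_exp b.
Proof. by case: b; rewrite /parity_exp; have := s1; lra. Qed.

Lemma w_pos (x : R) : 0 < x -> w x = cw * x `^ s.
Proof. by move=> x0; rewrite wE ?gt_eqF// gtr0_norm. Qed.

Lemma w_neg (x : R) : 0 < x -> w (- x) = cw * x `^ s.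
Proof. by move=> x0; rewrite wE ?oppr_eq0 ?gt_eqF// normrN gtr0_norm. Qed.

Lemma pow_parity_exp b (x : R) : 0 < x -> x `^ parity_exp b = parity_mon b x ^+ 2 * x `^ s.
Proof.
move=> x0; case: b; rewrite /parity_exp/= ?expr1n ?mul1r//.
rewrite powRD; last by apply/implyP => _; rewrite gt_eqF.
by rewrite mulrC -powR_mulrn ?ltW.
Qed.

Definition Phi b l x := parity_mon b x * basis a (parity_exp b) l `|x|.

Definition real_L2 f := measurable_fun setT f /\ integrable_line (fun x => f x ^+ 2 * w x).

Lemma real_L2_mul f g : real_L2 f -> real_L2 g -> integrable_line (fun x => f x * g x * w x).
Proof.
move=> [mf hf] [mg hg]; apply: (@le_integrable_line _ (fun x => f x ^+ 2 * w x + g x ^+ 2 * w x)).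
- by apply: measurable_funM => //; apply: measurable_funM.
- exact: integrable_lineD.
- move=> x; rewrite -mulrDl normrM [X in _ * X]ger0_norm// ler_wpM2r// ler_norml.
  by move: (f x) (g x) => A B; apply/andP; split; nra.
Qed.

Lemma real_L2D f g : real_L2 f -> real_L2 g -> real_L2 (fun x => f x + g x).
Proof.
move=> hf hg; have h := real_L2_mul hf hg; move: hf hg => [mf hf] [mg hg]; split.
  exact: measurable_funD.
have := integrable_lineD (integrable_lineD hf hg) (integrable_lineZ 2 h); apply: eq_integrable => // x _ /=.
by congr EFin; ring.
Qed.

Lemma real_L2Z c f : real_L2 f -> real_L2 (fun x => c * f x).
Proof.
move=> [mf hf]; split; first exact: measurable_funM.
by have := integrable_lineZ (c ^+ 2) hf; apply: eq_integrable => // x _ /=; congr EFin; ring.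
Qed.

Lemma real_L2B f g : real_L2 f -> real_L2 g -> real_L2 (fun x => f x - g x).
Proof.
move=> hf hg; have := real_L2D hf (real_L2Z (-1) hg).
by rewrite (_ : (fun x => f x + -1 * g x) = (fun x => f x - g x))//; apply/funext => x; rewrite mulN1r.
Qed.

Lemma fold_real_L2 f : measurable_fun setT f ->
  integrable_pos (fun x => (f x ^+ 2 + f (- x) ^+ 2) * x `^ s) -> real_L2 f.
Proof.
move=> mf hf; split => //; apply: fold_integrable_line.
  by apply: measurable_funM => //; exact: measurable_funX.
apply: (@eq_integrable_pos _ (fun x => cw * ((f x ^+ 2 + f (- x) ^+ 2) * x `^ s))); last exact: integrable_posZ.
have n0 (y z : R) : `|y ^+ 2 * (cw * z `^ s)| = y ^+ 2 * (cw * z `^ s).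
  by rewrite ger0_norm//; apply: mulr_ge0; [exact: sqr_ge0|apply: mulr_ge0; [exact: ltW|exact: powR_ge0]].
by move=> x x0; rewrite w_pos// w_neg// !n0; ring.
Qed.

(** It is considered for [x > 0] only. Dividing the odd part by [x] puts it into L^2 for the
    exponent [s + 2], where the half-line theory applies again. *)
Definition parity_part b f x := (f x + parity_sign b * f (- x)) / 2 / parity_mon b x.

Lemma parity_mon_neq0 b (x : R) : 0 < x -> parity_mon b x != 0.
Proof. by move=> x0; case: b; rewrite /= ?oner_eq0// gt_eqF. Qed.

Lemma parity_part_inner f b (u : R -> R) : integrable_line (fun x => f x * (parity_mon b x * u `|x|) * w x) ->
  integral_line (fun x => f x * (parity_mon b x * u `|x|) * w x) =
  integral_pos (fun x => 2 * cw * (parity_part b f x * u x * x `^ parity_exp b)).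
Proof.
move=> h; rewrite integral_line_fold//; apply: eq_integral_pos => x x0.
rewrite w_pos// w_neg// normrN gtr0_norm// /parity_part pow_parity_exp//.
have := parity_mon_neq0 b x0; case: b {h} => /= p0; by field.
Qed.

Lemma measurable_parity_mon b (A : set R) : measurable_fun A (parity_mon b).
Proof. by case: b; [exact: measurable_id|exact: measurable_cst]. Qed.

Lemma parity_part_measurable b f : measurable_fun setT f -> measurable_fun D (parity_part b f).
Proof.
move=> mf; apply: measurable_funM.
  apply: measurable_funTS; apply: measurable_funM => //; apply: measurable_funD => //.
  by apply: measurable_funM => //; apply: measurableT_comp.
apply: continuous_at_measurable => x x0; case: b => /=.
  by apply: inv_continuous; rewrite gt_eqF.
exact: cvg_cst.
Qed.

Lemma parity_part_integrable_pos b f : real_L2 f -> integrable_pos (fun x => parity_part b f x ^+ 2 * x `^ parity_exp b).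
Proof.
move=> [mf hf]; have h := integrable_posD (integrable_line_integrable_pos hf) (integrable_line_integrable_pos (integrable_line_opp hf)).
apply: (le_integrable_pos _ (integrable_posZ cw^-1 h)).
  apply: measurable_funM; first by apply: measurable_funX; exact: parity_part_measurable.
  by apply: measurable_funTS; exact: measurable_powR.
move=> x x0; rewrite ger0_norm; last by apply: mulr_ge0; rewrite ?sqr_ge0 ?powR_ge0.
rewrite w_pos// w_neg// pow_parity_exp// /parity_part !exprMn exprVn.
have p0 := parity_mon_neq0 b x0; have c0 := lt0r_neq0 cw0.
rewrite [leLHS](_ : _ = (f x + parity_sign b * f (- x)) ^+ 2 * 2^-1 ^+ 2 * x `^ s); last by field.
rewrite [leRHS](_ : _ = (f x ^+ 2 + f (- x) ^+ 2) * x `^ s); last by field.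
rewrite ler_wpM2r ?powR_ge0//; move: (f x) (f (- x)) => A B.
by case: b {p0} => /=; nra.
Qed.

Lemma measurable_comp_tau_abs (u : R -> R) : measurable_fun setT u ->
  measurable_fun setT (fun x : R => u (tau a `|x|)).
Proof.
move=> mu0; apply: (measurableT_comp mu0).
exact: (measurableT_comp (measurable_tau a) (@normr_measurable R setT)).
Qed.

Lemma real_L2_fast_decay b (u : R -> R) : fast_decay u -> measurable_fun setT u ->
  real_L2 (fun x => parity_mon b x * u (tau a `|x|)).
Proof.
move=> du mu0; apply: fold_real_L2.
  by apply: measurable_funM; [exact: measurable_parity_mon|exact: measurable_comp_tau_abs].
have h := integrable_pos_fast_decay2 a0 (parity_exp_gtN1 b) du du mu0 mu0.
apply: eq_integrable_pos (integrable_posZ 2 h) => x x0.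
rewrite normrN gtr0_norm// pow_parity_exp//; move: (tau a x) => t.
by case: b {h} => /=; ring.
Qed.

Lemma Phi_real_L2 b l : real_L2 (Phi b l).
Proof. exact: (real_L2_fast_decay b (fast_decay_dphi _ 0 l) (measurable_dphi _ 0 l)). Qed.

Lemma parity_part_basis_integrable_pos b l f : real_L2 f ->
  integrable_pos (fun x => parity_part b f x * basis a (parity_exp b) l x * x `^ parity_exp b).
Proof.
move=> hf; have [mf _] := hf.
have h1 := parity_part_integrable_pos b hf; have h2 := integrable_pos_basis2 a0 (parity_exp_gtN1 b) l l.
apply: (le_integrable_pos _ (integrable_posD h1 h2)).
  apply: measurable_funM; last by apply: measurable_funTS; exact: measurable_powR.
  apply: measurable_funM; first exact: parity_part_measurable.
  by apply: measurable_comp_tau; exact: (measurable_dphi _ 0).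
move=> x x0; rewrite -mulrDl normrM [X in _ * X]ger0_norm ?powR_ge0//.
rewrite ler_wpM2r ?powR_ge0// ler_norml; move: (parity_part b f x) (basis _ _ _ _) => A B.
by apply/andP; split; nra.
Qed.

(** The denominator is the squared norm of [Phi b l] on the line, the 2 counting both half lines. *)
Definition rcoef b l f := integral_line (fun x => f x * Phi b l x * w x) / (2 * cw * nrm a (parity_exp b) l).

Lemma integral_line_Phi b l f : real_L2 f ->
  integral_line (fun x => f x * Phi b l x * w x) =
  2 * cw * integral_pos (fun x => parity_part b f x * basis a (parity_exp b) l x * x `^ parity_exp b).
Proof.
move=> hf; have h := real_L2_mul hf (Phi_real_L2 b l).
by rewrite -integral_posZ; [exact: parity_part_inner|exact: parity_part_basis_integrable_pos].
Qed.

Lemma nrm_pos b l : 0 < nrm a (parity_exp b) l.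
Proof. exact: (nrm_gt0 a0 (parity_exp_gtN1 b)). Qed.

Lemma rcoefE b l f : real_L2 f -> rcoef b l f = coef a (parity_exp b) (parity_part b f) l.
Proof.
move=> hf; rewrite /rcoef integral_line_Phi// /coef; have := lt0r_neq0 (nrm_pos b l).
by have := lt0r_neq0 cw0; move: (nrm _ _ _) cw => A B hA hB; field; rewrite hA hB.
Qed.

Lemma parity_part_id f x : 0 < x -> f x = parity_part false f x + x * parity_part true f x.
Proof. by move=> x0; rewrite /parity_part/=; field; rewrite gt_eqF. Qed.

Lemma parity_part_opp f x : 0 < x -> f (- x) = parity_part false f x - x * parity_part true f x.
Proof. by move=> x0; rewrite /parity_part/=; field; rewrite gt_eqF. Qed.

Lemma real_L2_complete f : real_L2 f -> (forall b l, rcoef b l f = 0) ->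
  {ae mu, forall x, f x = 0}.
Proof.
move=> hf H; have [mf _] := hf.
have ae b : {ae mu, forall x : R, 0 < x -> parity_part b f x = 0}.
  apply: (basis_complete a0 (parity_exp_gtN1 b)); first exact: parity_part_measurable.
    exact: parity_part_integrable_pos.
  move=> l; have := H b l; rewrite rcoefE// /coef => /eqP.
  by rewrite mulf_eq0 invr_eq0 [X in _ || X]gt_eqF ?nrm_pos// orbF => /eqP.
have h := ae_and (ae false) (ae true).
apply: ae_split; apply: ae_mono h => x [h1 h2] x0.
  by rewrite parity_part_id// h1// h2// mulr0 addr0.
by rewrite parity_part_opp// h1// h2// mulr0 subr0.
Qed.

Definition rexp (c : bool -> nat -> R) x :=
  expand a (parity_exp false) (c false) `|x| + x * expand a (parity_exp true) (c true) `|x|.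

Lemma expandE b c x : expand a (parity_exp b) c x = series_sum (fun l => c l * phi (lam a (parity_exp b)) l (tau a x)).
Proof. by []. Qed.

(** The triple is fixed before the coefficients. Uniform bounds on the sum and on [tau^N] times the
    sum feed [decay_dominated]; squaring makes the result quadratic in [M]. *)
Lemma expand_dominated b : exists (A : R) (P : nat) (G : R -> R), [/\ 0 <= A, integrable_pos G & 
  forall (c : nat -> R) (M : R), (forall l, `|c l| * l.+1%:R ^+ P <= M) ->
  (forall x, abs_sums_le (fun l => c l * basis a (parity_exp b) l x) (A * M)) /\
  forall x : R, 0 < x -> expand a (parity_exp b) c x ^+ 2 * x `^ parity_exp b <= A * M ^+ 2 * G x].
Proof.
have [N [G [hG dom]]] := decay_dominated a0 (parity_exp_gtN1 b).
have [A0 [P0 [A0p H0]]] := expand_abs_sums_le a (parity_exp b) 0.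
have [A1 [P1 [A1p H1]]] := expand_abs_sums_le a (parity_exp b) N.
pose A := A0 + A1; have Ap : 0 <= A by rewrite addr_ge0.
have A0A : A0 <= A by rewrite lerDl.
have A1A : A1 <= A by rewrite lerDr.
pose K := 1 + (a / 2) ^+ N; have ca : 0 <= (a / 2) ^+ N by rewrite exprn_ge0// divr_ge0// ltW.
have K0 : 0 <= K by rewrite addr_ge0.
exists (A + K * A ^+ 2), (maxn P0 P1), G; split => //.
  by rewrite addr_ge0// mulr_ge0// sqr_ge0.
move=> c M hM.
have M0 : 0 <= M by apply: le_trans (hM 0%N); rewrite mulr_ge0// exprn_ge0.
have hP (P : nat) : (P <= maxn P0 P1)%N -> forall l, `|c l| * l.+1%:R ^+ P <= M.
  move=> PP l; apply: le_trans (hM l); rewrite ler_wpM2l//.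
  by apply: ler_weXn2l => //; rewrite ler1n.
have u0 x := H0 c M (hP _ (leq_maxl _ _)) _ (tau_ge0 a0 x).
have u1 x := H1 c M (hP _ (leq_maxr _ _)) _ (tau_ge0 a0 x).
have E x : expand a (parity_exp b) c x = series_sum (fun l => tau a x ^+ 0 * (c l * phi (lam a (parity_exp b)) l (tau a x))).
  by rewrite expandE; apply: eq_series_sum => l; rewrite expr0 mul1r.
have b0 x : `|expand a (parity_exp b) c x| <= A * M.
  by rewrite E (le_trans (abs_sums_le_series_sum (u0 x)))// ler_wpM2r.
have b1 x : tau a x ^+ N * `|expand a (parity_exp b) c x| <= A * M.
  have -> : tau a x ^+ N * `|expand a (parity_exp b) c x| = `|tau a x ^+ N * expand a (parity_exp b) c x|.
    by rewrite normrM [X in _ = X * _]ger0_norm// exprn_ge0// tau_ge0.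
  rewrite expandE -series_sumZ; first by rewrite (le_trans (abs_sums_le_series_sum (u1 x)))// ler_wpM2r.
  have := abs_sums_le_cvg (u0 x); under eq_fun do rewrite expr0 mul1r.
  exact.
split.
  move=> x n; have := u0 x n; under eq_bigr do rewrite expr0 mul1r.
  move=> h; apply: (le_trans h); rewrite ler_wpM2r// (le_trans A0A)// lerDl.
  by rewrite mulr_ge0// sqr_ge0.
move=> x x0.
have AM0 : 0 <= A * M by rewrite mulr_ge0.
have e2 y : expand a (parity_exp b) c y ^+ 2 <= (A * M) ^+ 2.
  by rewrite -[leLHS](real_normK (num_real _)) lerXn2r ?nnegrE.
(* [G] is known only through [dom]; testing it on [min(1, (y^a)^-N) * y^p], with [p] the parity
   exponent, shows that it is nonnegative. *)
have G0 : 0 <= G x.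
  have h y : 0 < y -> `|y `^ parity_exp b * 0| <= 0 * y `^ parity_exp b by move=> _; rewrite mulr0 normr0 mul0r.
  have Z := @dom (fun y => Num.min 1 (((y `^ a) ^+ N)^-1) * y `^ parity_exp b) 1 _ _ x x0.
  have {}Z : `|Num.min 1 (((x `^ a) ^+ N)^-1) * x `^ parity_exp b| <= 1 * G x.
    apply: Z => y y0.
      rewrite ger0_norm ?mulr_ge0 ?powR_ge0// ?le_min ?ler01 ?invr_ge0 ?exprn_ge0 ?powR_ge0//.
      by rewrite ler_wpM2r ?powR_ge0// ge_min lexx.
    have yN : 0 < (y `^ a) ^+ N by rewrite exprn_gt0// powR_gt0.
    rewrite ger0_norm ?mulr_ge0 ?powR_ge0// ?le_min ?ler01 ?invr_ge0 ?exprn_ge0 ?powR_ge0//.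
    rewrite mulrAC ler_wpM2r ?powR_ge0// -ler_pdivlMr// mul1r ge_min lexx orbT//.
  by rewrite -[G x]mul1r (le_trans _ Z).
have := @dom (fun y => expand a (parity_exp b) c y ^+ 2 * y `^ parity_exp b) (K * (A * M) ^+ 2) _ _ x x0.
have n2 (y z : R) : `|y ^+ 2 * z `^ parity_exp b| = y ^+ 2 * z `^ parity_exp b.
  by rewrite ger0_norm//; apply: mulr_ge0; [exact: sqr_ge0|exact: powR_ge0].
rewrite n2 => H; apply: (le_trans (H _ _)).
- move=> y y0; rewrite n2.
  rewrite ler_wpM2r ?powR_ge0// (le_trans (e2 y))// ler_peMl ?sqr_ge0// /K lerDl//.
- move=> y y0; rewrite n2.
  rewrite mulrAC ler_wpM2r ?powR_ge0// (powa_tau a0 y) exprMn mulrCA.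
  apply: (@le_trans _ _ ((a / 2) ^+ N * (A * M) ^+ 2)); last by rewrite ler_wpM2r ?sqr_ge0// /K lerDr.
  rewrite ler_wpM2l// mulrC -[X in _ * X <= _](real_normK (num_real _)) !expr2 [leLHS]mulrA.
  by apply: ler_pM => //; rewrite mulr_ge0// exprn_ge0// tau_ge0.
- rewrite ler_wpM2r//; rewrite (_ : (A + K * A ^+ 2) * M ^+ 2 = A * M ^+ 2 + K * (A * M) ^+ 2); last by ring.
  by rewrite lerDr mulr_ge0// sqr_ge0.
Qed.

Definition coef_le (P : nat) (M : R) (c : bool -> nat -> R) :=
  forall b l, `|c b l| * l.+1%:R ^+ P <= M.
Definition rapid2 (c : bool -> nat -> R) := forall b, rapid (c b).

Lemma rapid2_coef_le c P : rapid2 c -> exists M, coef_le P M c.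
Proof.
move=> h; have [M0 h0] := h false P; have [M1 h1] := h true P.
by exists (Num.max M0 M1) => -[] l; rewrite le_max ?h0 ?h1 ?orbT.
Qed.

Lemma coef_le_le P Q M c : (P <= Q)%N -> coef_le Q M c -> coef_le P M c.
Proof.
move=> PQ h b l; apply: le_trans (h b l); rewrite ler_wpM2l//.
by apply: ler_weXn2l => //; rewrite ler1n.
Qed.

Lemma coef_le_ge0 P M c : coef_le P M c -> 0 <= M.
Proof. by move=> h; apply: le_trans (h false 0%N); rewrite mulr_ge0// exprn_ge0. Qed.

Lemma measurable_basis b l (A : set R) : measurable_fun A (basis a (parity_exp b) l).
Proof. by apply: measurable_comp_tau; exact: (measurable_dphi _ 0). Qed.

(** This is the continuity of the expansion from one coefficient seminorm to the L^2 norm. On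
    folding to the half line the cross terms of the even and odd parts cancel. *)
Lemma rexp_normal : exists (A : R) (P : nat), 0 <= A /\ forall c M, coef_le P M c ->
  [/\ forall b x, abs_sums_le (fun l => c b l * basis a (parity_exp b) l x) (A * M),
      real_L2 (rexp c) & integral_line (fun x => rexp c x ^+ 2 * w x) <= A * M ^+ 2].
Proof.
have [A0 [P0 [G0 [A00 hG0 H0]]]] := expand_dominated false.
have [A1 [P1 [G1 [A10 hG1 H1]]]] := expand_dominated true.
pose G x := A0 * G0 x + A1 * G1 x.
have hG : integrable_pos G by apply: integrable_posD; exact: integrable_posZ.
pose B := 2 * cw * `|integral_pos G|; have B0 : 0 <= B by rewrite !mulr_ge0// ltW.
exists (A0 + A1 + B), (maxn P0 P1); split; first by rewrite !addr_ge0.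
move=> c M hc; have M0 := coef_le_ge0 hc.
have [u0 e0] := H0 (c false) M (coef_le_le (leq_maxl P0 P1) hc false).
have [u1 e1] := H1 (c true) M (coef_le_le (leq_maxr P0 P1) hc true).
have u b x : abs_sums_le (fun l => c b l * basis a (parity_exp b) l x) ((A0 + A1 + B) * M).
  have le_ubs (f : nat -> R) (K L : R) : K <= L -> abs_sums_le f K -> abs_sums_le f L.
    by move=> KL h n; exact: le_trans (h n) KL.
  by case: b; [apply: le_ubs (u1 x)|apply: le_ubs (u0 x)]; rewrite ler_wpM2r//; lra.
have me b : measurable_fun setT (expand a (parity_exp b) (c b)).
  apply: (@measurable_fun_cvg _ _ _ setT (fun n x => series (fun l => c b l * basis a (parity_exp b) l x) n)).
    move=> n; rewrite (_ : (fun x => _) = (fun x => \sum_(l < n) c b l * basis a (parity_exp b) l x)).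
      by apply: measurable_sum => l; apply: measurable_funM => //; exact: measurable_basis.
    by apply/funext => x; rewrite /series/= big_mkord.
  by move=> x _; exact: (abs_sums_le_cvg (u b x)).
have mr : measurable_fun setT (rexp c).
  have mn := @normr_measurable R setT.
  apply: measurable_funD; first exact: (measurableT_comp (me false) mn).
  by apply: measurable_funM => //; exact: (measurableT_comp (me true) mn).
have E (x : R) : 0 < x -> (rexp c x ^+ 2 + rexp c (- x) ^+ 2) * x `^ s =
    2 * (expand a (parity_exp false) (c false) x ^+ 2 * x `^ parity_exp false) +
    2 * (expand a (parity_exp true) (c true) x ^+ 2 * x `^ parity_exp true).
  move=> x0; rewrite /rexp normrN gtr0_norm// !pow_parity_exp//=.
  by move: (expand _ _ _ _) (expand _ _ _ _) => y z; ring.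
have dom (x : R) : 0 < x -> (rexp c x ^+ 2 + rexp c (- x) ^+ 2) * x `^ s <= 2 * M ^+ 2 * G x.
  move=> x0; rewrite E//; have := e0 x x0; have := e1 x x0; rewrite /G => h1 h2.
  rewrite (_ : 2 * M ^+ 2 * _ = 2 * (A0 * M ^+ 2 * G0 x) + 2 * (A1 * M ^+ 2 * G1 x)); last by ring.
  by rewrite lerD// ler_wpM2l.
have nn (x : R) : 0 <= (rexp c x ^+ 2 + rexp c (- x) ^+ 2) * x `^ s.
  by apply: mulr_ge0; [apply: addr_ge0; exact: sqr_ge0|exact: powR_ge0].
have hh : integrable_pos (fun x => (rexp c x ^+ 2 + rexp c (- x) ^+ 2) * x `^ s).
  apply: (le_integrable_pos _ (integrable_posZ (2 * M ^+ 2) hG)); last by move=> x x0; rewrite ger0_norm// dom.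
  apply: measurable_funTS; apply: measurable_funM; last exact: measurable_powR.
  have mo : measurable_fun setT (fun x : R => rexp c (- x)) := measurableT_comp mr (@measurable_opp R).
  exact: (measurable_funD (measurable_funX 2 mr) (measurable_funX 2 mo)).
have hr := fold_real_L2 mr hh; split => //.
rewrite integral_line_fold; last by case: hr.
have E2 (x : R) : 0 < x -> rexp c x ^+ 2 * w x + rexp c (- x) ^+ 2 * w (- x) =
    cw * ((rexp c x ^+ 2 + rexp c (- x) ^+ 2) * x `^ s).
  by move=> x0; rewrite w_pos// w_neg//; move: (rexp c x) (rexp c (- x)) (x `^ s) => y z t; ring.
apply: (@le_trans _ _ (integral_pos (fun x => cw * (2 * M ^+ 2 * G x)))).
  apply: le_integral_pos.
  - by apply: (eq_integrable_pos _ (integrable_posZ cw hh)) => x x0; rewrite E2.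
  - by apply: integrable_posZ; exact: integrable_posZ.
  - by move=> x x0; rewrite E2// ler_wpM2l ?dom// ltW.
rewrite !integral_posZ//; last exact: integrable_posZ.
rewrite (_ : cw * (2 * M ^+ 2 * integral_pos G) = 2 * cw * integral_pos G * M ^+ 2); last by move: (integral_pos G) => y; ring.
rewrite ler_wpM2r ?sqr_ge0//; apply: (@le_trans _ _ B); last by rewrite lerDr addr_ge0.
by rewrite /B ler_wpM2l ?ler_norm// mulr_ge0// ltW.
Qed.

Lemma rexp_real_L2 c : rapid2 c -> real_L2 (rexp c).
Proof.
move=> rc; have [A [P [_ H]]] := rexp_normal.
by have [M hM] := rapid2_coef_le P rc; have [] := H c M hM.
Qed.

Lemma rexp_cvg c b x : rapid2 c -> cvgn (series (fun l => c b l * basis a (parity_exp b) l x)).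
Proof.
move=> rc; have [A [P [_ H]]] := rexp_normal.
by have [M hM] := rapid2_coef_le P rc; have [h _ _] := H c M hM; exact: abs_sums_le_cvg (h b x).
Qed.

Lemma rexp_lin r c d : rapid2 c -> rapid2 d ->
  rexp (fun b l => r * c b l + d b l) = (fun x => r * rexp c x + rexp d x).
Proof.
move=> rc hd; apply/funext => x; rewrite /rexp /expand.
have E b : series_sum (fun l => (r * c b l + d b l) * basis a (parity_exp b) l `|x|) =
    r * series_sum (fun l => c b l * basis a (parity_exp b) l `|x|) + series_sum (fun l => d b l * basis a (parity_exp b) l `|x|).
  rewrite -series_sumZ; last exact: rexp_cvg.
  rewrite -series_sumD; [|exact/is_cvg_seriesZ/rexp_cvg|exact: rexp_cvg].
  by apply: eq_series_sum => l; rewrite mulrDl mulrA.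
by rewrite !E; move: (series_sum _) (series_sum _) (series_sum _) (series_sum _) => p q y z; ring.
Qed.

Lemma parity_part_rexp b c x : 0 < x -> parity_part b (rexp c) x = expand a (parity_exp b) (c b) x.
Proof.
move=> x0; rewrite /parity_part /rexp normrN gtr0_norm//.
have := parity_mon_neq0 b x0; case: b => /= p0; move: (expand _ _ _ _) (expand _ _ _ _) => y z; by field.
Qed.

(** By dominated convergence the pairing with a basis function is the limit of the pairings of
    partial sums, which by orthogonality are constant from the index [l.+1] on. *)
Lemma rcoef_rexp c b l : rapid2 c -> rcoef b l (rexp c) = c b l.
Proof.
move=> rc; rewrite rcoefE; last exact: rexp_real_L2.
have [A [P [_ H]]] := rexp_normal; have [M hM] := rapid2_coef_le P rc; have [u _ _] := H c M hM.
rewrite /coef; apply: canLR (mulfK (lt0r_neq0 (nrm_pos b l))) _.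
pose fn n x := (\sum_(k < n) c b k * basis a (parity_exp b) k x) * basis a (parity_exp b) l x * x `^ parity_exp b.
pose g x := A * M * `|basis a (parity_exp b) l x * x `^ parity_exp b|.
have hb : integrable_pos (fun x => basis a (parity_exp b) l x * x `^ parity_exp b).
  apply: (fast_decay_integrable_pos a0 (parity_exp_gtN1 b) (fast_decay_dphi (lam a (parity_exp b)) 0 l)).
  by apply: measurable_comp_tau; exact: (measurable_dphi _ 0).
have cv : integral_pos (fn n) @[n --> \oo] --> integral_pos (fun x => parity_part b (rexp c) x * basis a (parity_exp b) l x * x `^ parity_exp b).
  apply: (@integral_pos_dominated _ fn _ g).
  - move=> n; apply: measurable_funM; last by apply: measurable_funTS; exact: measurable_powR.
    apply: measurable_funM; last exact: measurable_basis.
    by apply: measurable_sum => k; apply: measurable_funM => //; exact: measurable_basis.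
  - move=> x x0; rewrite parity_part_rexp//; apply: cvgMl; apply: cvgMl.
    rewrite (_ : (fun n => _) = series (fun k => c b k * basis a (parity_exp b) k x)); first exact: abs_sums_le_cvg (u b x).
    by apply/funext => n; rewrite /series/= big_mkord.
  - by apply: integrable_posZ; exact: integrable_norm.
  - move=> n x x0; rewrite /fn /g -mulrA normrM ler_wpM2r//.
    by rewrite (le_trans (ler_norm_sum _ _ _))//; exact: u.
rewrite -(cvg_lim _ cv)//; apply/cvg_lim => //; apply: cvg_near_cst; exists l.+1 => //= n /= ln; apply/eqP.
rewrite /fn (@eq_integral_pos _ _ (fun x => \sum_(k < n) c b k * (basis a (parity_exp b) k x * basis a (parity_exp b) l x * x `^ parity_exp b))); last first.
  by move=> x x0; rewrite !mulr_suml; apply: eq_bigr => k _; rewrite !mulrA.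
have h2 k := integrable_pos_basis2 a0 (parity_exp_gtN1 b) k l.
rewrite integral_pos_sum; last by move=> k; exact: integrable_posZ.
rewrite (bigD1 (Ordinal ln))//= integral_posZ// big1 ?addr0.
  by apply/eqP; congr (_ * _); apply: eq_integral_pos => x _; rewrite expr2.
move=> k kl; by rewrite integral_posZ// (basis_ortho a0 (parity_exp_gtN1 b)) ?mulr0.
Qed.

Lemma rcoefB b l f g : real_L2 f -> real_L2 g -> rcoef b l (fun x => f x - g x) = rcoef b l f - rcoef b l g.
Proof.
move=> hf hg; rewrite /rcoef -mulrBl -integral_lineB; [|exact: real_L2_mul (Phi_real_L2 b l)..].
by congr (integral_line _ / _); apply/funext => x; rewrite -!mulrBl.
Qed.

Lemma rexp_complete g : real_L2 g -> rapid2 (fun b l => rcoef b l g) ->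
  {ae mu, forall x, g x = rexp (fun b l => rcoef b l g) x}.
Proof.
move=> hg rc; have hr := rexp_real_L2 rc.
apply: ae_mono (real_L2_complete (real_L2B hg hr) _) => [x /eqP|b l]; first by rewrite subr_eq0 => /eqP.
by rewrite rcoefB// rcoef_rexp// subrr.
Qed.

Lemma schwartz_real_L2 (u v : R -> R) : real_schwartz u -> real_schwartz v ->
  real_L2 (fun x => u (tau a `|x|) + x * v (tau a `|x|)).
Proof.
move=> su sv.
have h b (f : R -> R) : real_schwartz f -> real_L2 (fun x => parity_mon b x * f (tau a `|x|)).
  move=> sf; apply: real_L2_fast_decay; first exact: real_schwartz_fast_decay.
  by apply: continuous_measurable_fun; exact: real_schwartz_continuous.
have := real_L2D (h false u su) (h true v sv).
by rewrite (_ : (fun x => _ + _) = (fun x => u (tau a `|x|) + x * v (tau a `|x|)))//; apply/funext => x; rewrite /= mul1r.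
Qed.

Lemma schwartz_rcoef (u v : R -> R) : real_schwartz u -> real_schwartz v ->
  rapid2 (fun b l => rcoef b l (fun x => u (tau a `|x|) + x * v (tau a `|x|))).
Proof.
move=> su sv b; pose f x := u (tau a `|x|) + x * v (tau a `|x|).
have E l : rcoef b l f = coef a (parity_exp b) ((if b then v else u) \o tau a) l.
  rewrite rcoefE; last exact: schwartz_real_L2.
  congr (_ / _); apply: eq_integral_pos => x x0; congr (_ * _ * _).
  rewrite /parity_part /f normrN gtr0_norm//.
  by case: b => /=; move: (u _) (v _) => y z; field; rewrite ?gt_eqF.
rewrite (_ : (fun l => _) = coef a (parity_exp b) ((if b then v else u) \o tau a)); last by apply/funext.
by apply: schwartz_coef_rapid => //; [exact: parity_exp_gtN1|case: b {E}].
Qed.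

(** * The operators [h], [e^+] and [e^-] in the Laguerre basis *)

Arguments dphi : simpl never.
Arguments phi : simpl never.
Variable kap : R.
Hypothesis sE : s = a - 2 + 2 * kap.

Definition lm b := lam a (parity_exp b).
(* Coefficients of [(al * (2 nu) + be * raise + ga * lower)] applied to the sum
   with coefficients [c], as in the three-term relations of the Laguerre
   functions; [c b l.-1] is multiplied by 0 when [l = 0]. *)
Definition three_term (al be ga : R) (c : bool -> nat -> R) b l :=
  al * ((2 * l%:R + lm b + 1) * c b l) + be * (l%:R * c b l.-1) + ga * ((l.+1%:R + lm b) * c b l.+1).

Lemma three_term_coef_le P al be ga : exists K, 0 <= K /\ forall c M, coef_le P.+1 M c -> coef_le P (K * M) (three_term al be ga c).
Proof.
pose L := `|lm false| + `|lm true|.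
have lmL b : `|lm b| <= L by case: b; rewrite ?lerDl ?lerDr.
have L0 : 0 <= L by rewrite addr_ge0.
exists (`|al| * (3 + L) + `|be| * 2 ^+ P + `|ga| * (1 + L)); split.
  by rewrite !addr_ge0// mulr_ge0// ?exprn_ge0// addr_ge0.
move=> c M hc b l; have M0 := coef_le_ge0 hc; have lP0 k : 0 <= k.+1%:R ^+ P :> R by rewrite exprn_ge0.
have n1 : 1 <= l.+1%:R :> R by rewrite ler1n.
have N' (p q : R) (B : R) : `|p| <= B * l.+1%:R -> 0 <= B -> `|q| * l.+1%:R ^+ P.+1 <= M ->
    `|p * q| * l.+1%:R ^+ P <= B * M.
  move=> pB B0 qM; rewrite normrM -mulrA.
  apply: le_trans (ler_wpM2r _ pB) _; first by rewrite mulr_ge0.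
  by rewrite -mulrA ler_wpM2l// mulrCA -exprS.
have h1 : `|(2 * l%:R + lm b + 1) * c b l| * l.+1%:R ^+ P <= (3 + L) * M.
  apply: N' (hc b l); last by rewrite addr_ge0.
  have := lmL b; rewrite !ler_norml -natr1 in n1 *; have l0 : 0 <= l%:R :> R by [].
  by move=> /andP[? ?]; apply/andP; split; nra.
(* The weight at [l] exceeds the one at [l - 1], but [l + 1 <= 2 l] for [l >= 1], which costs
   [2 ^ P]. *)
have h2 : `|l%:R * c b l.-1| * l.+1%:R ^+ P <= 2 ^+ P * M.
  case: l {n1 N' h1} => [|k]; first by rewrite mul0r normr0 mul0r mulr_ge0// exprn_ge0.
  rewrite normrM ger0_norm//= mulrAC.
  apply: (@le_trans _ _ (2 ^+ P * (`|c b k| * k.+1%:R ^+ P.+1))); last by rewrite ler_wpM2l ?exprn_ge0.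
  rewrite [leRHS](_ : _ = k.+1%:R * (2 * k.+1%:R) ^+ P * `|c b k|); last by rewrite exprS exprMn; ring.
  rewrite ler_wpM2r// ler_wpM2l//.
  have natrS2 : k.+2%:R = k%:R + 2 :> R by rewrite -addn2 natrD.
  have natrS1 : k.+1%:R = k%:R + 1 :> R by rewrite -addn1 natrD.
  by rewrite lerXn2r ?nnegrE ?mulr_ge0// natrS2 natrS1; have : 0 <= k%:R :> R by []; lra.
have h3 : `|(l.+1%:R + lm b) * c b l.+1| * l.+1%:R ^+ P <= (1 + L) * M.
  apply: N'; [|by rewrite addr_ge0|].
    have := lmL b; rewrite !ler_norml => /andP[? ?]; apply/andP; split; nra.
  apply: le_trans (hc b l.+1); rewrite ler_wpM2l//.
  by rewrite lerXn2r ?nnegrE// ler_nat.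
move: h1 h2 h3; rewrite /three_term; set y1 := (2 * l%:R + lm b + 1) * c b l.
set y2 := l%:R * c b l.-1; set y3 := (l.+1%:R + lm b) * c b l.+1.
move: y1 y2 y3 (l.+1%:R ^+ P) (lP0 l) => y1 y2 y3 q q0 h1 h2 h3.
apply: (@le_trans _ _ ((`|al| * `|y1| + `|be| * `|y2| + `|ga| * `|y3|) * q)).
  rewrite ler_wpM2r// -!normrM; apply: le_trans (ler_normD _ _) _.
  by rewrite lerD2r; exact: ler_normD.
rewrite [leLHS](_ : _ = `|al| * (`|y1| * q) + `|be| * (`|y2| * q) + `|ga| * (`|y3| * q)); last by ring.
rewrite [leRHS](_ : _ = `|al| * ((3 + L) * M) + `|be| * (2 ^+ P * M) + `|ga| * ((1 + L) * M)).
  by apply: lerD; [apply: lerD|]; apply: ler_wpM2l.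
by rewrite [LHS]mulrDl [X in X + _ = _]mulrDl !mulrA.
Qed.

Lemma coef_le_rapid2 c : (forall P, exists M, coef_le P M c) -> rapid2 c.
Proof. by move=> h b P; have [M hM] := h P; exists M. Qed.

Lemma three_term_rapid2 al be ga c : rapid2 c -> rapid2 (three_term al be ga c).
Proof.
move=> rc; apply: coef_le_rapid2 => P; have [K [_ H]] := three_term_coef_le P al be ga.
by have [M hM] := rapid2_coef_le P.+1 rc; exists (K * M); exact: H.
Qed.

Definition finite_coefs n (c : bool -> nat -> R) := forall b l, (n <= l)%N -> c b l = 0.

Lemma finite_coefs_rapid2 n c : finite_coefs n c -> rapid2 c.
Proof.
move=> fc b P; exists (\sum_(k < n) `|c b k| * k.+1%:R ^+ P) => l.
have nn (k : 'I_n) : 0 <= `|c b k| * k.+1%:R ^+ P by rewrite mulr_ge0// exprn_ge0.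
have [nl|ln] := leqP n l; first by rewrite fc// normr0 mul0r sumr_ge0.
by rewrite (bigD1 (Ordinal ln))//= lerDl sumr_ge0.
Qed.

Lemma three_term_finite_coefs n al be ga c : finite_coefs n c -> finite_coefs n.+1 (three_term al be ga c).
Proof.
move=> fc b l nl; rewrite /three_term !fc ?mulr0 ?addr0//.
- exact: leqW (ltnW nl).
- by case: l nl.
- exact: ltnW.
Qed.

Definition Usum (n : nat) (c : bool -> nat -> R) b m t := \sum_(l < n) c b l * dphi (lm b) m l t.

Lemma rexp_finite_coefs n c x : finite_coefs n c ->
  rexp c x = Usum n c false 0 (tau a `|x|) + x * Usum n c true 0 (tau a `|x|).
Proof.
move=> fc; rewrite /rexp /expand.
by congr (_ + _ * _); apply: series_sum_eventually0 => l nl; rewrite fc// mul0r.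
Qed.

Lemma Usum0 n c b t : Usum n c b 0 t = \sum_(l < n) c b l * phi (lm b) l t.
Proof. by []. Qed.

(** Shifting the summation index moves the operator from the coefficients to the functions, with
    raising and lowering transposed. Raising is the reason for [n.+1]. *)
Lemma Usum_three_term n al be ga c b t : finite_coefs n c -> Usum n.+1 (three_term al be ga c) b 0 t =
  \sum_(l < n) c b l * (al * ((2 * l%:R + lm b + 1) * phi (lm b) l t) +
     be * (l.+1%:R * phi (lm b) l.+1 t) + ga * ((l%:R + lm b) * phim1 (lm b) l t)).
Proof.
move=> fc; rewrite Usum0 /three_term.
under eq_bigr do rewrite mulrDl mulrDl.
rewrite !big_split/=.
under [RHS]eq_bigr do rewrite !mulrDr.
rewrite !big_split/=; congr (_ + _ + _).
- rewrite big_ord_recr/= fc// !(mulr0, mul0r) addr0; apply: eq_bigr => l _; ring.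
- rewrite big_ord_recl/= !(mulr0, mul0r) add0r; apply: eq_bigr => l _.
  by rewrite /bump/= add1n add0n; ring.
- rewrite -[RHS]addr0; rewrite big_ord_recr/= [X in _ + ga * X * _](_ : _ = 0); last by rewrite fc ?mulr0// ltnW.
  rewrite mulr0 mul0r; congr (_ + _).
  case: n fc => [|n] fc; first by rewrite !big_ord0.
  rewrite big_ord_recr/= fc// !(mulr0, mul0r) addr0.
  rewrite [RHS]big_ord_recl/= !(mulr0, mul0r) add0r; apply: eq_bigr => l _.
  by rewrite /bump/= add1n add0n/=; ring.
Qed.

Lemma is_derive_Usum n c b m (t : R) : is_derive t (1 : R) (Usum n c b m) (Usum n c b m.+1 t).
Proof.
have -> : Usum n c b m = \sum_(l < n) (c b l \*: dphi (lm b) m l).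
  by apply/funext => y; rewrite fct_sumE.
have H := @is_derive_sum _ _ _ n _ t (1 : R) _ (fun i => is_deriveZ (c b i) (is_derive_dphi (lm b) m i t)).
by apply: (is_derive_eq H).
Qed.

Lemma is_derive_tau_abs (x : R) : x != 0 ->
  is_derive x (1 : R) (fun y : R => tau a `|y|) (a * tau a `|x| / x).
Proof.
have pos (z : R) : 0 < z -> is_derive z (1 : R) (fun y : R => tau a `|y|) (a * tau a `|z| / z).
  move=> z0; apply: (@near_eq_is_derive _ _ _ (tau a)).
    near=> y; rewrite gtr0_norm//; near: y; exact: lt_nbhsr.
  apply: (is_derive_eq (is_derive_tau a0 z0)); rewrite gtr0_norm// /tau (powR_pred a z0).
  by move: (z `^ _) => t; field; rewrite !gt_eqF.
move=> x0; have [xn|xp|E] := ltgtP x 0; last by rewrite E eqxx in x0.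
  have nx : 0 < - x by rewrite oppr_gt0.
  have H := is_derive1_comp (pos _ nx) (is_deriveN (is_derive_id x (1 : R))).
  rewrite (_ : (fun y : R => tau a `|y|) = (fun y : R => tau a `|y|) \o -%R); last first.
    by apply/funext => y; rewrite /= normrN.
  by apply: (is_derive_eq H); rewrite normrN invrN; ring.
exact: pos.
Unshelve. all: by end_near.
Qed.

(** On the line every reflection is [x |-> - x], so the Dunkl operator depends on the multiplicities
    only through their half sum [kap] (see [dunklE]). *)
Definition dunR f x := derive1 f x + kap * (f x - f (- x)) / x.

Lemma dunR_derive f x d : is_derive x (1 : R) f d -> dunR f x = d + kap * (f x - f (- x)) / x.
Proof. by move=> h; rewrite /dunR derive1E (@derive_val _ _ _ _ _ _ _ h). Qed.

Lemma near_neq0 (x : R) : x != 0 -> \forall y \near x, y != 0.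
Proof.
move=> x0; have [xn|xp|E] := ltgtP x 0; last by rewrite E eqxx in x0.
  by apply: filterS (lt_nbhsl xn) => y y0; rewrite lt_eqF.
by apply: filterS (lt_nbhsr xp) => y y0; rewrite gt_eqF.
Qed.

Section DunklFormula.
Variables (U0 U1 U2 V0 V1 V2 : R -> R).
Hypothesis dU0 : forall t : R, is_derive t (1 : R) U0 (U1 t).
Hypothesis dU1 : forall t : R, is_derive t (1 : R) U1 (U2 t).
Hypothesis dV0 : forall t : R, is_derive t (1 : R) V0 (V1 t).
Hypothesis dV1 : forall t : R, is_derive t (1 : R) V1 (V2 t).
Let T (x : R) := tau a `|x|.
Let f x := U0 (T x) + x * V0 (T x).

Let dcomp (u u1 : R -> R) (x : R) : x != 0 -> (forall t : R, is_derive t (1 : R) u (u1 t)) ->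
  is_derive x (1 : R) (fun y => u (T y)) (u1 (T x) * (a * T x / x)).
Proof. by move=> x0 du; exact: is_derive1_comp (du (T x)) (is_derive_tau_abs x0). Qed.

Lemma derive_parity (x : R) : x != 0 -> is_derive x (1 : R) f
  (U1 (T x) * (a * T x / x) + (V0 (T x) + V1 (T x) * (a * T x))).
Proof.
move=> x0; have H := is_deriveD (dcomp x0 dU0) (is_deriveM (is_derive_id x (1 : R)) (dcomp x0 dV0)).
apply: (is_derive_eq H); rewrite /GRing.scale/=; move: (T x) (U1 _) (V0 _) (V1 _) => t p q r.
by field.
Qed.

Lemma dunR_parity (x : R) : x != 0 -> dunR f x =
  a * T x * U1 (T x) / x + ((1 + 2 * kap) * V0 (T x) + a * T x * V1 (T x)).
Proof.
move=> x0; rewrite (dunR_derive (derive_parity x0)) /f /T normrN -/(T x).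
move: (T x) (U1 _) (V0 _) (V1 _) (U0 _) => t p q r u.
by field.
Qed.

(** The identity [|x|^(2-a) * tau |x| = (2/a) x^2] removes the powers of [x]. On each parity there
    remains the Laguerre differential operator, with the parameters [(2 kap - 1) / a] and
    [(2 kap + 1) / a]. *)
Lemma dunR2_parity (x : R) : x != 0 -> a^-1 * `|x| `^ (2 - a) * dunR (dunR f) x =
  2 * (T x * U2 (T x) + (lm false + 1) * U1 (T x)) +
  x * (2 * (T x * V2 (T x) + (lm true + 1) * V1 (T x))).
Proof.
move=> x0.
have e : \forall y \near x, (a * (T y * U1 (T y)) / y + ((1 + 2 * kap) * V0 (T y) + a * (T y * V1 (T y))))
    = dunR f y.
  by near=> y; rewrite dunR_parity ?mulrA//; near: y; exact: near_neq0.
have dk (t : R) : is_derive t (1 : R) (fun t => a * (t * U1 t)) (a * (U1 t + t * U2 t)).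
  have H := is_deriveZ a (is_deriveM (is_derive_id t (1 : R)) (dU1 t)).
  by apply: (is_derive_eq H); rewrite /GRing.scale/=; move: (U1 t) (U2 t) => p q; ring.
have dm (t : R) : is_derive t (1 : R) (fun t => (1 + 2 * kap) * V0 t + a * (t * V1 t))
    ((1 + 2 * kap) * V1 t + a * (V1 t + t * V2 t)).
  have H := is_deriveD (is_deriveZ (1 + 2 * kap) (dV0 t)) (is_deriveZ a (is_deriveM (is_derive_id t (1 : R)) (dV1 t))).
  by apply: (is_derive_eq H); rewrite /GRing.scale/=; move: (V1 t) (V2 t) => p q; ring.
have H := is_deriveD (is_deriveM (dcomp x0 dk) (is_deriveV x0 (is_derive_id x (1 : R)))) (dcomp x0 dm).
have {}H := near_eq_is_derive e H.
rewrite (dunR_derive H) !dunR_parity ?oppr_eq0// /T normrN -/(T x) /GRing.scale/=.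
have xT : `|x| `^ (2 - a) * T x = 2 / a * x ^+ 2.
  have nx : 0 < `|x| by rewrite normr_gt0.
  rewrite /T /tau mulrCA -powRD ?subrK; last by apply/implyP => _; rewrite gt_eqF.
  by rewrite powR_mulrn// real_normK// num_real.
have L0 : lm false = (2 * kap - 1) / a.
  by rewrite /lm /lam /parity_exp sE; field; rewrite gt_eqF.
have L1 : lm true = (2 * kap + 1) / a.
  by rewrite /lm /lam /parity_exp sE; field; rewrite gt_eqF.
have an0 : a != 0 by rewrite gt_eqF.
rewrite L0 L1; move: (T x) (U1 _) (U2 _) (V0 _) (V1 _) (V2 _) xT => t p q r u v xT.
transitivity (a^-1 * (`|x| `^ (2 - a) * t) * ((a ^+ 2 * (p + t * q) + (2 * kap - 1) * a * p) / x ^+ 2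
   + (a * ((1 + 2 * kap + a) * u + a * t * v)) / x)).
  by move: (`|x| `^ _) => y; field; rewrite x0 ?an0.
by rewrite xT; field; rewrite x0 an0.
Unshelve. all: by end_near.
Qed.

End DunklFormula.

Lemma lmE b : lm b = (2 * kap + parity_sign (~~ b)) / a.
Proof. by rewrite /lm /lam /parity_exp sE; case: b => /=; field; rewrite gt_eqF. Qed.

Lemma rexp_finE n c : finite_coefs n c -> rexp c =
  (fun x : R => Usum n c false 0 (tau a `|x|) + x * Usum n c true 0 (tau a `|x|)).
Proof. by move=> fc; apply/funext => y; exact: rexp_finite_coefs. Qed.

(** [(2/a) x d/dx] becomes [2 t d/dt]; on the odd part, differentiating the factor [x] adds [2/a],
    which turns the constant [lm false + 1] into [lm true + 1]. Then [euler_phi] applies to both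
    parities. *)
Lemma rexp_h n c (x : R) : finite_coefs n c -> x != 0 ->
  2 / a * (x * derive1 (rexp c) x) + (2 * kap + a - 1) / a * rexp c x = rexp (three_term 0 1 (-1) c) x.
Proof.
move=> fc x0; have E := rexp_finE fc.
rewrite (rexp_finite_coefs x (three_term_finite_coefs 0 1 (-1) fc)) !(Usum_three_term 0 1 (-1) _ _ fc) {}E.
have H := derive_parity (is_derive_Usum n c false 0) (is_derive_Usum n c true 0) x0.
rewrite derive1E (@derive_val _ _ _ _ _ _ _ H).
have S b t : \sum_(l < n) c b l * (0 * ((2 * l%:R + lm b + 1) * phi (lm b) l t) +
     1 * (l.+1%:R * phi (lm b) l.+1 t) + -1 * ((l%:R + lm b) * phim1 (lm b) l t)) =
   2 * t * Usum n c b 1 t + (lm b + 1) * Usum n c b 0 t.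
  rewrite Usum0 /Usum !mulr_sumr -big_split/=; apply: eq_bigr => l _.
  rewrite mul0r add0r mul1r mulN1r -euler_phi.
  by move: (dphi _ _ _ _) (phi _ _ _) => p q; rewrite /=; ring.
rewrite !S !lmE /=; move: (tau a `|x|) => t.
move: (Usum n c false 1 t) (Usum n c true 1 t) (Usum n c false 0 t) (Usum n c true 0 t) => p q r u.
by field; rewrite x0 gt_eqF.
Qed.

Lemma rexp_p n c (x : R) : finite_coefs n c ->
  a^-1 * `|x| `^ a * rexp c x = rexp (three_term 2^-1 (- 2^-1) (- 2^-1) c) x.
Proof.
move=> fc; rewrite (rexp_finite_coefs x (three_term_finite_coefs _ _ _ fc)) !(Usum_three_term _ _ _ _ _ fc) (rexp_finite_coefs x fc).
have S b t : \sum_(l < n) c b l * (2^-1 * ((2 * l%:R + lm b + 1) * phi (lm b) l t) +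
     - 2^-1 * (l.+1%:R * phi (lm b) l.+1 t) + - 2^-1 * ((l%:R + lm b) * phim1 (lm b) l t)) =
   t / 2 * Usum n c b 0 t.
  rewrite Usum0 !mulr_sumr; apply: eq_bigr => l _.
  have := mulX_phi (lm b) l t; rewrite /=.
  move: (phi (lm b) l t) (phi (lm b) l.+1 t) (phim1 (lm b) l t) => p q r E.
  rewrite (_ : t / 2 * (c b l * p) = c b l / 2 * (t * p)); last by ring.
  by rewrite E; field.
by rewrite !S (powa_tau a0); move: (Usum _ _ _ _ _) (Usum _ _ _ _ _) => p q; field; rewrite gt_eqF.
Qed.

(** By [phi_ode] the operator multiplies [phi_l] by [t / 2 - (2 l + lm b + 1)]; expanding [t phi_l]
    leaves [- 1/2] in all three places. Against [rexp_p] only the diagonal sign differs, so the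
    generator of so(2) is diagonal ([act_J]). *)
Lemma rexp_q n c (x : R) : finite_coefs n c -> x != 0 ->
  a^-1 * `|x| `^ (2 - a) * dunR (dunR (rexp c)) x = rexp (three_term (- 2^-1) (- 2^-1) (- 2^-1) c) x.
Proof.
move=> fc x0; have E := rexp_finE fc.
rewrite (rexp_finite_coefs x (three_term_finite_coefs _ _ _ fc)) !(Usum_three_term _ _ _ _ _ fc) {}E.
rewrite (dunR2_parity (is_derive_Usum n c false 0) (is_derive_Usum n c false 1)
  (is_derive_Usum n c true 0) (is_derive_Usum n c true 1) x0).
have S b t : \sum_(l < n) c b l * (- 2^-1 * ((2 * l%:R + lm b + 1) * phi (lm b) l t) +
     - 2^-1 * (l.+1%:R * phi (lm b) l.+1 t) + - 2^-1 * ((l%:R + lm b) * phim1 (lm b) l t)) =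
   2 * (t * Usum n c b 2 t + (lm b + 1) * Usum n c b 1 t).
  rewrite /Usum !mulr_sumr -big_split mulr_sumr; apply: eq_bigr => l _ /=.
  transitivity (2 * (c b l * (t * dphi (lm b) 2 l t + (lm b + 1) * dphi (lm b) 1 l t))); last first.
    by move: (dphi _ 2 _ _) (dphi _ 1 _ _) => p q; ring.
  rewrite phi_ode; have := mulX_phi (lm b) l t.
  move: (phi (lm b) l t) (phi (lm b) l.+1 t) (phim1 (lm b) l t) => p q r E.
  have -> : (2 : R) * (c b l * ((t / 4 - (l%:R + (lm b + 1) / 2)) * p)) = c b l * (2^-1 * (t * p) - (2 * l%:R + lm b + 1) * p) by field.
  by rewrite E; field.
by rewrite !S.
Qed.

End WeightedLine.

(** * The complex L^2 space as a real inner product space *)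

Section ComplexL2.
Variable R : realType.
Local Notation mu := (@lebesgue_measure R).
Local Notation re := (@complex.Re R).
Local Notation im := (@complex.Im R).
Implicit Types (f g h : R -> R[i]) (x : R).

Lemma reD (y z : R[i]) : re (y + z) = re y + re z. Proof. by case: y; case: z. Qed.
Lemma imD (y z : R[i]) : im (y + z) = im y + im z. Proof. by case: y; case: z. Qed.
Lemma reB (y z : R[i]) : re (y - z) = re y - re z. Proof. by case: y; case: z. Qed.
Lemma imB (y z : R[i]) : im (y - z) = im y - im z. Proof. by case: y; case: z. Qed.
Lemma reM (y z : R[i]) : re (y * z) = re y * re z - im y * im z. Proof. by case: y; case: z. Qed.
Lemma imM (y z : R[i]) : im (y * z) = re y * im z + im y * re z. Proof. by case: y; case: z. Qed.
Lemma complexP (y z : R[i]) : re y = re z -> im y = im z -> y = z.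
Proof. by case: y => a b; case: z => c d /= -> ->. Qed.

Variable w : R -> R.
Hypothesis w_ge0 : forall x, 0 <= w x.
Hypothesis mw : measurable_fun setT w.

(** The density of the real part of the Hermitian product: it gives the same norm, and pairing with
    both [g] and [i g] recovers the rest. *)
Definition inner_density f g x := (re (f x) * re (g x) + im (f x) * im (g x)) * w x.
Definition inner f g := integral_line (inner_density f g).
Definition norm2 f := inner f f.
Definition cscale (c : R[i]) f x := c * f x.

Lemma norm2_density_ge0 f x : 0 <= inner_density f f x.
Proof. by apply: mulr_ge0 => //; rewrite -!expr2; apply: addr_ge0; exact: sqr_ge0. Qed.

Lemma memL2P f : memL2 w f <-> real_L2 w (re \o f) /\ real_L2 w (im \o f).
Proof.
have E : L2sq w f = (\int[mu]_x `|(inner_density f f x)%:E|)%E.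
  by rewrite /L2sq; apply: eq_integral => x _; rewrite /= ger0_norm ?norm2_density_ge0// /inner_density !expr2.
split.
  move=> [mr mi hf].
  have h : integrable_line (inner_density f f).
    apply/integrableP; split; last by rewrite -E.
    apply/measurable_EFinP; apply: measurable_funM => //.
    by apply: measurable_funD; apply: measurable_funM.
  have sub (u : R -> R) : measurable_fun setT u -> (forall x, u x ^+ 2 <= re (f x) ^+ 2 + im (f x) ^+ 2) -> real_L2 w u.
    move=> mu0 uf; split => //; apply: (le_integrable_line _ h) => [|x].
      by apply: measurable_funM => //; exact: measurable_funX.
    rewrite ger0_norm; last by apply: mulr_ge0; rewrite ?sqr_ge0.
    by rewrite /inner_density -!expr2 ler_wpM2r.
  by split; apply: sub => // x /=; rewrite ?lerDl ?lerDr sqr_ge0.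
move=> [[mr hr] [mi hi]]; split => //; rewrite E.
have : integrable_line (inner_density f f).
  have := integrable_lineD hr hi; apply: eq_integrable => // x _ /=; congr EFin.
  by rewrite /inner_density mulrDl !expr2.
by move=> /integrableP[].
Qed.

Lemma inner_integrable_line f g : memL2 w f -> memL2 w g -> integrable_line (inner_density f g).
Proof.
move=> /memL2P[hr hi] /memL2P[kr ki].
have := integrable_lineD (real_L2_mul w_ge0 mw hr kr) (real_L2_mul w_ge0 mw hi ki).
by apply: eq_integrable => // x _ /=; rewrite /inner_density mulrDl.
Qed.

Lemma L2sqE f : memL2 w f -> L2sq w f = (norm2 f)%:E.
Proof.
move=> hf; have h := inner_integrable_line hf hf.
rewrite /norm2 /inner /integral_line /Rintegral fineK; first by apply: eq_integral => x _; rewrite /inner_density !expr2.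
exact: integrable_fin_num.
Qed.

Lemma memL2D f g : memL2 w f -> memL2 w g -> memL2 w (f \+ g).
Proof.
move=> /memL2P[hr hi] /memL2P[kr ki]; apply/memL2P; split.
- have := real_L2D w_ge0 mw hr kr; rewrite (_ : (fun x => _) = re \o (f \+ g))//.
  by apply/funext => x; rewrite /= reD.
- have := real_L2D w_ge0 mw hi ki; rewrite (_ : (fun x => _) = im \o (f \+ g))//.
  by apply/funext => x; rewrite /= imD.
Qed.

Lemma memL2Z c f : memL2 w f -> memL2 w (cscale c f).
Proof.
move=> /memL2P[hr hi]; apply/memL2P; split.
- have := real_L2B w_ge0 mw (real_L2Z (re c) hr) (real_L2Z (im c) hi); rewrite (_ : (fun x => _) = re \o cscale c f)//.
  by apply/funext => x; rewrite /= reM.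
- have := real_L2D w_ge0 mw (real_L2Z (re c) hi) (real_L2Z (im c) hr); rewrite (_ : (fun x => _) = im \o cscale c f)//.
  by apply/funext => x; rewrite /= imM.
Qed.

Lemma memL2B f g : memL2 w f -> memL2 w g -> memL2 w (f \- g).
Proof.
move=> hf hg; have := memL2D hf (memL2Z (-1) hg).
by rewrite (_ : f \+ _ = f \- g)//; apply/funext => x; rewrite /= /cscale mulN1r.
Qed.

Lemma innerC f g : inner f g = inner g f.
Proof. by congr integral_line; apply/funext => x; rewrite /inner_density mulrC [_ * re _]mulrC [_ * im _]mulrC mulrC. Qed.

Lemma innerDl f g h : memL2 w f -> memL2 w g -> memL2 w h -> inner (f \+ g) h = inner f h + inner g h.
Proof.
move=> hf hg hh; rewrite /inner -integral_lineD; [|exact: inner_integrable_line..].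
by congr integral_line; apply/funext => x; rewrite /inner_density/= reD imD; ring.
Qed.

Lemma innerBl f g h : memL2 w f -> memL2 w g -> memL2 w h -> inner (f \- g) h = inner f h - inner g h.
Proof.
move=> hf hg hh; rewrite /inner -integral_lineB; [|exact: inner_integrable_line..].
by congr integral_line; apply/funext => x; rewrite /inner_density/= reB imB; ring.
Qed.

Lemma innerZl (r : R) f h : memL2 w f -> memL2 w h -> inner (cscale r%:C%C f) h = r * inner f h.
Proof.
move=> hf hh; rewrite /inner -integral_lineZ; last exact: inner_integrable_line.
by congr integral_line; apply/funext => x; rewrite /inner_density /cscale reM imM /=; ring.
Qed.

Lemma norm2_ge0 f : 0 <= norm2 f. Proof. by apply: integral_line_ge0 => x; exact: norm2_density_ge0. Qed.

Lemma norm2D f g : memL2 w f -> memL2 w g -> norm2 (f \+ g) = norm2 f + 2 * inner f g + norm2 g.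
Proof.
move=> hf hg; have hfg := memL2D hf hg.
by rewrite /norm2 innerDl// ![inner _ (f \+ g)]innerC !innerDl// (innerC g f); ring.
Qed.

Lemma norm2Z (r : R) f : memL2 w f -> norm2 (cscale r%:C%C f) = r ^+ 2 * norm2 f.
Proof.
move=> hf; have hz := memL2Z r%:C%C hf.
by rewrite /norm2 innerZl// innerC innerZl// expr2 mulrA.
Qed.

(** It follows from the nonnegativity of the squared norms of [f + d^-1 g] and [f - d^-1 g]. Only
    squared norms occur, and a large [d] makes the second term small. *)
Lemma inner_le (d : R) f g : 0 < d -> memL2 w f -> memL2 w g ->
  `|inner f g| <= d * norm2 f + d^-1 * norm2 g.
Proof.
move=> d0 hf hg.
have K (r : R) : 0 <= norm2 f + 2 * (r * inner f g) + r ^+ 2 * norm2 g.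
  have hz := memL2Z r%:C%C hg.
  by have := norm2_ge0 (f \+ cscale r%:C%C g); rewrite norm2D// norm2Z// [inner f _]innerC innerZl// (innerC g f).
have K1 := K d^-1; have K2 := K (- d^-1).
have nf := norm2_ge0 f; have ng := norm2_ge0 g; have dn : d != 0 by rewrite gt_eqF.
have {}K1 : 0 <= d * norm2 f + 2 * inner f g + d^-1 * norm2 g.
  have := mulr_ge0 (ltW d0) K1; move: (norm2 f) (norm2 g) (inner f g) => p q r.
  by rewrite (_ : d * (p + _ + _) = d * p + 2 * r + d^-1 * q)//; field.
have {}K2 : 0 <= d * norm2 f - 2 * inner f g + d^-1 * norm2 g.
  have := mulr_ge0 (ltW d0) K2; move: (norm2 f) (norm2 g) (inner f g) => p q r.
  by rewrite (_ : d * (p + _ + _) = d * p - 2 * r + d^-1 * q)//; field.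
have P1 : 0 <= d * norm2 f by rewrite mulr_ge0// ltW.
have P2 : 0 <= d^-1 * norm2 g by rewrite mulr_ge0// invr_ge0 ltW.
by move: (d * norm2 f) (d^-1 * norm2 g) (inner f g) K1 K2 P1 P2 => p q r *; rewrite ler_norml; apply/andP; split; lra.
Qed.

Lemma norm2D_le f g : memL2 w f -> memL2 w g -> norm2 (f \+ g) <= 2 * norm2 f + 2 * norm2 g.
Proof.
move=> hf hg; rewrite norm2D//.
have := inner_le ltr01 hf hg; rewrite invr1 !mul1r => /(le_trans (ler_norm _)).
have := norm2_ge0 f; have := norm2_ge0 g.
have := norm2_ge0 (f \- g); rewrite (_ : f \- g = f \+ cscale (-1)%:C%C g).
  rewrite norm2D//; last exact: memL2Z.
  rewrite norm2Z// [inner f (cscale _ _)]innerC innerZl// (innerC g f) sqrrN expr1n mul1r.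
  by move: (norm2 f) (norm2 g) (inner f g) => p q r; lra.
by apply/funext => x; rewrite /cscale/= rmorphN rmorph1 mulN1r.
Qed.

Lemma norm2B_le f g : memL2 w f -> memL2 w g -> norm2 (f \- g) <= 2 * norm2 f + 2 * norm2 g.
Proof.
move=> hf hg; rewrite (_ : f \- g = f \+ cscale (-1)%:C%C g); last first.
  by apply/funext => x; rewrite /cscale/= rmorphN rmorph1 mulN1r.
apply: le_trans (norm2D_le hf (memL2Z _ hg)) _.
by rewrite norm2Z// sqrrN expr1n mul1r.
Qed.

Lemma norm2C f g : norm2 (f \- g) = norm2 (g \- f).
Proof. by congr integral_line; apply/funext => x; rewrite /inner_density/= !reB !imB; ring. Qed.

Lemma aeeq_sym f g : aeeq f g -> aeeq g f.
Proof. by apply: ae_mono => x ->. Qed.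

Lemma aeeq_trans f g h : aeeq f g -> aeeq g h -> aeeq f h.
Proof. by move=> h1 h2; apply: ae_mono (ae_and h1 h2) => x [-> ->]. Qed.

Lemma inner_ae f f' g : memL2 w f -> memL2 w f' -> memL2 w g -> aeeq f f' -> inner f g = inner f' g.
Proof.
move=> hf hf' hg e; have h1 := inner_integrable_line hf hg; have h2 := inner_integrable_line hf' hg.
congr fine; apply: ae_eq_integral => //.
- by apply/measurable_EFinP; exact: integrable_line_measurable.
- by apply/measurable_EFinP; exact: integrable_line_measurable.
- by apply: ae_mono e => x E _; rewrite /= /inner_density E.
Qed.

Lemma norm2_ae f f' : memL2 w f -> memL2 w f' -> aeeq f f' -> norm2 f = norm2 f'.
Proof. by move=> hf hf' e; rewrite /norm2 (inner_ae hf hf')// innerC (inner_ae hf hf'). Qed.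

Section Limits.
Variables (T : Type) (A : set_system T).
Context {FA : Filter A}.
Implicit Types F G : T -> R -> R[i].

Definition cvL F f := norm2 (F t \- f) @[t --> A] --> (0 : R).

Lemma L2cvgP F f : (forall t, memL2 w (F t)) -> memL2 w f -> L2cvg w F A f <-> cvL F f.
Proof.
move=> hF hf; rewrite /L2cvg /cvL.
rewrite (_ : (fun t => L2sq w _) = EFin \o (fun t => norm2 (F t \- f))); last first.
  by apply/funext => t; rewrite L2sqE//; exact: memL2B.
by split => [/fine_cvgP[]//|h]; apply/fine_cvgP; split => //; exact: nearW.
Qed.

Lemma cvL_le (u : T -> R) F f : (forall t, norm2 (F t \- f) <= u t) ->
  u t @[t --> A] --> (0 : R) -> cvL F f.
Proof.
move=> h; apply: (@squeeze_cvgr _ _ _ _ (fun=> 0)); last exact: cvg_cst.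
by apply: nearW => t; rewrite norm2_ge0 h.
Qed.

Lemma cvL_D F G f g : (forall t, memL2 w (F t)) -> (forall t, memL2 w (G t)) -> memL2 w f -> memL2 w g ->
  cvL F f -> cvL G g -> cvL (fun t => F t \+ G t) (f \+ g).
Proof.
move=> hF hG hf hg cF cG.
apply: (@cvL_le (fun t => 2 * norm2 (F t \- f) + 2 * norm2 (G t \- g))) => [t|].
  rewrite (_ : _ \- _ = (F t \- f) \+ (G t \- g)); last by apply/funext => x /=; ring.
  by apply: norm2D_le; exact: memL2B.
rewrite -[0]addr0 -[X in X + _](mulr0 2) -[X in _ + X](mulr0 2).
by apply: cvgD; apply: cvgMr.
Qed.

Lemma cvL_Z (m : T -> R) (m0 : R) F f : (forall t, memL2 w (F t)) -> memL2 w f ->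
  m t @[t --> A] --> m0 -> cvL F f -> cvL (fun t => cscale (m t)%:C%C (F t)) (cscale m0%:C%C f).
Proof.
move=> hF hf cm cF.
apply: (@cvL_le (fun t => 2 * (m t ^+ 2 * norm2 (F t \- f)) + 2 * ((m t - m0) ^+ 2 * norm2 f))) => [t|].
  rewrite (_ : _ \- _ = cscale (m t)%:C%C (F t \- f) \+ cscale (m t - m0)%:C%C f); last first.
    by apply/funext => x; apply: complexP; rewrite /= /cscale !(reB, reD, reM, imB, imD, imM)/=; ring.
  have h := memL2B (hF t) hf.
  by apply: le_trans (norm2D_le (memL2Z _ h) (memL2Z _ hf)) _; rewrite !norm2Z.
have -> : 0 = 2 * (m0 ^+ 2 * 0) + 2 * (0 ^+ 2 * norm2 f) :> R by ring.
apply: cvgD; apply: cvgMr; apply: cvgM => //.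
- by rewrite !expr2; apply: cvgM.
- by rewrite !expr2; apply: cvgM; rewrite -(subrr m0); apply: cvgB => //; exact: cvg_cst.
- exact: cvg_cst.
Qed.

Lemma cvL_cst f : cvL (fun=> f) f.
Proof.
rewrite /cvL (_ : norm2 _ = 0); first exact: cvg_cst.
rewrite /norm2 /inner (_ : inner_density _ _ = fun=> 0); last by apply/funext => x; rewrite /inner_density/= subrr/=; ring.
by rewrite /integral_line Rintegral_cst// mul0r.
Qed.

Lemma cvL_inner F f g : (forall t, memL2 w (F t)) -> memL2 w f -> memL2 w g -> cvL F f ->
  inner (F t) g @[t --> A] --> inner f g.
Proof.
move=> hF hf hg cF; apply/cvgrPdist_lt => e e0.
(* This makes [d^-1 * norm2 g] at most [e / 2]; the [+ 1] keeps [d] positive when [g] is zero. *)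
pose d := (norm2 g + 1) / (e / 2).
have ng := norm2_ge0 g; have g1 : 0 < norm2 g + 1 by lra.
have d0 : 0 < d by rewrite !divr_gt0.
have e2d : 0 < e / 2 / d by rewrite !divr_gt0.
have /cvgrPdist_lt/(_ _ e2d) := cF; apply: filterS => t; rewrite sub0r normrN => H.
rewrite -innerBl// -/(f \- F t).
apply: le_lt_trans (inner_le d0 (memL2B hf (hF t)) hg) _.
rewrite norm2C [e](splitr e) ltr_leD//.
  by rewrite mulrC -ltr_pdivlMr// (le_lt_trans (ler_norm _)).
rewrite /d invf_div mulrAC -mulrA ler_piMr ?divr_ge0 ?(ltW e0)//.
by rewrite ler_pdivrMr// mul1r lerDl.
Qed.

End Limits.
End ComplexL2.

(** * Elements and one-parameter subgroups of the covering group *)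

Section CoverGroup.
Variable R : realType.
Implicit Types p q t s x y z : R.

Definition mx2 (a b c d : R) : 'M[R]_2 :=
  \matrix_(i, j) if i == 0 then (if j == 0 then a else b) else if j == 0 then c else d.

Lemma mx2P (A B : 'M[R]_2) : A 0 0 = B 0 0 -> A 0 1 = B 0 1 -> A 1 0 = B 1 0 -> A 1 1 = B 1 1 -> A = B.
Proof.
move=> h00 h01 h10 h11; apply/matrixP => i j.
have o2 (k : 'I_2) : k = 0 \/ k = 1.
  by case: k => [[|[|]]//= h]; [left|right]; apply/val_inj.
by case: (o2 i) => ->; case: (o2 j) => ->.
Qed.

Lemma mx2M a b c d a' b' c' d' : mx2 a b c d *m mx2 a' b' c' d' =
  mx2 (a * a' + b * c') (a * b' + b * d') (c * a' + d * c') (c * b' + d * d').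
Proof. by apply: mx2P; rewrite !mxE big_ord_recl big_ord1 !mxE. Qed.

Lemma det_mx2 a b c d : \det (mx2 a b c d) = a * d - b * c.
Proof.
rewrite (expand_det_row _ 0) !big_ord_recl big_ord0 /cofactor !det_mx11 !mxE/=; ring.
Qed.

Lemma lifts_mx2 a b c d (f : R -> R) : (forall t, exists2 r, 0 < r &
    a * cos t + b * sin t = r * cos (f t) /\ c * cos t + d * sin t = r * sin (f t)) ->
  lifts (mx2 a b c d) f.
Proof.
move=> H t; have [r r0 [h1 h2]] := H t; exists r => //.
apply/matrixP => i j; rewrite !mxE big_ord_recl big_ord1 !mxE/=.
by case: i => [[|[|]]//= hi]; rewrite -?h1 -?h2.
Qed.

(** [y / (r + x)] is the tangent of half the polar angle of [(x, y)]; the condition excludes the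
    negative real axis and the origin. *)
Lemma cos_sin_2atan x y : let r := Num.sqrt (x ^+ 2 + y ^+ 2) in 0 < r + x ->
  r * cos (2 * atan (y / (r + x))) = x /\ r * sin (2 * atan (y / (r + x))) = y.
Proof.
move=> r; set z := y / (r + x) => r0.
have rr : r ^+ 2 = x ^+ 2 + y ^+ 2 by rewrite sqr_sqrtr// addr_ge0// sqr_ge0.
have c0 : 0 < cos (atan z) by apply: cos_gt0_pihalf; rewrite atan_gtNpi2 atan_ltpi2.
have cn : cos (atan z) != 0 by rewrite gt_eqF.
have rge : 0 <= r := sqrtr_ge0 _.
have rp : 0 < r.
  rewrite lt_neqAle rge andbT eq_sym; apply/eqP => E.
  have y0 : 0 <= y ^+ 2 := sqr_ge0 y; have x0 : 0 <= x ^+ 2 := sqr_ge0 x.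
  move: rr; rewrite E expr0n/= => /esym/eqP; rewrite paddr_eq0// sqrf_eq0 => /andP[/eqP xe _].
  by move: r0; rewrite E xe addr0 ltxx.
have := cos2_tan2 cn; rewrite atanK => C.
have C2 : cos (atan z) ^+ 2 = (r + x) / (2 * r).
  rewrite -[LHS]invrK C; apply: (canLR invrK).
  rewrite /z expr_div_n; apply/eqP; rewrite -subr_eq0.
  rewrite (_ : _ - _ = (x ^+ 2 + y ^+ 2 - r ^+ 2) / (r + x) ^+ 2); first by rewrite rr subrr mul0r.
  by field; rewrite !gt_eqF.
have S : sin (atan z) = z * cos (atan z).
  by have E : sin (atan z) / cos (atan z) = z := atanK z; rewrite -[LHS](divfK cn) E.
rewrite mulr_natl cos_mulr2n sin_mulr2n S mulrCA -expr2 C2 /z; split; first by field; rewrite gt_eqF.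
by field; rewrite !gt_eqF.
Qed.

Section Element.
Variables th t0 s : R.
Let e := expR t0.
Let ei := expR (- t0).
Let V t := e * cos t + s * e * sin t.
Let W t := ei * sin t.
Let X t := cos t * V t + sin t * W t.
Let Y t := cos t * W t - sin t * V t.
Let rho t := Num.sqrt (X t ^+ 2 + Y t ^+ 2).

Definition gmx := mx2 (e * cos th) (s * e * cos th - ei * sin th) (e * sin th) (s * e * sin th + ei * cos th).
(* [(X, Y)] is the image of [ray t] under the triangular factor, in the frame
   rotated by [t]; its angle is [2 atan (Y / (rho + X))] since a triangular matrix
   with positive diagonal maps no ray to the opposite one. *)
Definition glift t := t + th + 2 * atan (Y t / (rho t + X t)).

Let e_ei : e * ei = 1. Proof. by rewrite /e /ei -expRD subrr expR0. Qed.
Let e0 : 0 < e. Proof. exact: expR_gt0. Qed.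
Let ei0 : 0 < ei. Proof. exact: expR_gt0. Qed.

Let VE t : V t = cos t * X t - sin t * Y t.
Proof. by rewrite /X /Y -[LHS]mul1r -(cos2Dsin2 t); ring. Qed.
Let WE t : W t = sin t * X t + cos t * Y t.
Proof. by rewrite /X /Y -[LHS]mul1r -(cos2Dsin2 t); ring. Qed.

Let rhoX t : 0 < rho t + X t.
Proof.
(* If [Y t = 0] then [ray t] is an eigenvector of the triangular factor and [X t] its eigenvalue,
   [e] when [sin t = 0] and [ei] otherwise, positive in both cases. *)
have [Y0|Y0] := eqVneq (Y t) 0.
  suff X0 : 0 < X t by rewrite ltr_wpDl// sqrtr_ge0.
  have [s0|s0] := eqVneq (sin t) 0.
    have c1 : cos t ^+ 2 = 1 by have := cos2Dsin2 t; rewrite s0 expr0n/= addr0.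
    by rewrite /X /V s0 mul0r mulr0 !addr0 mulrCA -expr2 c1 mulr1.
  have := WE t; rewrite Y0 mulr0 addr0 mulrC => /(mulIf s0) <-.
  by [].
have lt : `|X t| < rho t.
  rewrite -sqrtr_sqr ltr_sqrt; first by rewrite ltrDl exprn_even_gt0.
  by rewrite ltr_wpDl ?sqr_ge0// exprn_even_gt0.
by have := ler_norm (- X t); rewrite normrN; move: (rho t) (X t) lt => p q; lra.
Qed.

Lemma gmx_det : \det gmx = 1.
Proof.
rewrite det_mx2 -e_ei -[RHS]mulr1 -(cos2Dsin2 th); ring.
Qed.

Lemma glift_lifts : lifts gmx glift.
Proof.
apply: lifts_mx2 => t; exists (rho t).
  have [/=] := cos_sin_2atan (rhoX t); rewrite -/(rho t) => h1 h2.
  rewrite lt_neqAle sqrtr_ge0 andbT eq_sym; apply/eqP => E.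
  have := rhoX t; rewrite -h1 E mul0r addr0 ltxx//.
have [/=] := cos_sin_2atan (rhoX t); rewrite -/(rho t) /glift => h1 h2.
set u := 2 * atan _ in h1 h2 *.
split.
  transitivity (cos th * V t - sin th * W t); first by rewrite /V /W; ring.
  by rewrite VE WE -h1 -h2 !(cosD, sinD); ring.
transitivity (sin th * V t + cos th * W t); first by rewrite /V /W; ring.
by rewrite VE WE -h1 -h2 !(cosD, sinD); ring.
Qed.

Lemma glift_continuous : continuous glift.
Proof.
have cc : continuous (@cos R) by exact: continuous_cos.
have cscale : continuous (@sin R) by exact: continuous_sin.
have ccst (r : R) : continuous (fun _ : R => r) by move=> ?; exact: cvg_cst.
have cV : continuous V.
  by move=> t; apply: cvgD; apply: cvgM; [exact: ccst|exact: cc|exact: ccst|exact: cscale].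
have cW : continuous W by move=> t; apply: cvgM; [exact: ccst|exact: cscale].
have cX : continuous X.
  by move=> t; apply: cvgD; apply: cvgM; [exact: cc|exact: cV|exact: cscale|exact: cW].
have cY : continuous Y.
  by move=> t; apply: cvgB; apply: cvgM; [exact: cc|exact: cW|exact: cscale|exact: cV].
have cr : continuous rho.
  move=> t; apply: (@continuous_comp _ _ _ (fun t => X t ^+ 2 + Y t ^+ 2) Num.sqrt); last exact: sqrt_continuous.
  by apply: cvgD; rewrite !expr2; apply: cvgM; [exact: cX|exact: cX|exact: cY|exact: cY].
move=> t; apply: cvgD; first by apply: cvgD; [exact: cvg_id|exact: ccst].
apply: cvgM; first exact: ccst.
apply: (@continuous_comp _ _ _ (fun t => Y t / (rho t + X t)) (@atan R)); last exact: continuous_atan.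
apply: cvgM; first exact: cY.
apply: (@continuous_comp _ _ _ (fun t => rho t + X t) GRing.inv).
  by apply: cvgD; [exact: cr|exact: cX].
by apply: inv_continuous; rewrite gt_eqF.
Qed.

Definition iwasawa_el := SL2Cover gmx_det glift_continuous glift_lifts.

Lemma glift0 : glift 0 = th.
Proof.
rewrite /glift (_ : Y 0 = 0) ?mul0r ?atan0 ?mulr0 ?addr0 ?add0r//.
by rewrite /Y /W /V sin0 !(mulr0, mul0r) subr0.
Qed.

Lemma iwasawa_iwasawa_el : iwasawa iwasawa_el = \row_i [:: th; t0; s]`_i.
Proof.
apply/rowP => i; rewrite !mxE.
have n2 : (e * cos th) ^+ 2 + (e * sin th) ^+ 2 = e ^+ 2.
  by rewrite -[RHS]mulr1 -(cos2Dsin2 th); ring.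
case: i => [[|[|[|]]]//= hi].
- exact: glift0.
- by rewrite n2 sqrtr_sqr gtr0_norm// expRK.
- rewrite n2 (_ : _ + _ = s * e ^+ 2); first by rewrite mulfK// expf_neq0// gt_eqF.
  by rewrite -[RHS]mulr1 -(cos2Dsin2 th); ring.
Qed.

End Element.

Lemma lift_rotation th x : clift (iwasawa_el th 0 0) x = x + th.
Proof.
rewrite /= /glift oppr0 expR0 !(mul1r, mul0r) addr0 [X in X / _](_ : _ = 0) ?mul0r ?atan0 ?mulr0 ?addr0//.
by rewrite mulrC subrr.
Qed.

(** If [|d|] were nonzero somewhere, it would take a value in []0, pi]] by the intermediate value
    theorem, and there the cosine is less than 1. *)
Lemma cos_eq1 (d : R -> R) : continuous d -> d 0 = 0 -> (forall t, cos (d t) = 1) -> forall t, d t = 0.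
Proof.
move=> cd d0 h t.
have cn : continuous (fun t => `|d t|) by move=> u; apply: cvg_norm; exact: cd.
have hn u : cos `|d u| = 1.
  by case: (lerP 0 (d u)) => h0; [rewrite ger0_norm|rewrite ltr0_norm// cosN].
apply/eqP; rewrite -normr_eq0; apply/negPn/negP => dn.
have dp : 0 < `|d t| by rewrite lt_neqAle normr_ge0 andbT eq_sym.
pose v := Num.min `|d t| pi; have v0 : 0 < v by rewrite lt_min dp pi_gt0.
have vd : v <= `|d t| by rewrite ge_min lexx.
have vpi : v <= pi by rewrite ge_min lexx orbT.
have [c hc] : exists c, `|d c| = v.
  have [t0|t0] := leP 0 t.
    have [||c _ hc] := @IVT R (fun t => `|d t|) 0 t v t0; [exact: continuous_subspaceT| |by exists c].
    by rewrite d0 normr0 ge_min le_max (ltW v0) vd orbT.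
  have [||c _ hc] := @IVT R (fun t => `|d t|) t 0 v (ltW t0); [exact: continuous_subspaceT| |by exists c].
  by rewrite d0 normr0 ge_min le_max (ltW v0) vd orbT.
have := hn c; rewrite hc => E.
have : cos v < cos 0 by rewrite ltr_cos// in_itv/= ?lexx ?pi_ge0 ?(ltW v0).
by rewrite E cos0 ltxx.
Qed.

(** Two lifts of the same matrix give the same rays, so their difference is continuous with cosine
    1, and it vanishes at 0. *)
Lemma cover_ext (g h : SL2cover R) : cmat g = cmat h -> clift g 0 = clift h 0 -> g = h.
Proof.
move=> em e0.
have el : clift g = clift h.
  apply/funext => t; apply/eqP; rewrite -subr_eq0; apply/eqP; move: t.
  apply: cos_eq1.
  - by move=> t; apply: cvgB; exact: clift_continuous.
  - by rewrite e0 subrr.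
  - move=> t; have [r r0 hr] := clift_lifts g t; have [r' r'0 hr'] := clift_lifts h t.
    have E : r *: ray (clift g t) = r' *: ray (clift h t) by rewrite -hr -hr' em.
    have Ec := congr1 (fun m : 'cV_2 => m 0 0) E; have Es := congr1 (fun m : 'cV_2 => m 1 0) E.
    move: Ec Es; rewrite !mxE/=; set u := clift g t; set v := clift h t => Ec Es.
    have rr : r ^+ 2 = r' ^+ 2.
      rewrite -[LHS]mulr1 -(cos2Dsin2 u) -[RHS]mulr1 -(cos2Dsin2 v) !mulrDr -!exprMn Ec Es//.
    have {}rr : r = r' by apply/eqP; rewrite -(eqrXn2 (n := 2)) ?rr// ltW.
    have rn : r != 0 by rewrite gt_eqF.
    move: Ec Es; rewrite -rr => /(mulfI rn) Ec /(mulfI rn) Es.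
    by rewrite cosB Ec Es -!expr2 cos2Dsin2.
move: g h em e0 el => [m f d c l] [m' f' d' c' l'] /= em _ el; subst.
by congr SL2Cover; exact: Prop_irrelevance.
Qed.

Lemma cmulA (f g h : SL2cover R) : cmul f (cmul g h) = cmul (cmul f g) h.
Proof. by apply: cover_ext => //=; rewrite mulmxA. Qed.

Lemma cmul1 (g : SL2cover R) : cmul (cone R) g = g.
Proof. by apply: cover_ext => //=; rewrite mul1mx. Qed.

Lemma cmulg1 (g : SL2cover R) : cmul g (cone R) = g.
Proof. by apply: cover_ext => //=; rewrite mulmx1. Qed.

Lemma iwasawa_el_mul th t s t' s' :
  cmul (iwasawa_el th t s) (iwasawa_el 0 t' s') = iwasawa_el th (t + t') (s' + s * expR (- (2 * t'))).
Proof.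
apply: cover_ext; last by rewrite /= !glift0.
rewrite /= /gmx cos0 sin0 !(mulr1, mulr0, subr0, add0r) mx2M.
have -> : expR (t + t') = expR t * expR t' by rewrite expRD.
have -> : expR (- (t + t')) = expR (- t) * expR (- t') by rewrite opprD expRD.
have -> : expR (- (2 * t')) = expR (- t') ^+ 2 by rewrite mulr_natl mulr2n opprD expRD expr2.
have E : expR t' * expR (- t') = 1 by rewrite -expRD subrr expR0.
move: (expR t') (expR (- t')) (expR t) (expR (- t)) (cos th) (sin th) E => u v x y c d E.
have K : u * v ^+ 2 = v by rewrite expr2 mulrA E mul1r.
have K2 : s * v ^+ 2 * (x * u) = s * x * v by rewrite -{2}K; ring.
by congr mx2; rewrite ?mulrDl ?K2; ring.
Qed.

Lemma iwasawa_el_rotation th th' t s : cmul (iwasawa_el th 0 0) (iwasawa_el th' t s) = iwasawa_el (th + th') t s.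
Proof.
apply: cover_ext; last first.
  by have := lift_rotation th (glift th' t s 0) => /= ->; rewrite !glift0 addrC.
rewrite /= /gmx oppr0 expR0 !(mul1r, mul0r, add0r, sub0r) mx2M cosD sinD.
by congr mx2; ring.
Qed.

Lemma gel1 : iwasawa_el 0 0 0 = cone R.
Proof.
apply: cover_ext; last by rewrite /= glift0.
rewrite /= /gmx oppr0 expR0 cos0 sin0; apply: mx2P; rewrite !mxE/=; ring.
Qed.

End CoverGroup.

(** * One-parameter subgroups along the Iwasawa coordinate lines *)

Section OneParameter.
Variable R : realType.
Implicit Types (t s h : R) (x : 'rV[R]_3).

Lemma cvg_mx (T : Type) (A : set_system T) (FA : Filter A) m n (F : T -> 'M[R]_(m, n)) (M : 'M[R]_(m, n)) :
  (forall i j, F t i j @[t --> A] --> M i j) -> F t @[t --> A] --> M.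
Proof.
move=> H B [P hP sB].
have h : \forall t \near A, forall i : 'I_m, forall j : 'I_n, P i j (F t i j).
  by apply: filter_forall => i; apply: filter_forall => j; exact: H.
by apply: filterS h => t ht; apply: sB.
Qed.

Lemma iwasawa_continuous (g : R -> SL2cover R) :
  (forall i j, continuous (fun h => cmat (g h) i j)) -> continuous (fun h => clift (g h) 0) ->
  continuous (fun h => iwasawa (g h)).
Proof.
move=> cm cl h; apply: cvg_mx => i j.
have n2 u : 0 < cmat (g u) 0 0 ^+ 2 + cmat (g u) 1 0 ^+ 2.
  rewrite lt_neqAle addr_ge0 ?sqr_ge0// andbT eq_sym; apply/eqP => E.
  have := E; move=> /eqP; rewrite paddr_eq0 ?sqr_ge0// !sqrf_eq0 => /andP[/eqP e1 /eqP e2].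
  have : \det (cmat (g u)) = 0.
    have -> : cmat (g u) = mx2 0 (cmat (g u) 0 1) 0 (cmat (g u) 1 1).
      by apply: mx2P; rewrite ?e1 ?e2 !mxE.
    by rewrite det_mx2 mul0r mulr0 subrr.
  by rewrite cmat_det => /eqP; rewrite oner_eq0.
have c2 : (fun u => cmat (g u) 0 0 ^+ 2 + cmat (g u) 1 0 ^+ 2) u @[u --> h] -->
    (cmat (g h) 0 0 ^+ 2 + cmat (g h) 1 0 ^+ 2).
  by apply: cvgD; rewrite !expr2; apply: cvgM; exact: cm.
rewrite /iwasawa (_ : (fun u => _) = (fun u => [:: clift (g u) 0;
   ln (Num.sqrt (cmat (g u) 0 0 ^+ 2 + cmat (g u) 1 0 ^+ 2));
   (cmat (g u) 0 0 * cmat (g u) 0 1 + cmat (g u) 1 0 * cmat (g u) 1 1) /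
   (cmat (g u) 0 0 ^+ 2 + cmat (g u) 1 0 ^+ 2)]`_j)); last by apply/funext => u; rewrite mxE.
rewrite mxE; case: j => [[|[|[|]]]//= hj].
- exact: cl.
- apply: (@continuous_comp _ _ _ (fun u => Num.sqrt (cmat (g u) 0 0 ^+ 2 + cmat (g u) 1 0 ^+ 2)) (@ln R)).
    apply: (@continuous_comp _ _ _ (fun u => cmat (g u) 0 0 ^+ 2 + cmat (g u) 1 0 ^+ 2) Num.sqrt) => //.
    exact: sqrt_continuous.
  by apply: continuous_ln; rewrite sqrtr_gt0.
- apply: cvgM; first by apply: cvgD; apply: cvgM; exact: cm.
  apply: (@continuous_comp _ _ _ (fun u => cmat (g u) 0 0 ^+ 2 + cmat (g u) 1 0 ^+ 2) GRing.inv) => //.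
  by apply: inv_continuous; rewrite gt_eqF.
Qed.

(** All subgroups needed have matrices that combine two fixed matrices with scalar functions, so
    continuity and the derivative at 0 reduce to those scalars. *)
Lemma one_parameter_of_cmat (g : R -> SL2cover R) (u v : R -> R) du dv (P Q : 'M[R]_2) :
  (forall s t, g (s + t) = cmul (g s) (g t)) ->
  (forall h, cmat (g h) = u h *: P + v h *: Q) ->
  (forall h, is_derive h (1 : R) u (du h)) -> (forall h, is_derive h (1 : R) v (dv h)) ->
  continuous (fun h => clift (g h) 0) ->
  one_parameter_subgroup (du 0 *: P + dv 0 *: Q) g.
Proof.
move=> gM gE hu hv cl.
have E i j : (fun h => cmat (g h) i j) = (fun h => P i j * u h + Q i j * v h).
  by apply/funext => h; rewrite gE !mxE mulrC [_ * v _]mulrC.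
have d i j h : is_derive h (1 : R) (fun h => cmat (g h) i j) (P i j * du h + Q i j * dv h).
  by rewrite E; exact: is_deriveD (is_deriveZ (P i j) (hu h)) (is_deriveZ (Q i j) (hv h)).
split => //.
- by apply: iwasawa_continuous => // i j h; exact: is_derive_continuous (d i j h).
- have D : derivable (fun t => cmat (g t)) (0 : R) 1.
    by apply/derivable_mxP => i j; exact: (@ex_derive _ _ _ _ _ _ _ (d i j 0)).
  split => //; rewrite derive_mx//; apply/matrixP => i j; rewrite !mxE.
  by rewrite (@derive_val _ _ _ _ _ _ _ (d i j 0)) mulrC [Q _ _ * _]mulrC.
Qed.

Lemma one_parameter_e :
  one_parameter_subgroup (mx2 0 1 0 0) (fun h => iwasawa_el 0 0 h : SL2cover R).
Proof.
rewrite (_ : mx2 0 1 0 0 = (0 : R) *: mx2 1 0 0 1 + 1 *: mx2 0 1 0 0); last first.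
  by apply: mx2P; rewrite !mxE/=; ring.
apply: (@one_parameter_of_cmat _ (fun=> 1) id (fun=> 0) (fun=> 1)).
- by move=> s t; rewrite iwasawa_el_mul addr0 mulr0 oppr0 expR0 mulr1 addrC.
- move=> h; rewrite /= /gmx oppr0 expR0 cos0 sin0; apply: mx2P; rewrite !mxE/=; ring.
- by move=> h; rewrite /= (_ : (fun _ => _) = fun=> 0); [exact: cvg_cst|apply/funext => u; rewrite glift0].
Qed.

Lemma is_derive_expRN h : is_derive h (1 : R) (fun h => expR (- h)) (- expR (- h)).
Proof.
have H := is_derive1_comp (is_derive_expR (- h)) (is_deriveN (is_derive_id h (1 : R))).
by apply: (is_derive_eq H); rewrite mulrN1.
Qed.

(** This is the diagonal subgroup conjugated to [exp(- s e^+) exp(h H) exp(s e^+)], where [H] is the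
    diagonal generator: right multiplication by it moves only the coordinate [t] of a point whose
    last coordinate is [s]. *)
Lemma one_parameter_h s : one_parameter_subgroup (mx2 1 (2 * s) 0 (-1))
  (fun h => iwasawa_el 0 h (s - s * expR (- (2 * h)))).
Proof.
rewrite (_ : mx2 1 (2 * s) 0 (-1) = expR 0 *: mx2 1 s 0 0 + (- expR (- 0)) *: mx2 0 (- s) 0 1); last first.
  by rewrite oppr0 expR0; apply: mx2P; rewrite !mxE/=; ring.
apply: (@one_parameter_of_cmat _ expR (fun h => expR (- h)) expR (fun h => - expR (- h))).
- move=> t t'; rewrite iwasawa_el_mul; congr iwasawa_el.
  by rewrite mulrDr opprD expRD; ring.
- move=> h; rewrite /= /gmx cos0 sin0.
  have -> : expR (- (2 * h)) = expR (- h) ^+ 2 by rewrite mulr_natl mulr2n opprD expRD expr2.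
  have E : expR h * expR (- h) = 1 by rewrite -expRD subrr expR0.
  move: (expR h) (expR (- h)) E => u v E.
  have K : u * v ^+ 2 = v by rewrite expr2 mulrA E mul1r.
  apply: mx2P; rewrite !mxE/=; [ring| |ring|ring].
  have -> : (s - s * v ^+ 2) * u = s * u - s * (u * v ^+ 2) by ring.
  by rewrite K; ring.
- exact: is_derive_expRN.
- by move=> h; rewrite /= (_ : (fun _ => _) = fun=> 0); [exact: cvg_cst|apply/funext => u; rewrite glift0].
Qed.

(** Conjugating the rotations by the triangular factor lets right multiplication act as a rotation
    inserted to the left of that factor, so that only the angle changes. *)
Lemma one_parameter_k t s : one_parameter_subgroup
  (mx2 (- s * expR (2 * t)) (- expR (- (2 * t)) - s ^+ 2 * expR (2 * t)) (expR (2 * t)) (s * expR (2 * t)))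
  (fun h => cmul (iwasawa_el 0 (- t) (- s * expR (2 * t))) (cmul (iwasawa_el h 0 0) (iwasawa_el 0 t s))).
Proof.
set b := iwasawa_el 0 t s; set b' := iwasawa_el 0 _ _.
have bb' : cmul b b' = cone R.
  rewrite iwasawa_el_mul subrr mulrN opprK mulNr addrC subrr; exact: gel1.
set J := mx2 _ _ _ _.
rewrite (_ : J = (- sin (0 : R)) *: mx2 1 0 0 1 + cos (0 : R) *: J); last first.
  by rewrite sin0 cos0 oppr0 scale0r scale1r add0r.
apply: (@one_parameter_of_cmat _ cos sin (fun h => - sin h) cos).
- move=> u v; rewrite -[iwasawa_el (u + v) 0 0]iwasawa_el_rotation.
  rewrite -!cmulA; congr cmul; congr cmul.
  by rewrite (cmulA b) bb' cmul1.
- move=> h; rewrite [cmat _]/= /b /b' /= /gmx cos0 sin0 !mx2M oppr0 expR0 opprK.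
  rewrite /J; have -> : expR (- (2 * t)) = expR (- t) ^+ 2 by rewrite mulr_natl mulr2n opprD expRD expr2.
  have -> : expR (2 * t) = expR t ^+ 2 by rewrite mulr_natl mulr2n expRD expr2.
  have E : expR t * expR (- t) - 1 = 0 by rewrite -expRD subrr expR0 subrr.
  move: (expR t) (expR (- t)) (cos h) (sin h) E => u v c d E.
  (* Each entry holds modulo the relation [u v = 1]; [z] is the cofactor of that relation. *)
  have Z (x y z : R) : x - y = (u * v - 1) * z -> x = y.
    by rewrite E mul0r => /eqP; rewrite subr_eq0 => /eqP.
  apply: mx2P; rewrite !mxE/=.
  - by apply: (Z _ _ (c - s * u ^+ 2 * d)); ring.
  - by apply: (Z _ _ (- (c * s * u * v) - s ^+ 2 * u ^+ 2 * d)); ring.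
  - by apply: (Z _ _ 0); ring.
  - by apply: (Z _ _ c); ring.
- move=> h; rewrite /= (_ : (fun _ => _) = (fun h => glift 0 (- t) (- s * expR (2 * t)) h)).
    exact: glift_continuous.
  by apply/funext => u; rewrite glift0; have := lift_rotation u 0 => /= ->; rewrite add0r.
Qed.

Definition group_point x : SL2cover R := iwasawa_el (x 0 (@Ordinal 3 0 isT)) (x 0 (@Ordinal 3 1 isT)) (x 0 (@Ordinal 3 2 isT)).

Lemma iwasawa_group_point x : iwasawa (group_point x) = x.
Proof.
by rewrite iwasawa_iwasawa_el; apply/rowP => -[[|[|[|]]]//= h]; rewrite mxE; congr (x _ _); exact/val_inj.
Qed.

(** The Lie algebra element whose left-invariant flow through [x] is the coordinate line [i] (see
    [direction_flow]). It depends on the point, which is why the coefficients [exp(p t) s^j] arise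
    in the iterated derivatives. *)
Definition direction x (i : 'I_3) : 'M[R]_2 :=
  let t := x 0 (@Ordinal 3 1 isT) in let s := x 0 (@Ordinal 3 2 isT) in
  match val i with
  | 0 => mx2 (- s * expR (2 * t)) (- expR (- (2 * t)) - s ^+ 2 * expR (2 * t)) (expR (2 * t)) (s * expR (2 * t))
  | 1 => mx2 1 (2 * s) 0 (-1)
  | _ => mx2 0 1 0 0
  end.

Lemma direction_flow x i : exists2 g, one_parameter_subgroup (direction x i) g &
  forall h, cmul (group_point x) (g h) = group_point (x + h *: delta_mx 0 i).
Proof.
rewrite /group_point; move: (erefl (x 0 (@Ordinal 3 0 isT))) (erefl (x 0 (@Ordinal 3 1 isT))) (erefl (x 0 (@Ordinal 3 2 isT))).
set th := x 0 (@Ordinal 3 0 isT); set t := x 0 (@Ordinal 3 1 isT); set s := x 0 (@Ordinal 3 2 isT).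
move=> _ _ _; case: i => [[|[|[|]]]//= hi].
- exists (fun h => cmul (iwasawa_el 0 (- t) (- s * expR (2 * t))) (cmul (iwasawa_el h 0 0) (iwasawa_el 0 t s))).
    exact: one_parameter_k.
  move=> h; rewrite cmulA iwasawa_el_mul subrr mulrN opprK mulNr addrC subrr cmulA.
  by rewrite iwasawa_el_rotation iwasawa_el_rotation !mxE/= mulr1 mulr0 !addr0.
- exists (fun h => iwasawa_el 0 h (s - s * expR (- (2 * h)))); first exact: one_parameter_h.
  by move=> h; rewrite iwasawa_el_mul subrK !mxE/= mulr1 mulr0 !addr0.
- exists (fun h => iwasawa_el 0 0 h); first exact: one_parameter_e.
  by move=> h; rewrite iwasawa_el_mul !mxE/= mulr1 !mulr0 !addr0 oppr0 expR0 mulr1 addrC.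
Qed.

Lemma one_parameter_J : one_parameter_subgroup (mx2 0 (-1) 1 0) (fun h => iwasawa_el h 0 0 : SL2cover R).
Proof.
have := one_parameter_k 0 0; rewrite mulr0 oppr0 expR0 !mulr1 expr0n/= subr0.
rewrite (_ : (fun h => _) = (fun h => iwasawa_el h 0 0))//.
apply/funext => h; rewrite gel1 cmul1.
by rewrite cmulg1.
Qed.

End OneParameter.

(** * The infinitesimal action on coefficients *)

Section OmegaFormula.
Variable R : realType.
Variables (S : {fset R}) (k : R -> R) (a : R).
Local Notation re := (@complex.Re R).
Local Notation im := (@complex.Im R).
Local Notation kap := (half_sum S k).
Local Notation w := (weight S k a).
Implicit Types (x : R) (f g : R -> R[i]).
Hypothesis S0 : 0 \notin S.
Hypothesis a0 : 0 < a.
Hypothesis hlam : -1 < lambda S k a 0.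

Definition wexp := a - 2 + 2 * kap.
Definition wcst := \prod_(α <- S) `|α| `^ k α.

Lemma wexp_gtN1 : -1 < wexp.
Proof.
have := hlam; rewrite /lambda mulr0 add0r ltr_pdivlMr// /wexp mulN1r.
by move: kap => y; lra.
Qed.

Lemma wcst_gt0 : 0 < wcst.
Proof.
rewrite /wcst big_seq; apply: prodr_gt0 => α αS; rewrite powR_gt0// normr_gt0.
by apply: contraNneq S0 => <-.
Qed.

Lemma weightE x : x != 0 -> w x = wcst * `|x| `^ wexp.
Proof.
move=> x0; have nx : 0 < `|x| by rewrite normr_gt0.
have pD (p q : R) : `|x| `^ (p + q) = `|x| `^ p * `|x| `^ q.
  by rewrite powRD//; apply/implyP => _; rewrite gt_eqF.
have E (s : seq R) : \prod_(α <- s) `|α * x| `^ k α =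
    (\prod_(α <- s) `|α| `^ k α) * `|x| `^ (\sum_(α <- s) k α).
  elim: s => [|α s IH]; first by rewrite !big_nil powRr0 mulr1.
  by rewrite !big_cons pD IH normrM powRM//; ring.
have K : 2 * kap = \sum_(α <- S) k α by rewrite /half_sum mulrA divff ?mul1r.
by rewrite /weight E /wexp K (pD (a - 2)) mulrCA.
Qed.

Lemma weight_ge0 x : 0 <= w x.
Proof. by rewrite mulr_ge0 ?powR_ge0// prodr_ge0// => α _; exact: powR_ge0. Qed.

Lemma measurable_weight : measurable_fun setT w.
Proof.
have mp (p : R) (f : R -> R) : measurable_fun setT f -> measurable_fun setT (fun x : R => `|f x| `^ p).
  move=> mf; apply: (measurableT_comp (measurable_powR _)).
  exact: (measurableT_comp (@normr_measurable R setT)).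
apply: measurable_funM; first exact: (mp (a - 2) id).
by apply: measurable_prod => α _; apply: (mp (k α) (fun x : R => α * x)); exact: measurable_funM.
Qed.

Lemma reflectionE α x : α \in S -> reflection α x = - x.
Proof.
move=> αS; have α0 : α != 0 by apply: contraNneq S0 => <-.
by rewrite /reflection; field.
Qed.

Lemma dunklE f x : x != 0 -> dunkl S k f x = (dunR kap (re \o f) x +i* dunR kap (im \o f) x)%C.
Proof.
move=> x0; have xC : x%:C%C != 0 by apply: contraNneq x0 => -[->].
rewrite /dunkl (_ : \sum_(α <- S) _ = (\sum_(α <- S) k α)%:C%C * ((x^-1)%:C%C * (f x - f (- x)))); last first.
  rewrite rmorph_sum mulr_suml !big_seq; apply: eq_bigr => α αS.
  have α0 : α != 0 by apply: contraNneq S0 => <-.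
  have αC : α%:C%C != 0 by apply: contraNneq α0 => -[->].
  rewrite reflectionE//; move: (f x) (f (- x)) => y z.
  by rewrite /= !(rmorphM, fmorphV); field; rewrite xC αC.
rewrite mulrA -rmorphM -/(half_sum S k); move: kap => K.
by apply: complexP; rewrite !(reD, imD, reM, imM, reB, imB)/= /dunR/=; move: (derive1 _ _) => d; field.
Qed.

Lemma dunR_ext (K : R) (f g : R -> R) x : x != 0 -> (forall y : R, y != 0 -> f y = g y) ->
  dunR K f x = dunR K g x.
Proof.
move=> x0 fg; rewrite /dunR !derive1E (@near_eq_derive _ _ _ f g); last first.
  by near=> y; apply: fg; near: y; exact: near_neq0.
by rewrite !fg// oppr_eq0.
Unshelve. all: by end_near.
Qed.

Lemma dunkl_laplacianE f x : x != 0 -> dunkl_laplacian S k f x =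
  (dunR kap (dunR kap (re \o f)) x +i* dunR kap (dunR kap (im \o f)) x)%C.
Proof.
move=> x0; rewrite /dunkl_laplacian dunklE//.
by congr (_ +i* _)%C; apply: dunR_ext => // y y0; rewrite /= dunklE.
Qed.

Definition cexp (c : (bool -> nat -> R) * (bool -> nat -> R)) x : R[i] :=
  (rexp a wexp c.1 x +i* rexp a wexp c.2 x)%C.

(** The pair holds the real and imaginary coefficients. [h] acts by a real operator; [e^+] and [e^-]
    carry a factor [i], so their combination [t], made of the triples in [rexp_p] and [rexp_q],
    exchanges the two components with a sign. *)
Definition act (X : 'M[R]_2) (c : (bool -> nat -> R) * (bool -> nat -> R)) :
    (bool -> nat -> R) * (bool -> nat -> R) :=
  let h := three_term a wexp 0 (X 0 0) (- X 0 0) in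
  let t := three_term a wexp ((X 0 1 - X 1 0) / 2) (- (X 0 1 + X 1 0) / 2) (- (X 0 1 + X 1 0) / 2) in
  (fun b l => h c.1 b l - t c.2 b l, fun b l => h c.2 b l + t c.1 b l).

Let s1 := wexp_gtN1.
Let cw0 := wcst_gt0.

Lemma rexpD c d : rapid2 c -> rapid2 d -> rexp a wexp (fun b l => c b l + d b l) = (fun x => rexp a wexp c x + rexp a wexp d x).
Proof.
move=> rc hd; have := rexp_lin a0 s1 cw0 weightE measurable_weight 1 rc hd.
rewrite (_ : (fun b l => 1 * c b l + d b l) = (fun b l => c b l + d b l)).
  by move=> ->; apply/funext => x; rewrite mul1r.
by apply/funext => b; apply/funext => l; rewrite mul1r.
Qed.

Lemma rexpZ r c : rapid2 c -> rexp a wexp (fun b l => r * c b l) = (fun x => r * rexp a wexp c x).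
Proof.
move=> rc; have z0 : @rapid2 R (fun _ _ => 0) by apply: (@finite_coefs_rapid2 _ 0).
have := rexp_lin a0 s1 cw0 weightE measurable_weight r rc z0.
rewrite (_ : (fun b l => r * c b l + 0) = (fun b l => r * c b l)); last first.
  by apply/funext => b; apply/funext => l; rewrite addr0.
move=> ->; apply/funext => x; rewrite (_ : rexp a wexp (fun _ _ => 0) x = 0) ?addr0//.
rewrite (@rexp_finite_coefs _ a wexp 0)// /Usum !big_ord0; ring.
Qed.

Lemma rapid2D c d : @rapid2 R c -> rapid2 d -> rapid2 (fun b l => c b l + d b l).
Proof.
move=> hc hd b P; have [C hC] := hc b P; have [D hD] := hd b P; exists (C + D) => l.
apply: le_trans (lerD (hC l) (hD l)); rewrite -mulrDl ler_wpM2r ?exprn_ge0//.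
exact: ler_normD.
Qed.

Lemma rapid2Z r c : @rapid2 R c -> rapid2 (fun b l => r * c b l).
Proof.
move=> hc b P; have [C hC] := hc b P; exists (`|r| * C) => l.
by rewrite normrM -mulrA ler_wpM2l.
Qed.

Lemma omega_cexp n c X x : finite_coefs n c.1 -> finite_coefs n c.2 -> x != 0 ->
  omega S k a X (cexp c) x = cexp (act X c) x.
Proof.
case: c => c d /= fc fd x0.
have sE : wexp = a - 2 + 2 * kap by [].
have rc := finite_coefs_rapid2 fc; have rapid := finite_coefs_rapid2 fd.
have lr al be ga e : rapid2 e -> rapid2 (three_term a wexp al be ga e) by exact: three_term_rapid2.
pose h := three_term a wexp 0 1 (-1); pose p := three_term a wexp 2^-1 (- 2^-1) (- 2^-1).
pose q := three_term a wexp (- 2^-1) (- 2^-1) (- 2^-1).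
have comb (r1 r2 r3 : R) (e1 e2 e3 : bool -> nat -> R) : rapid2 e1 -> rapid2 e2 -> rapid2 e3 ->
   rexp a wexp (fun b l => r1 * e1 b l + (r2 * e2 b l + r3 * e3 b l)) x =
   r1 * rexp a wexp e1 x + (r2 * rexp a wexp e2 x + r3 * rexp a wexp e3 x).
  move=> h1 h2 h3; have z1 := rapid2Z r1 h1; have z2 := rapid2Z r2 h2; have z3 := rapid2Z r3 h3.
  by rewrite (rexpD z1 (rapid2D z2 z3)) (rexpD z2 z3) !rexpZ.
have E1 : rexp a wexp (act X (c, d)).1 x = X 0 0 * rexp a wexp (h c) x +
    ((- X 0 1) * rexp a wexp (p d) x + (- X 1 0) * rexp a wexp (q d) x).
  rewrite -comb; [|exact: lr..]; congr (rexp a wexp _ x).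
  by apply/funext => b; apply/funext => l; rewrite /= /h /p /q /three_term; field.
have E2 : rexp a wexp (act X (c, d)).2 x = X 0 0 * rexp a wexp (h d) x +
    (X 0 1 * rexp a wexp (p c) x + X 1 0 * rexp a wexp (q c) x).
  rewrite -comb; [|exact: lr..]; congr (rexp a wexp _ x).
  by apply/funext => b; apply/funext => l; rewrite /= /h /p /q /three_term; field.
rewrite /cexp E1 E2 /h /p /q.
rewrite -!(rexp_h a0 sE fc x0) -!(rexp_h a0 sE fd x0).
rewrite -!(rexp_p wexp a0 x fc) -!(rexp_p wexp a0 x fd).
rewrite -!(rexp_q a0 sE fc x0) -!(rexp_q a0 sE fd x0).
rewrite /omega /omega_h /omega_eplus /omega_eminus dunkl_laplacianE// /cderive.
rewrite (_ : (fun y => re _) = rexp a wexp c)// (_ : (fun y => im _) = rexp a wexp d)//.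
rewrite (_ : re \o cexp (c, d) = rexp a wexp c)// (_ : im \o cexp (c, d) = rexp a wexp d)//.
move: (dunR _ _ _) (dunR _ _ _) (derive1 _ _) (derive1 _ _) => *.
apply: complexP; rewrite !(reD, imD, reM, imM)/=.
  by move: (rexp a wexp c x) (rexp a wexp d x) => *; rewrite (addrAC _ a 1); ring.
by move: (rexp a wexp c x) (rexp a wexp d x) => *; ring.
Qed.

Lemma Gamma_gt0 (r : R) : 0 < r -> 0 < Gamma r.
Proof.
move=> r0; have r1 : -1 < r - 1 by move: r0; lra.
(* For [a = 1] the function [phi 0 0 (tau 1 x)] is [exp(- x)]. *)
have h := fast_decay_integrable_pos_pow ltr01 r1 (fast_decay_dphi 0 0 0) (measurable_comp_tau 1 (measurable_dphi 0 0 0)).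
apply: integral_pos_gt0; last by move=> x x0; rewrite mulr_gt0 ?powR_gt0 ?expR_gt0.
apply: eq_integrable_pos h => x x0; rewrite /dphi /phi -laguerreE /laguerre big_ord1 /= gbinom0 fact0 expr0.
by rewrite /tau powRr1 ?(ltW x0)// !divr1 !mulr1 mul1r (mulrC 2) mulfK// mulrC.
Qed.

Definition radial_cst (m l : nat) : R := let lam := lambda S k a m in
  Num.sqrt (2 `^ (lam + 1) * Gamma (l%:R + 1) / (a `^ lam * Gamma (lam + l%:R + 1))).

Lemma radial_cst_gt0 m l : 0 < radial_cst m l.
Proof.
have hm : -1 < lambda S k a m.
  apply: lt_le_trans hlam _; rewrite /lambda ler_wpM2r ?invr_ge0 ?(ltW a0)//.
  by rewrite mulr0 -!addrA lerD2r mulr_ge0.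
have l0 : 0 <= l%:R :> R by [].
rewrite sqrtr_gt0 divr_gt0 ?mulr_gt0 ?powR_gt0 ?Gamma_gt0//; by lra.
Qed.

Lemma lambda_bool b : lambda S k a (nat_of_bool b) = lm a wexp b.
Proof. by rewrite (lmE a0 (erefl wexp)) /lambda; case: b => /=; congr (_ / _); ring. Qed.

Lemma radialE b l (r : R) : radial S k a (nat_of_bool b) l r =
  radial_cst b l * r ^+ nat_of_bool b * phi (lm a wexp b) l (tau a r).
Proof.
rewrite /radial -/(radial_cst b l) -mulrA laguerreE lambda_bool; congr (_ * (_ * expR (- _))).
by rewrite /tau; field; rewrite gt_eqF.
Qed.

Lemma W_cexp n c : finite_coefs n c.1 -> finite_coefs n c.2 -> W S k a (cexp c).
Proof.
case: c => c d /= fc fd.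
pose K b l : R[i] := ((radial_cst (nat_of_bool b) l)^-1)%:C%C * (c b l +i* d b l)%C.
pose p m l (y : R) : R[i] := if m is m'.+1 then if m' is 0 then K true l * y%:C%C else 0 else K false l.
have fS (e : bool -> nat -> R) : finite_coefs n e -> finite_coefs n.+2 e by move=> fe b l nl; apply: fe; apply: leq_trans nl; do 2 apply: leqW.
(* In [W] one bound serves for both the degree and the radial index, and the degrees 0 and 1 must
   occur; the polynomials of higher degree are taken to be 0. *)
exists n.+2, p; split.
  move=> [|[|m]] l.
  - exists (K false l)%:P; split; [by case=> // j _; rewrite coefC|move=> x x0|by move=> y _; rewrite hornerC].
    rewrite dunkl_laplacianE//.
    have z (r : R) y : dunR kap (fun=> r) y = 0.
      by rewrite /dunR derive1_cst subrr mulr0 mul0r addr0.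
    rewrite (_ : re \o _ = fun=> re (K false l)); last by apply/funext => y; rewrite /= hornerC.
    rewrite (_ : im \o _ = fun=> im (K false l)); last by apply/funext => y; rewrite /= hornerC.
    rewrite (_ : dunR kap (fun=> re _) = fun=> 0); last by apply/funext => y; exact: z.
    by rewrite (_ : dunR kap (fun=> im _) = fun=> 0) ?z//; apply/funext => y; exact: z.
  - exists (K true l *: 'X); split; [|move=> x x0|by move=> y _; rewrite hornerZ hornerX].
      by move=> j j1; rewrite coefZ coefX (negbTE j1) mulr0.
    rewrite dunkl_laplacianE//.
    have z (r : R) : dunR kap (dunR kap (fun y => r * y)) x = 0.
      rewrite (@dunR_ext _ _ (fun=> r * (1 + 2 * kap)))//.
        by rewrite /dunR derive1_cst subrr mulr0 mul0r addr0.
      move=> y y0; have H := is_deriveZ r (is_derive_id y (1 : R)).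
      have {}H : is_derive y (1 : R) (fun y => r * y) r.
        by apply: (is_derive_eq H); rewrite /GRing.scale/= mulr1.
      by rewrite (dunR_derive _ H)/=; move: (half_sum S k) => q; field.
    rewrite (_ : re \o _ = fun y => re (K true l) * y).
      rewrite (_ : im \o _ = fun y => im (K true l) * y); first by rewrite !z.
      by apply/funext => y; rewrite /= hornerZ hornerX imM /= mulr0 add0r.
    by apply/funext => y; rewrite /= hornerZ hornerX reM /= mulr0 subr0.
  - exists 0; split; [by move=> j _; rewrite coef0|move=> x x0|by move=> y _; rewrite horner0].
    rewrite dunkl_laplacianE//.
    have z y : dunR kap (fun=> 0) y = 0.
      by rewrite /dunR derive1_cst subrr mulr0 mul0r addr0.
    have zz : dunR kap (fun=> 0) = fun=> 0 by apply/funext => y; exact: z.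
    rewrite (_ : re \o _ = fun=> 0); last by apply/funext => y; rewrite /= horner0.
    by rewrite (_ : im \o _ = fun=> 0) ?zz ?z//; apply/funext => y; rewrite /= horner0.
apply/funext => x.
have rn b l : radial_cst (nat_of_bool b) l != 0 by rewrite gt_eqF// radial_cst_gt0.
pose ph b l := phi (lm a wexp b) l (tau a `|x|).
have A0 l : polar_tensor (p 0%N l) (radial S k a 0 l) x =
    Complex (c false l * ph false l) (d false l * ph false l).
  rewrite /polar_tensor (radialE false) expr0 mulr1 /p /K -/(ph false l).
  have := rn false l; move: (radial_cst _ _) (ph _ _) => r q r0.
  by apply: complexP; rewrite !(reM, imM)/=; field.
have A1 l : polar_tensor (p 1%N l) (radial S k a 1 l) x =
    Complex (x * (c true l * ph true l)) (x * (d true l * ph true l)).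
  rewrite /polar_tensor (radialE true) expr1 /p /K -/(ph true l).
  have := rn true l; move: (radial_cst _ _) (ph _ _) => r q r0.
  (* At 0 the angular argument [x / |x|] is 0, and so are both sides. *)
  have [->|x0] := eqVneq x 0.
    by apply: complexP; rewrite !(reM, imM)/= !mul0r !mulr0 ?mul0r; ring.
  have nx : `|x| != 0 by rewrite normr_eq0.
  by apply: complexP; rewrite !(reM, imM)/=; field; rewrite r0 nx.
rewrite big_ord_recl big_ord_recl /= [X in _ + (_ + X)]big1; last first.
  by move=> m _; apply: big1 => l _; rewrite /polar_tensor mul0r.
rewrite addr0; under eq_bigr do rewrite A0; under [X in _ + X]eq_bigr do rewrite A1.
have reS (F : 'I_n.+2 -> R[i]) : re (\sum_l F l) = \sum_l re (F l) by exact: (big_morph _ (@reD R) erefl).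
have imS (F : 'I_n.+2 -> R[i]) : im (\sum_l F l) = \sum_l im (F l) by exact: (big_morph _ (@imD R) erefl).
rewrite /cexp (rexp_finite_coefs a wexp x (fS _ fc)) (rexp_finite_coefs a wexp x (fS _ fd)) !Usum0 !mulr_sumr.
by apply: complexP; rewrite !(reD, imD) !(reS, imS)/=.
Qed.

End OmegaFormula.

Lemma cvLP (R : realType) (w : R -> R) (w0 : forall x, 0 <= w x) (T : Type) (A : set_system T)
    {FA : Filter A} (F : T -> R -> R[i]) (f : R -> R[i]) :
  cvL w A F f <-> forall e : R, 0 < e -> \forall t \near A, norm2 w (F t \- f) < e.
Proof.
have n0 t : `|0 - norm2 w (F t \- f)| = norm2 w (F t \- f).
  by rewrite sub0r normrN ger0_norm// norm2_ge0.
rewrite /cvL; split => [/cvgrPdist_lt H e e0|H].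
  by apply: filterS (H e e0) => t; rewrite n0.
by apply/cvgrPdist_lt => e e0; apply: filterS (H e e0) => t; rewrite n0.
Qed.

(** * Smooth vectors *)

Section OmegaSmooth.
Variable R : realType.
Variables (S : {fset R}) (k : R -> R) (a : R).
Local Notation re := (@complex.Re R).
Local Notation im := (@complex.Im R).
Local Notation w := (weight S k a).
Local Notation mu := (@lebesgue_measure R).
Implicit Types (x h : R) (f : R -> R[i]).
Hypothesis S0 : 0 \notin S.
Hypothesis a0 : 0 < a.
Hypothesis hlam : -1 < lambda S k a 0.
Variable Ω : SL2cover R -> (R -> R[i]) -> R -> R[i].
Hypothesis hU : unitary_representation w Ω.
Hypothesis integral_pos0 : forall (X : 'M[R]_2) f, \tr X = 0 -> W S k a f ->
  infinitesimal_action w Ω X f (omega S k a X f).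

Let s1 := wexp_gtN1 a0 hlam.
Let cw0 := @wcst_gt0 R S k S0.
Let wE := @weightE R S k a.
Let w0 : forall x, 0 <= w x := @weight_ge0 R S k a.
Let mw := @measurable_weight R S k a.
Local Notation norm2 := (norm2 w).
Local Notation inner := (inner w).
Local Notation E := (cexp S k a).
Local Notation A := (act S k a).
Local Notation coefs := ((bool -> nat -> R) * (bool -> nat -> R))%type.

(** * Coefficient seminorms and truncation *)

Definition good (c : coefs) := rapid2 c.1 /\ rapid2 c.2.
Definition coef_le2 P M (c : coefs) := coef_le P M c.1 /\ coef_le P M c.2.
Definition finite_coefs2 n (c : coefs) := finite_coefs n c.1 /\ finite_coefs n c.2.
Definition subc (c d : coefs) : coefs := (fun b l => c.1 b l - d.1 b l, fun b l => c.2 b l - d.2 b l).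
Definition trunc n (c : coefs) : coefs :=
  (fun b l => if (l < n)%N then c.1 b l else 0, fun b l => if (l < n)%N then c.2 b l else 0).

Lemma good_coef_le2 c P : good c -> exists M, coef_le2 P M c.
Proof.
move=> [h1 h2]; have [M hM] := rapid2_coef_le P h1; have [N hN] := rapid2_coef_le P h2.
by exists (Num.max M N); split=> b l; rewrite le_max ?hM ?hN ?orbT.
Qed.

Lemma finite_coefs2_good n c : finite_coefs2 n c -> good c.
Proof. by move=> [h1 h2]; split; apply: finite_coefs_rapid2; eassumption. Qed.

Lemma finite_coefs2_trunc n c : finite_coefs2 n (trunc n c).
Proof. by split=> b l; rewrite leqNgt => /negbTE /= ->. Qed.

Lemma coef_le2_trunc P M n c : coef_le2 P M c -> coef_le2 P M (trunc n c).
Proof.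
move=> [h1 h2]; split=> b l /=; case: ifP => // _; rewrite normr0 mul0r.
- exact: (coef_le_ge0 h1).
- exact: (coef_le_ge0 h2).
Qed.

(** On the tail one power of [l + 1] is traded for the factor [1 / (n + 1)]. *)
Lemma coef_le2_tail P M n c : coef_le2 P.+1 M c -> coef_le2 P (M / n.+1%:R) (subc c (trunc n c)).
Proof.
have H (e : bool -> nat -> R) : coef_le P.+1 M e -> coef_le P (M / n.+1%:R) (fun b l => e b l - (if (l < n)%N then e b l else 0)).
  move=> he b l; have M0 := coef_le_ge0 he; case: ltnP => ln.
    by rewrite subrr normr0 mul0r divr_ge0.
  rewrite subr0 ler_pdivlMr//; apply: le_trans (he b l).
  by rewrite exprSr mulrA ler_wpM2l ?mulr_ge0 ?exprn_ge0// ler_nat.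
by move=> [h1 h2]; split; exact: H.
Qed.

Lemma good_sub c d : good c -> good d -> good (subc c d).
Proof.
have H (e e' : bool -> nat -> R) : rapid2 e -> rapid2 e' -> rapid2 (fun b l => e b l - e' b l).
  move=> he he'; have := rapid2D he (rapid2Z (-1) he').
  rewrite (_ : (fun b l => _) = (fun b l => e b l - e' b l))//.
  by apply/funext => b; apply/funext => l; rewrite mulN1r.
by move=> [h1 h2] [h3 h4]; split; exact: H.
Qed.

Lemma cexp_sub c d : good c -> good d -> E (subc c d) = E c \- E d.
Proof.
have H (e e' : bool -> nat -> R) x : rapid2 e -> rapid2 e' ->
    rexp a (wexp S k a) (fun b l => e b l - e' b l) x = rexp a (wexp S k a) e x - rexp a (wexp S k a) e' x.
  move=> he he'; have := rexpD S0 a0 hlam he (rapid2Z (-1) he').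
  rewrite (rexpZ S0 a0 hlam (-1) he') (_ : (fun b l => e b l + -1 * e' b l) = (fun b l => e b l - e' b l)).
    by move=> ->; rewrite mulN1r.
  by apply/funext => b; apply/funext => l; rewrite mulN1r.
by move=> [h1 h2] [h3 h4]; apply/funext => x; apply: complexP; rewrite /= ?reB ?imB /cexp /= H.
Qed.

Lemma cexp_memL2 c : good c -> memL2 w (E c).
Proof.
move=> [h1 h2]; apply/(memL2P w0 mw); split.
- exact: (rexp_real_L2 a0 s1 cw0 wE mw h1).
- exact: (rexp_real_L2 a0 s1 cw0 wE mw h2).
Qed.

Lemma cexp_bound : exists (C : R) (P : nat), 0 <= C /\
  forall c M, good c -> coef_le2 P M c -> norm2 (E c) <= C * M ^+ 2.
Proof.
have [C [P [C0 H]]] := rexp_normal a0 s1 cw0 wE mw.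
exists (2 * C), P; split; first by rewrite mulr_ge0.
move=> c M gc [h1 h2]; have [_ [m1 l1] b1] := H _ _ h1; have [_ [m2 l2] b2] := H _ _ h2.
have -> : norm2 (E c) = integral_line (fun x => rexp a (wexp S k a) c.1 x ^+ 2 * w x) + integral_line (fun x => rexp a (wexp S k a) c.2 x ^+ 2 * w x).
  rewrite -integral_lineD//; congr integral_line; apply/funext => x.
  by rewrite /inner_density /cexp/= mulrDl !expr2.
by rewrite -mulrA mulr_natl mulr2n lerD.
Qed.

Lemma act_bound X P : exists K, 0 <= K /\ forall c M, coef_le2 P.+1 M c -> coef_le2 P (K * M) (A X c).
Proof.
have [K [K0 HK]] := three_term_coef_le a (wexp S k a) P 0 (X 0 0) (- X 0 0).
have [L [L0 HL]] := three_term_coef_le a (wexp S k a) P ((X 0 1 - X 1 0) / 2) (- (X 0 1 + X 1 0) / 2) (- (X 0 1 + X 1 0) / 2).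
exists (K + L); split; first exact: addr_ge0.
move=> c M [h1 h2]; split=> b l; rewrite mulrDl /act/=.
- apply: le_trans (lerD (HK _ _ h1 b l) (HL _ _ h2 b l)).
  by rewrite -mulrDl ler_wpM2r ?exprn_ge0// ler_normB.
- apply: le_trans (lerD (HK _ _ h2 b l) (HL _ _ h1 b l)).
  by rewrite -mulrDl ler_wpM2r ?exprn_ge0// ler_normD.
Qed.

Lemma act_good X c : good c -> good (A X c).
Proof.
move=> gc; have H P : exists M, coef_le2 P M (A X c).
  have [K [_ HK]] := act_bound X P; have [M hM] := good_coef_le2 P.+1 gc.
  by exists (K * M); exact: HK.
by split; apply: coef_le_rapid2 => P; have [M [h1 h2]] := H P; exists M.
Qed.

Lemma act_sub X c d : A X (subc c d) = subc (A X c) (A X d).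
Proof.
by congr pair; apply/funext => b; apply/funext => l; rewrite /= /three_term; ring.
Qed.

(** The formula for [omega] divides by [x], so it can be compared with an expansion only off 0;
    changing one value affects neither measurability nor the norm. *)
Lemma memL2_off0 f g : memL2 w g -> (forall x, x != 0 -> f x = g x) -> memL2 w f.
Proof.
move=> [mr mi lg] fg.
have meas (p : R[i] -> R) : measurable_fun setT (fun x => p (g x)) -> measurable_fun setT (fun x => p (f x)).
  move=> mp; rewrite (_ : (fun x => p (f x)) = (fun x => if x == 0 then p (f 0) else p (g x))).
    by apply: measurable_fun_ifT => //; exact: (@measurable_fun_eqr _ _ R setT id (cst 0)).
  by apply/funext => x; case: eqP => [->//|/eqP x0]; rewrite fg.
have mf1 := meas _ mr; have mf2 := meas _ mi; split => //.
rewrite /L2sq (@ge0_ae_eq_integral _ _ _ mu setT _ (fun x => ((re (g x) ^+ 2 + im (g x) ^+ 2) * w x)%:E))//.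
- by apply/measurable_EFinP; apply: measurable_funM => //; apply: measurable_funD; exact: measurable_funX.
- by apply/measurable_EFinP; apply: measurable_funM => //; apply: measurable_funD; exact: measurable_funX.
- by move=> x _; rewrite lee_fin; apply: mulr_ge0 => //; apply: addr_ge0; exact: sqr_ge0.
- by move=> x _; rewrite lee_fin; apply: mulr_ge0 => //; apply: addr_ge0; exact: sqr_ge0.
- by apply: ae_mono (@ae_neq0 R) => x x0 _; rewrite fg.
Qed.

Lemma Omega_mem g f : memL2 w f -> memL2 w (Ω g f).
Proof. by case: hU => -[h _ _ _] _ _ _; exact: h. Qed.

Lemma Omega_sub g f f' : memL2 w f -> memL2 w f' -> aeeq (Ω g (f \- f')) (Ω g f \- Ω g f').
Proof.
case: hU => -[_ h _ _] _ _ _ hf hf'; have := h g (-1) f' f hf' hf.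
rewrite (_ : (fun x => -1 * f' x + f x) = f \- f'); last by apply/funext => x /=; ring.
rewrite (_ : (fun x => -1 * Ω g f' x + Ω g f x) = Ω g f \- Ω g f')//.
by apply/funext => x /=; ring.
Qed.

Lemma Omega_norm2 g f : memL2 w f -> norm2 (Ω g f) = norm2 f.
Proof.
move=> hf; have hg := Omega_mem g hf; case: hU => -[_ _ h _] _ _ _; have := h g f hf.
by rewrite !(L2sqE w0 mw)// => -[].
Qed.

Lemma Omega_mul g g' f : memL2 w f -> aeeq (Ω (cmul g g') f) (Ω g (Ω g' f)).
Proof. by case: hU => _ _ h2 _; exact: h2. Qed.

Definition increment (ga : R -> SL2cover R) f h := Ω (ga h) f \- f.
Definition diff_quot (ga : R -> SL2cover R) f h := cscale (h^-1)%:C%C (increment ga f h).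

Lemma increment_mem ga f h : memL2 w f -> memL2 w (increment ga f h).
Proof. by move=> hf; apply: memL2B => //; exact: Omega_mem. Qed.

Lemma diff_quot_mem ga f h : memL2 w f -> memL2 w (diff_quot ga f h).
Proof. by move=> hf; apply: memL2Z => //; exact: increment_mem. Qed.

Lemma norm2_diff_quot ga f h : h != 0 -> memL2 w f -> norm2 (increment ga f h) = h ^+ 2 * norm2 (diff_quot ga f h).
Proof.
move=> h0 hf; rewrite (norm2Z w0 mw _ (increment_mem ga h hf)) mulrA -exprMn divff// expr1n mul1r//.
Qed.

(* Unitarity: [Omega(2h) f - f = Omega(h) (Omega(h) f - f) + (Omega(h) f - f)]. *)
Lemma increment_double ga f h : (forall s t, ga (s + t) = cmul (ga s) (ga t)) -> memL2 w f ->
  norm2 (increment ga f (h + h)) <= 4 * norm2 (increment ga f h).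
Proof.
move=> gM hf; have m1 := increment_mem ga h hf; have m2 := Omega_mem (ga h) m1.
rewrite (@norm2_ae _ w w0 mw _ (Ω (ga h) (increment ga f h) \+ increment ga f h)).
- apply: le_trans (norm2D_le w0 mw m2 m1) _; rewrite (Omega_norm2 _ m1).
  by move: (norm2 _) => q; lra.
- exact: increment_mem.
- exact: memL2D.
- rewrite /increment gM; have h1 := Omega_mul (ga h) (ga h) hf.
  have h2 := Omega_sub (ga h) (Omega_mem (ga h) hf) hf.
  by apply: ae_mono (ae_and h1 h2) => x [/= -> ->]; ring.
Qed.

(* Halving [h] repeatedly and using the derivative at 0. *)
Lemma diff_quot_limit ga f f' : (forall s t, ga (s + t) = cmul (ga s) (ga t)) -> memL2 w f -> memL2 w f' ->
  cvL w 0^' (diff_quot ga f) f' -> forall h, h != 0 -> norm2 (increment ga f h) <= 2 * h ^+ 2 * norm2 f'.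
Proof.
move=> gM hf hf' lim h h0.
have D n : norm2 (increment ga f h) <= 4 ^+ n * norm2 (increment ga f (h / 2 ^+ n)).
  elim: n => [|n IH]; first by rewrite !expr0 mul1r divr1.
  apply: le_trans IH _; rewrite exprSr -mulrA ler_wpM2l ?exprn_ge0//.
  apply: le_trans (increment_double _ gM hf); rewrite (_ : _ + _ = h / 2 ^+ n)//.
  by rewrite exprSr; field; rewrite expf_neq0.
have Q n : norm2 (increment ga f h) <= h ^+ 2 * norm2 (diff_quot ga f (h / 2 ^+ n)).
  apply: le_trans (D n) _; rewrite norm2_diff_quot ?mulf_neq0 ?invr_eq0 ?expf_neq0//.
  rewrite mulrA ler_wpM2r ?norm2_ge0// expr_div_n -exprM mulnC exprM (_ : 2 ^+ 2 = 4 :> R); last by ring.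
  by rewrite mulrCA divff ?mulr1// expf_neq0.
apply/ler_addgt0Pr => e e0.
have h2 : 0 < h ^+ 2 by rewrite exprn_even_gt0.
have e1 : 0 < e / (2 * h ^+ 2) by rewrite divr_gt0// mulr_gt0.
have /cvgrPdist_lt/(_ _ e1) [d /= d0 Hd] := lim.
have [n hn] : exists n, `|h| / 2 ^+ n < d.
  exists (Num.bound (`|h| / d)).
  have := archi_boundP (divr_ge0 (normr_ge0 h) (ltW d0)); set n := Num.bound _ => hn.
  rewrite ltr_pdivrMr ?exprn_gt0// mulrC -ltr_pdivrMr//; apply: lt_le_trans hn _.
  by rewrite -natrX ler_nat ltnW// ltn_expl.
have hz : h / 2 ^+ n != 0 by rewrite mulf_neq0 ?invr_eq0 ?expf_neq0.
have hb : ball_ Num.norm (0 : R) d (h / 2 ^+ n).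
  by rewrite /= sub0r normrN normrM normfV [X in _ / X]ger0_norm// exprn_ge0.
have := Hd _ hb hz; rewrite sub0r normrN ger0_norm ?norm2_ge0// => H.
apply: le_trans (Q n) _.
have mq := diff_quot_mem ga (h / 2 ^+ n) hf.
have : norm2 (diff_quot ga f (h / 2 ^+ n)) <= 2 * norm2 (diff_quot ga f (h / 2 ^+ n) \- f') + 2 * norm2 f'.
  apply: le_trans (norm2D_le w0 mw (memL2B w0 mw mq hf') hf').
  by rewrite (_ : (_ \- _) \+ _ = diff_quot ga f (h / 2 ^+ n))//; apply/funext => x /=; rewrite subrK.
move=> /(ler_wpM2l (ltW h2))/le_trans; apply.
rewrite (_ : _ * (_ + _) = 2 * h ^+ 2 * norm2 f' + 2 * h ^+ 2 * norm2 (diff_quot ga f (h / 2 ^+ n) \- f')); last by move: (norm2 _) (norm2 _) => *; ring.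
by rewrite lerD2l mulrC -ler_pdivlMr; [exact: ltW|exact: mulr_gt0].
Qed.

Lemma infinitesimal_finite_coefs X ga n c : \tr X = 0 -> one_parameter_subgroup X ga -> finite_coefs2 n c ->
  cvL w 0^' (diff_quot ga (E c)) (E (A X c)).
Proof.
move=> tX og fc; have gc := finite_coefs2_good fc; have ga' := act_good X gc.
have mE := cexp_memL2 gc; have mA := cexp_memL2 ga'.
have Ex x : x != 0 -> omega S k a X (E c) x = E (A X c) x.
  by move=> x0; case: fc => f1 f2; exact: (omega_cexp S0 a0 hlam X f1 f2 x0).
have mo := memL2_off0 mA Ex.
have := integral_pos0 tX (W_cexp S0 a0 hlam (proj1 fc) (proj2 fc)) og.
move=> /(L2cvgP w0 mw (fun t => diff_quot_mem ga t mE) mo).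
rewrite /cvL (_ : (fun t => norm2 (diff_quot ga (E c) t \- omega S k a X (E c))) =
   (fun t => norm2 (diff_quot ga (E c) t \- E (A X c))))//.
apply/funext => t; apply: (norm2_ae w0 mw).
- by apply: memL2B => //; exact: diff_quot_mem.
- by apply: memL2B => //; exact: diff_quot_mem.
- by apply: ae_mono (@ae_neq0 R) => x x0 /=; rewrite Ex.
Qed.

Lemma increment_sub ga f f' h : memL2 w f -> memL2 w f' ->
  aeeq (increment ga (f \- f') h) (increment ga f h \- increment ga f' h).
Proof.
by move=> hf hf'; apply: ae_mono (Omega_sub (ga h) hf hf') => x; rewrite /increment /= => ->; ring.
Qed.

Lemma increment_le ga f h : memL2 w f -> norm2 (increment ga f h) <= 4 * norm2 f.
Proof.
move=> hf; apply: le_trans (norm2B_le w0 mw (Omega_mem (ga h) hf) hf) _.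
by rewrite (Omega_norm2 _ hf); move: (norm2 f) => q; lra.
Qed.

Lemma small_inv (C e : R) : 0 <= C -> 0 < e -> exists n, C / n.+1%:R ^+ 2 < e.
Proof.
move=> C0 e0; exists (Num.bound (C / e)).
have := archi_boundP (divr_ge0 C0 (ltW e0)); set n := Num.bound _ => hn.
rewrite ltr_pdivrMr ?exprn_gt0// mulrC -ltr_pdivrMr//; apply: lt_le_trans hn _.
by rewrite -natrX ler_nat (leq_trans (leqnSn n))// leq_pmulr.
Qed.

(** With [h] fixed, the truncation satisfies [diff_quot_limit], uniformly in [n] because truncating
    does not increase seminorms. The increment of the tail is at most [4 norm2] of the tail, which
    is arbitrarily small. *)
Lemma increment_bound X : \tr X = 0 -> exists (C : R) (P : nat), 0 <= C /\ forall ga c M h, h != 0 ->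
  one_parameter_subgroup X ga -> good c -> coef_le2 P M c -> norm2 (increment ga (E c) h) <= C * M ^+ 2 * h ^+ 2.
Proof.
move=> tX; have [C [P [C0 HC]]] := cexp_bound; have [K [K0 HK]] := act_bound X P.
exists (4 * C * K ^+ 2), P.+1; split; first by rewrite !mulr_ge0// sqr_ge0.
move=> ga c M h h0 og gc bc.
apply/ler_addgt0Pr => e e0.
have C1 : 0 <= 8 * C * M ^+ 2 by apply: mulr_ge0; [exact: mulr_ge0|exact: sqr_ge0].
have [n hn] := small_inv C1 e0.
have fn := finite_coefs2_trunc n c; have gn := finite_coefs2_good fn; have gd := good_sub gc gn.
have mE := cexp_memL2 gc; have mn := cexp_memL2 gn; have md := cexp_memL2 gd.
have hlim := infinitesimal_finite_coefs tX og fn.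
have gM : forall s t, ga (s + t) = cmul (ga s) (ga t) by case: og.
have b1 := diff_quot_limit gM mn (cexp_memL2 (act_good X gn)) hlim h0.
have b2 := HC _ _ (act_good X gn) (HK _ _ (coef_le2_trunc n bc)).
have b3 := increment_le ga h md.
have b4 := HC _ _ gd (coef_le2_tail n bc).
have ae : aeeq (increment ga (E c) h) (increment ga (E (trunc n c)) h \+ increment ga (E (subc c (trunc n c))) h).
  rewrite cexp_sub//; apply: ae_mono (increment_sub ga h mE mn) => x /= ->; ring.
rewrite (norm2_ae w0 mw (increment_mem ga h mE) (memL2D w0 mw (increment_mem ga h mn) (increment_mem ga h md)) ae).
apply: le_trans (norm2D_le w0 mw (increment_mem ga h mn) (increment_mem ga h md)) _.
apply: lerD.
  apply: le_trans (_ : 2 * (2 * h ^+ 2 * (C * (K * M) ^+ 2)) <= _); last first.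
    by rewrite le_eqVlt; apply/orP; left; apply/eqP; ring.
  by rewrite ler_wpM2l// (le_trans b1)// ler_wpM2l// mulr_ge0// sqr_ge0.
apply: le_trans (ltW hn).
apply: le_trans (_ : 2 * (4 * (C * (M / n.+1%:R) ^+ 2)) <= _); last first.
  by rewrite le_eqVlt; apply/orP; left; apply/eqP; rewrite expr_div_n; move: (_ ^- 2) => q; ring.
by rewrite ler_wpM2l// (le_trans b3)// ler_wpM2l.
Qed.

(** By [increment_bound] the difference quotients of the tail are small uniformly in [h]. So the
    truncation is chosen first, and its known derivative then determines how small [h] must be. *)
Lemma infinitesimal_good X ga c : \tr X = 0 -> one_parameter_subgroup X ga -> good c ->
  cvL w 0^' (diff_quot ga (E c)) (E (A X c)).
Proof.
move=> tX og gc.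
have [C1 [P1 [C10 H1]]] := increment_bound tX; have [C2 [P2 [C20 H2]]] := cexp_bound.
have [K [K0 HK]] := act_bound X P2.
pose P := maxn P1 P2.+1.
have [M bM] := good_coef_le2 P.+1 gc.
apply/(cvLP w0) => e e0.
have CC0 : 0 <= (4 * C1 + 4 * C2 * K ^+ 2) * M ^+ 2.
  apply: mulr_ge0; last exact: sqr_ge0.
  by apply: addr_ge0; rewrite ?mulr_ge0 ?sqr_ge0.
have e2 : 0 < e / 2 by rewrite divr_gt0.
have [n hn] := small_inv CC0 e2.
have fn := finite_coefs2_trunc n c; have gn := finite_coefs2_good fn; have gd := good_sub gc gn.
have mE := cexp_memL2 gc; have mn := cexp_memL2 gn; have md := cexp_memL2 gd.
have mAE := cexp_memL2 (act_good X gc); have mAn := cexp_memL2 (act_good X gn).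
have mAd := cexp_memL2 (act_good X gd).
have coef_le := coef_le2_tail n bM.
have ble Q d (N : R) : (Q <= P)%N -> coef_le2 P N d -> coef_le2 Q N d.
  by move=> QP [u v]; split; [exact: coef_le_le QP u|exact: coef_le_le QP v].
have b2 := H2 _ _ (act_good X gd) (HK _ _ (ble _ _ _ (leq_maxr _ _) coef_le)).
have e4 : 0 < e / 4 by rewrite divr_gt0.
have /(cvLP w0)/(_ _ e4) := infinitesimal_finite_coefs tX og fn.
move=> [d0 /= d00 Hd]; exists d0 => //= h hb h0; have {Hd} Hn := Hd h hb h0.
have b1 := H1 ga _ _ h h0 og gd (ble _ _ _ (leq_maxl _ _) coef_le).
have {}b1 : norm2 (diff_quot ga (E (subc c (trunc n c))) h) <= C1 * (M / n.+1%:R) ^+ 2.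
  have h2 : 0 < h ^+ 2 by rewrite exprn_even_gt0.
  by have := b1; rewrite (norm2_diff_quot ga h0 md) [_ * h ^+ 2]mulrC ler_pM2l.
have mq f : memL2 w f -> memL2 w (diff_quot ga f h) by exact: diff_quot_mem.
have alg (p q y z : R[i]) : p - y = (q - z) + ((p - q) - (y - z)).
  by apply: complexP; rewrite !(reD, imD, reB, imB); ring.
pose F1 := diff_quot ga (E (trunc n c)) h \- E (A X (trunc n c)).
pose F2 := diff_quot ga (E (subc c (trunc n c))) h \- E (A X (subc c (trunc n c))).
have m1 : memL2 w F1 := memL2B w0 mw (mq _ mn) mAn.
have m2 : memL2 w F2 := memL2B w0 mw (mq _ md) mAd.
have ae : aeeq (diff_quot ga (E c) h \- E (A X c)) (F1 \+ F2).
  rewrite /F1 /F2 act_sub (cexp_sub (act_good X gc) (act_good X gn)) cexp_sub//.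
  apply: ae_mono (increment_sub ga h mE mn) => x /=.
  rewrite /diff_quot /cscale => ->; rewrite (mulrBr _ (increment ga (E c) h x)); exact: alg.
rewrite (norm2_ae w0 mw (memL2B w0 mw (mq _ mE) mAE) (memL2D w0 mw m1 m2) ae).
apply: le_lt_trans (norm2D_le w0 mw m1 m2) _.
rewrite [e]splitr; apply: ltr_leD; first by move: Hn; rewrite -/F1; lra.
apply: le_trans (_ : 2 * (2 * (C1 * (M / n.+1%:R) ^+ 2) + 2 * (C2 * (K * (M / n.+1%:R)) ^+ 2)) <= _).
  rewrite ler_wpM2l//; apply: le_trans (norm2B_le w0 mw (mq _ md) mAd) _.
  by rewrite lerD// ler_wpM2l.
apply: le_trans (ltW hn); rewrite le_eqVlt; apply/orP; left; apply/eqP.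
by rewrite !exprMn exprVn; move: (_ ^- 2) => q; ring.
Qed.

Lemma Omega_lin g (c : R[i]) f f' : memL2 w f -> memL2 w f' ->
  aeeq (Ω g (cscale c f \+ f')) (cscale c (Ω g f) \+ Ω g f').
Proof. by case: hU => -[_ h _ _] _ _ _; exact: h. Qed.

Lemma cscale_zero f : cscale (-1) f \+ f = fun=> 0.
Proof. by apply/funext => x; rewrite /cscale /= mulN1r addNr. Qed.

Lemma memL2_zero : memL2 w (fun=> 0).
Proof.
have z : @good (fun _ _ => 0, fun _ _ => 0) by apply: (@finite_coefs2_good 0).
by have := memL2D w0 mw (memL2Z w0 mw (-1) (cexp_memL2 z)) (cexp_memL2 z); rewrite cscale_zero.
Qed.

Lemma OmegaZ g (c : R[i]) f : memL2 w f -> aeeq (Ω g (cscale c f)) (cscale c (Ω g f)).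
Proof.
move=> hf; have hz := memL2_zero.
have h0 := Omega_lin g (-1) hz hz; rewrite !cscale_zero in h0.
have := Omega_lin g c hf hz; rewrite (_ : cscale c f \+ (fun=> 0) = cscale c f).
  by move=> h; apply: ae_mono (ae_and h h0) => x [-> /= ->]; rewrite addr0.
by apply/funext => x /=; rewrite addr0.
Qed.

Lemma OmegaD g f f' : memL2 w f -> memL2 w f' -> aeeq (Ω g (f \+ f')) (Ω g f \+ Ω g f').
Proof.
move=> hf hf'; have := Omega_lin g 1 hf hf'.
have one (F : R -> R[i]) : cscale 1 F = F by apply/funext => x; rewrite /cscale mul1r.
by rewrite !one.
Qed.

(** The equality is exact and not only almost everywhere, because continuity on the group factors
    the orbit map through the coordinates; [smooth_on_group] demands such exactness. *)
Lemma Omega_group_point g f : memL2 w f -> Ω g f = Ω (group_point (iwasawa g)) f.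
Proof.
by case: hU => _ _ _ h hf; have [F F1 _] := h f hf; rewrite !F1 iwasawa_group_point.
Qed.

Lemma Omega_cont f (x : 'rV[R]_3) : memL2 w f -> cvL w (nbhs x) (fun y => Ω (group_point y) f) (Ω (group_point x) f).
Proof.
move=> hf; case: hU => _ _ _ h; have [F F1 F2] := h f hf.
apply/(L2cvgP w0 mw); [by move=> y; exact: Omega_mem|exact: Omega_mem|].
rewrite (_ : (fun y => Ω (group_point y) f) = F); last by apply/funext => y; rewrite F1 iwasawa_group_point.
by rewrite F1 iwasawa_group_point; exact: F2.
Qed.

Lemma direction_trace (x : 'rV[R]_3) i : \tr (direction x i) = 0.
Proof.
by rewrite /direction /mxtrace big_ord_recl big_ord1; case: i => [[|[|[|]]]//= hi]; rewrite !mxE/=; ring.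
Qed.

Definition qdiff (F : 'rV[R]_3 -> R -> R[i]) (i : 'I_3) (x : 'rV[R]_3) (h : R) := cscale (h^-1)%:C%C (F (x + h *: delta_mx 0 i) \- F x).

(** Moving along a coordinate is right multiplication by [ga h], so the quotient is [Omega(g)]
    applied to the quotient at the identity, and [Omega(g)] is an isometry. *)
Lemma Omega_partial c (i : 'I_3) (x : 'rV[R]_3) : good c ->
  cvL w 0^' (qdiff (fun y => Ω (group_point y) (E c)) i x) (Ω (group_point x) (E (A (direction x i) c))).
Proof.
move=> gc; have [ga og Hga] := direction_flow x i.
have mE := cexp_memL2 gc; have mA := cexp_memL2 (act_good (direction x i) gc).
have := infinitesimal_good (direction_trace x i) og gc.
rewrite /cvL (_ : (fun t => norm2 (diff_quot ga (E c) t \- _)) =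
  (fun t => norm2 (qdiff (fun y => Ω (group_point y) (E c)) i x t \- Ω (group_point x) (E (A (direction x i) c)))))//.
apply/funext => t; have mq := diff_quot_mem ga t mE; have mi := increment_mem ga t mE.
rewrite -(Omega_norm2 (group_point x) (memL2B w0 mw mq mA)).
apply: (norm2_ae w0 mw).
- by apply: Omega_mem; exact: memL2B.
- by apply: (memL2B w0 mw); [apply: (memL2Z w0 mw); apply: (memL2B w0 mw)|]; exact: Omega_mem.
have h1 := Omega_sub (group_point x) mq mA; have h2 := OmegaZ (group_point x) (t^-1)%:C%C mi.
have h3 := Omega_sub (group_point x) (Omega_mem (ga t) mE) mE.
have h4 := Omega_mul (group_point x) (ga t) mE.
apply: ae_mono (ae_and (ae_and h1 h2) (ae_and h3 h4)) => y [[H1 H2] [H3 H4]].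
rewrite H1 /= H2 /cscale H3 /= -H4 Hga.
by rewrite /qdiff /cscale.
Qed.

(** * Iterated partial derivatives in Iwasawa coordinates *)

Local Notation term := ((R * R * nat) * coefs)%type.
Local Notation i1 := (@Ordinal 3 1 isT).
Local Notation i2 := (@Ordinal 3 2 isT).
Local Notation Xh := (mx2 1 0 0 (-1) : 'M[R]_2).
Local Notation Xe := (mx2 0 1 0 0 : 'M[R]_2).
Local Notation Xf := (mx2 0 0 1 0 : 'M[R]_2).

(* A term [((r, p, j), c)] stands for [r exp(p t) s^j Omega(g) (E c)] in the
   coordinates [(th, t, s)] of [g]; such terms are stable under the three partial
   derivatives. *)
Definition mval (m : R * R * nat) (t s : R) := m.1.1 * expR (m.1.2 * t) * s ^+ m.2.
Definition tval (T : term) (x : 'rV[R]_3) := cscale (mval T.1 (x 0 i1) (x 0 i2))%:C%C (Ω (group_point x) (E T.2)).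
Definition tsums (L : seq term) (x : 'rV[R]_3) := foldr (fun T acc => tval T x \+ acc) (fun=> 0) L.
Definition tgood (L : seq term) := foldr (fun T P => good T.2 /\ P) True L.

(** The product rule: terms keeping [c] differentiate the scalar, which does not involve the angle;
    the others list the entries of [direction], whose factors [exp(2 t)], [exp(- 2 t)] and [s] shift
    [p] and [j]. For [j = 0] the exponent [j.-1] comes with the factor 0. *)
Definition dterm (i : 'I_3) (T : term) : seq term :=
  let: ((r, p, j), c) := T in
  match val i with
  | 0 => [:: ((- r, p + 2, j.+1), A Xh c); ((- r, p - 2, j), A Xe c);
             ((- r, p + 2, j.+2), A Xe c); ((r, p + 2, j), A Xf c)]
  | 1 => [:: ((r * p, p, j), c); ((r, p, j), A Xh c); ((2 * r, p, j.+1), A Xe c)]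
  | _ => [:: ((r * j%:R, p, j.-1), c); ((r, p, j), A Xe c)]
  end.

Lemma tgood_dterm i T : good T.2 -> tgood (dterm i T).
Proof.
case: T => -[[r p] j] c /= gc.
have ag X : good (A X c) by exact: act_good.
by rewrite /dterm /=; case: i => [[|[|[|]]]//= hi]; intuition.
Qed.

Lemma tgood_cat L L' : tgood L -> tgood L' -> tgood (L ++ L').
Proof. by elim: L => //= T L IH [h1 h2] h; split => //; exact: IH. Qed.

Lemma tgood_derive i L : tgood L -> tgood (flatten (map (dterm i) L)).
Proof.
elim: L => //= T L IH [h1 h2]; apply: tgood_cat; [exact: tgood_dterm|exact: IH].
Qed.

Lemma tval_mem T (x : 'rV[R]_3) : good T.2 -> memL2 w (tval T x).
Proof. by move=> g; apply: (memL2Z w0 mw); apply: Omega_mem; exact: cexp_memL2. Qed.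

Lemma tsums_mem L (x : 'rV[R]_3) : tgood L -> memL2 w (tsums L x).
Proof.
elim: L => [_|T L IH /= [h1 h2]]; first exact: memL2_zero.
by apply: (memL2D w0 mw); [exact: tval_mem|exact: IH].
Qed.

Lemma tsums_cat L L' (x : 'rV[R]_3) : tsums (L ++ L') x = tsums L x \+ tsums L' x.
Proof.
elim: L => [|T L IH] /=; first by apply/funext => y; rewrite /= add0r.
by rewrite IH; apply/funext => y; rewrite /= addrA.
Qed.

Lemma is_derive_mval m (t s al be : R) : is_derive (0 : R) (1 : R)
  (fun h : R => mval m (t + h * al) (s + h * be))
  (al * m.1.2 * mval m t s + be * mval (m.1.1 * m.2%:R, m.1.2, m.2.-1) t s).
Proof.
case: m => -[r p] j /=.
have d1 (u v : R) : is_derive (0 : R) (1 : R) (fun h : R => u + h * v) v.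
  have H := is_deriveD (is_derive_cst u (0 : R) (1 : R)) (is_deriveM (is_derive_id (0 : R) (1 : R)) (is_derive_cst v (0 : R) (1 : R))).
  by apply: (is_derive_eq H); rewrite /GRing.scale/=; ring.
have d2 : is_derive (0 : R) (1 : R) (fun h : R => expR (p * (t + h * al))) (al * p * expR (p * t)).
  have h1 : is_derive (0 : R) (1 : R) (fun h : R => p * (t + h * al)) (p * al) := is_deriveZ p (d1 t al).
  have h0 : is_derive (p * (t + 0 * al)) (1 : R) (@expR R) (expR (p * t)).
    by rewrite mul0r addr0; exact: is_derive_expR.
  have H := @is_derive1_comp R expR (fun h : R => p * (t + h * al)) 0 _ _ h0 h1.
  by apply: (is_derive_eq H); move: (expR _) => q; ring.
have d3 : is_derive (0 : R) (1 : R) (fun h : R => (s + h * be) ^+ j) (be * (j%:R * s ^+ j.-1)).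
  have parity_mon (u : R -> R) n h : (u ^+ n) h = u h ^+ n.
    by elim: n => [|n IH]; rewrite ?expr0// !exprS -IH.
  have H := is_deriveX j (d1 s be).
  rewrite (_ : (fun h : R => _) = (fun h : R => s + h * be) ^+ j); last by apply/funext => h; rewrite parity_mon.
  apply: (is_derive_eq H); rewrite /GRing.scale/= mul0r addr0.
  by rewrite -mulr_natl; ring.
have H := is_deriveZ r (is_deriveM d2 d3).
have -> : (fun h : R => mval (r, p, j) (t + h * al) (s + h * be)) =
   r \*: ((fun h : R => expR (p * (t + h * al))) * (fun h : R => (s + h * be) ^+ j)).
  by apply/funext => h; rewrite /mval/= -mulrA.
apply: (is_derive_eq H); rewrite /GRing.scale/= /mval/= !mul0r !addr0.
move: (expR _) (s ^+ j) (s ^+ j.-1) => u v q; ring.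
Qed.

Lemma is_derive_quotient (u : R -> R) d : is_derive (0 : R) (1 : R) u d ->
  h^-1 * (u h - u 0) @[h --> 0^'] --> d.
Proof.
move=> [ex <-]; rewrite /derive /derivable in ex *.
move: ex; rewrite (_ : (fun h => _) = (fun h : R => h^-1 * (u h - u 0))) //.
by apply/funext => h; rewrite /= /GRing.scale/= mulr1 addr0.
Qed.

Lemma is_derive_dnbhs (u : R -> R) d : is_derive (0 : R) (1 : R) u d ->
  u h @[h --> 0^'] --> u 0.
Proof. by move=> /is_derive_continuous h; apply: cvg_within_filter; exact: h. Qed.

Lemma act_entries X c : good c -> forall g, aeeq (Ω g (E (A X c)))
  (cscale (X 0 0)%:C%C (Ω g (E (A Xh c))) \+ (cscale (X 0 1)%:C%C (Ω g (E (A Xe c))) \+ cscale (X 1 0)%:C%C (Ω g (E (A Xf c))))).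
Proof.
move=> gc g.
have [gh ge gf] : [/\ good (A Xh c), good (A Xe c) & good (A Xf c)] by split; exact: act_good.
have [mh me mf] : [/\ memL2 w (E (A Xh c)), memL2 w (E (A Xe c)) & memL2 w (E (A Xf c))].
  by split; exact: cexp_memL2.
have -> : E (A X c) = cscale (X 0 0)%:C%C (E (A Xh c)) \+ (cscale (X 0 1)%:C%C (E (A Xe c)) \+ cscale (X 1 0)%:C%C (E (A Xf c))).
  have lin (r1 r2 r3 : R) (e1 e2 e3 : bool -> nat -> R) x : rapid2 e1 -> rapid2 e2 -> rapid2 e3 ->
     rexp a (wexp S k a) (fun b l => r1 * e1 b l + (r2 * e2 b l + r3 * e3 b l)) x =
     r1 * rexp a (wexp S k a) e1 x + (r2 * rexp a (wexp S k a) e2 x + r3 * rexp a (wexp S k a) e3 x).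
    move=> h1 h2 h3; have z1 := rapid2Z r1 h1; have z2 := rapid2Z r2 h2; have z3 := rapid2Z r3 h3.
    by rewrite (rexpD S0 a0 hlam z1 (rapid2D z2 z3)) (rexpD S0 a0 hlam z2 z3) !(rexpZ S0 a0 hlam).
  case: gh => gh1 gh2; case: ge => ge1 ge2; case: gf => gf1 gf2.
  apply/funext => x; rewrite -[RHS]/((X 0 0)%:C%C * E (A Xh c) x +
    ((X 0 1)%:C%C * E (A Xe c) x + (X 1 0)%:C%C * E (A Xf c) x)).
  apply: complexP; rewrite !(reD, imD) !(reM, imM) /cexp/= !mul0r ?subr0 ?addr0.
  - rewrite -lin//; congr (rexp _ _ _ x); apply/funext => b; apply/funext => l.
    by rewrite /act /= /three_term !mxE/=; field.
  - rewrite -lin//; congr (rexp _ _ _ x); apply/funext => b; apply/funext => l.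
    by rewrite /act /= /three_term !mxE/=; field.
have zh := memL2Z w0 mw (X 0 0)%:C%C mh; have ze := memL2Z w0 mw (X 0 1)%:C%C me; have zf := memL2Z w0 mw (X 1 0)%:C%C mf.
have h1 := OmegaD g zh (memL2D w0 mw ze zf); have h2 := OmegaD g ze zf.
have h3 := OmegaZ g (X 0 0)%:C%C mh; have h4 := OmegaZ g (X 0 1)%:C%C me; have h5 := OmegaZ g (X 1 0)%:C%C mf.
apply: ae_mono (ae_and (ae_and h1 h2) (ae_and h3 (ae_and h4 h5))) => x [[H1 H2] [H3 [H4 H5]]].
by rewrite H1 /= H2 /= H3 H4 H5.
Qed.

Lemma cvL_lim_ae (T : Type) (F : set_system T) {FF : Filter F} (G : T -> R -> R[i]) f f' :
  (forall t, memL2 w (G t)) -> memL2 w f -> memL2 w f' -> aeeq f f' -> cvL w F G f -> cvL w F G f'.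
Proof.
move=> hG hf hf' e; rewrite /cvL (_ : (fun t => norm2 (G t \- f)) = (fun t => norm2 (G t \- f')))//.
apply/funext => t; apply: (norm2_ae w0 mw); [exact: memL2B..|].
by apply: ae_mono e => x /= ->.
Qed.

Lemma scaled_difference_quotient (p q r : R) (y z : R[i]) :
  p%:C%C * (r%:C%C * (y - z)) + (r * (p - q))%:C%C * z = r%:C%C * (p%:C%C * y - q%:C%C * z).
Proof. by case: y => y1 y2; case: z => z1 z2; apply: complexP => /=; ring. Qed.

(** By [scaled_difference_quotient], the quotient of scalar times vector is the moved scalar times
    the vector's quotient plus the scalar's quotient times the fixed vector. *)
Lemma tval_partial i T (x : 'rV[R]_3) : good T.2 -> cvL w 0^' (qdiff (tval T) i x) (tsums (dterm i T) x).
Proof.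
move=> gT; pose al : R := (val i == 1%N)%:R; pose be : R := (val i == 2%N)%:R.
pose u (h : R) := mval T.1 (x 0 i1 + h * al) (x 0 i2 + h * be).
have ux h : mval T.1 ((x + h *: delta_mx 0 i) 0 i1) ((x + h *: delta_mx 0 i) 0 i2) = u h.
  have e1 : (i1 == i) = (val i == 1%N) by rewrite eq_sym.
  have e2 : (i2 == i) = (val i == 2%N) by rewrite eq_sym.
  by rewrite /u !mxE /al /be !eqxx /= e1 e2.
have u0 : mval T.1 (x 0 i1) (x 0 i2) = u 0 by rewrite /u !mul0r !addr0.
have du := is_derive_mval T.1 (x 0 i1) (x 0 i2) al be.
set d := _ + _ in du.
pose F y := Ω (group_point y) (E T.2); pose G := Ω (group_point x) (E (A (direction x i) T.2)).
have mF y : memL2 w (F y) by apply: Omega_mem; exact: cexp_memL2.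
have mG : memL2 w G by apply: Omega_mem; apply: cexp_memL2; exact: act_good.
have mq h : memL2 w (qdiff F i x h) := memL2Z w0 mw _ (memL2B w0 mw (mF _) (mF _)).
have L1 : cvL w 0^' (fun h => cscale (u h)%:C%C (qdiff F i x h)) (cscale (u 0)%:C%C G).
  exact: (cvL_Z w0 mw mq mG (is_derive_dnbhs du) (Omega_partial i x gT)).
have L2 : cvL w 0^' (fun h => cscale (h^-1 * (u h - u 0))%:C%C (F x)) (cscale d%:C%C (F x)).
  exact: (cvL_Z w0 mw (fun=> mF x) (mF x) (is_derive_quotient du) (cvL_cst _ _)).
have mL1 h := memL2Z w0 mw (u h)%:C%C (mq h).
have mL2 h := memL2Z w0 mw (h^-1 * (u h - u 0))%:C%C (mF x).
have := cvL_D w0 mw mL1 mL2 (memL2Z w0 mw _ mG) (memL2Z w0 mw _ (mF x)) L1 L2.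
rewrite (_ : (fun h => _ \+ _) = qdiff (tval T) i x); last first.
  apply/funext => h; apply/funext => y.
  rewrite /qdiff /tval /cscale ux u0 -/(F x) -/(F (x + h *: delta_mx 0 i)) /=.
  exact: scaled_difference_quotient.
move=> /(_ ltac:(typeclasses eauto)) L; apply: (cvL_lim_ae _ _ _ _ L).
- by move=> h; exact: (memL2Z w0 mw _ (memL2B w0 mw (tval_mem _ gT) (tval_mem _ gT))).
- exact: (memL2D w0 mw (memL2Z w0 mw _ mG) (memL2Z w0 mw _ (mF x))).
- by apply: tsums_mem; exact: tgood_dterm.
apply: ae_mono (act_entries (direction x i) gT (group_point x)) => y H.
apply: etrans (congr1 (fun z => (u 0)%:C%C * z + d%:C%C * F x y) H) _.
rewrite -u0 /d /F /al /be /cscale /= {L L1 L2 mL1 mL2 mq mG G mF F H d du u0 ux u al be}.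
case: T gT => -[[r p] j] c /= gc; rewrite /dterm /tsums /tval /cscale.
have ep (t : R) : expR ((p + 2) * t) = expR (p * t) * expR (2 * t) by rewrite mulrDl expRD.
have em (t : R) : expR ((p - 2) * t) = expR (p * t) * expR (- (2 * t)) by rewrite mulrDl expRD mulNr.
rewrite /direction; move: (x 0 i1) (x 0 i2) => t s.
by case: i => [[|[|[|]]]//= hi]; rewrite !mxE /mval /= ?ep ?em ?exprS;
  move: (Ω (group_point x) (E c) y) (Ω (group_point x) (E (A Xh c)) y) (Ω (group_point x) (E (A Xe c)) y) (Ω (group_point x) (E (A Xf c)) y);
  move=> [e01 e02] [eh1 eh2] [ee1 ee2] [ef1 ef2]; apply: complexP => /=; ring.
Qed.

Lemma tval_cont T (x : 'rV[R]_3) : good T.2 -> cvL w (nbhs x) (tval T) (tval T x).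
Proof.
move=> gT; have mE := cexp_memL2 gT.
have cc (j : 'I_3) : (fun y : 'rV[R]_3 => y 0 j) y @[y --> x] --> x 0 j by exact: coord_continuous.
apply: (cvL_Z w0 mw); [by move=> y; exact: Omega_mem|exact: Omega_mem| |exact: Omega_cont].
apply: cvgM.
  apply: cvgM; first exact: cvg_cst.
  apply: (@continuous_comp _ _ _ (fun y : 'rV[R]_3 => T.1.1.2 * y 0 i1) (@expR R)); last exact: continuous_expR.
  apply: (@continuous_comp _ _ _ (fun y : 'rV[R]_3 => y 0 i1) ( *%R T.1.1.2)); first exact: cc.
  exact: mulrl_continuous.
apply: (@continuous_comp _ _ _ (fun y : 'rV[R]_3 => y 0 i2) (fun s : R => s ^+ T.1.2)); first exact: cc.
exact: exprn_continuous.
Qed.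

Lemma tsums_cont L (x : 'rV[R]_3) : tgood L -> cvL w (nbhs x) (tsums L) (tsums L x).
Proof.
elim: L => [_|T L IH /= [h1 h2]]; first exact: cvL_cst.
apply: (cvL_D w0 mw); [by move=> y; exact: tval_mem|by move=> y; exact: tsums_mem|exact: tval_mem|exact: tsums_mem| |exact: IH].
exact: tval_cont.
Qed.

Lemma qdiff_mem F i (x : 'rV[R]_3) h : (forall y, memL2 w (F y)) -> memL2 w (qdiff F i x h).
Proof. by move=> mF; exact: (memL2Z w0 mw _ (memL2B w0 mw (mF _) (mF _))). Qed.

Lemma tsums_partial i L (x : 'rV[R]_3) : tgood L ->
  cvL w 0^' (qdiff (tsums L) i x) (tsums (flatten (map (dterm i) L)) x).
Proof.
elim: L => [_|T L IH /= [h1 h2]].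
  rewrite (_ : qdiff _ _ _ = fun=> (fun=> 0)); first exact: cvL_cst.
  by apply/funext => h; apply/funext => y; rewrite /qdiff /cscale /= subrr mulr0.
rewrite tsums_cat.
rewrite (_ : qdiff _ i x = fun h => qdiff (tval T) i x h \+ qdiff (tsums L) i x h); last first.
  apply/funext => h; apply/funext => y; rewrite /qdiff /cscale /= -mulrDr; congr (_ * _).
  by rewrite opprD addrACA.
apply: (cvL_D w0 mw).
- by move=> h; apply: qdiff_mem => y; exact: tval_mem.
- by move=> h; apply: qdiff_mem => y; exact: tsums_mem.
- by apply: tsums_mem; exact: tgood_dterm.
- by apply: tsums_mem; exact: tgood_derive.
- exact: tval_partial.
- exact: IH.
Qed.

Lemma cexp_smooth c : good c -> smooth_vector w Ω (E c).
Proof.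
move=> gc; split; first exact: cexp_memL2.
pose dl := fix dl (s : seq 'I_3) : seq term :=
  if s is i :: s' then flatten (map (dterm i) (dl s')) else [:: ((1, 0, 0%N), c)].
have gdl s : tgood (dl s) by elim: s => //= i s IH; exact: tgood_derive.
exists (fun s => tsums (dl s)); split.
- move=> g; rewrite /= (Omega_group_point _ (cexp_memL2 gc)); apply/funext => y.
  rewrite /= /tval /cscale /mval /= mul0r expR0 !mulr1 mul1r addr0.
  by move: (Ω _ _ _) => [y1 y2]; apply: complexP => /=; ring.
- by move=> s x; exact: tsums_mem.
- by move=> s x; apply/(L2cvgP w0 mw); [move=> y; exact: tsums_mem|exact: tsums_mem|exact: tsums_cont].
- move=> s i x; apply/(L2cvgP w0 mw).
  + by move=> h; apply: qdiff_mem => y; exact: tsums_mem.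
  + by apply: tsums_mem; exact: tgood_derive.
  + exact: tsums_partial.
Qed.

(** * Rapid decrease of the coefficients of a smooth vector *)

Definition delta1 b l : coefs := (fun b' l' => ((b' == b) && (l' == l))%:R, fun _ _ => 0).
Definition delta2 b l : coefs := (fun _ _ => 0, fun b' l' => ((b' == b) && (l' == l))%:R).
Local Notation J := (mx2 0 (-1) 1 0 : 'M[R]_2).
(** The operator [omega(J)] multiplies [Phi b l] by [- i] times this number; [delta1] and [delta2]
    are the coefficients of [Phi b l] and of [i Phi b l]. *)
Definition frequency b l : R := 2 * l%:R + lm a (wexp S k a) b + 1.
Definition scal (r : R) (c : coefs) : coefs := (fun b l => r * c.1 b l, fun b l => r * c.2 b l).

Lemma delta_finite_coefs b l : finite_coefs2 l.+1 (delta1 b l) /\ finite_coefs2 l.+1 (delta2 b l).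
Proof.
have H : finite_coefs l.+1 (fun b' l' => ((b' == b) && (l' == l))%:R : R).
  by move=> b' l' ll; rewrite gtn_eqF// andbF.
by split; split.
Qed.

Lemma act_J b l : A J (delta1 b l) = scal (- frequency b l) (delta2 b l) /\
  A J (delta2 b l) = scal (frequency b l) (delta1 b l).
Proof.
have half : (1 + 1) / 2 = 1 :> R by field.
have H b' l' : (2 * l'%:R + lm a (wexp S k a) b' + 1) * ((b' == b) && (l' == l))%:R =
   frequency b l * ((b' == b) && (l' == l))%:R.
  by case: eqP => [->|_]; case: eqP => [->|_]; rewrite //= !mulr0.
split; congr pair; apply/funext => b'; apply/funext => l'; rewrite /act /= /three_term !mxE/= ?H.
- by field.
- by rewrite ?mulNr -H; field.
- by rewrite -H; field.
- by field.
Qed.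

Lemma cexp_scal r c : good c -> E (scal r c) = cscale r%:C%C (E c).
Proof.
move=> [h1 h2]; apply/funext => x; rewrite /cscale /cexp /= !(rexpZ S0 a0 hlam)//.
by apply: complexP; rewrite /=; ring.
Qed.

Definition rotation (th : R) : SL2cover R := iwasawa_el th 0 0.

Lemma rotation_mul (s t : R) : cmul (rotation s) (rotation t) = rotation (s + t).
Proof. exact: iwasawa_el_rotation. Qed.

(** Polarization of the invariance of the norm. *)
Lemma Omega_inner g f f' : memL2 w f -> memL2 w f' -> inner (Ω g f) (Ω g f') = inner f f'.
Proof.
move=> hf hf'; have m1 := Omega_mem g hf; have m2 := Omega_mem g hf'.
have := norm2D w0 mw m1 m2; have := norm2D w0 mw hf hf'.
rewrite -(norm2_ae w0 mw (Omega_mem g (memL2D w0 mw hf hf')) (memL2D w0 mw m1 m2) (OmegaD g hf hf')).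
rewrite !Omega_norm2//; last exact: memL2D.
by move=> ->; move: (norm2 f) (norm2 f') (inner f f') (inner _ _) => p q u v; lra.
Qed.

Lemma Omega_rotation_inner h f f' : memL2 w f -> memL2 w f' ->
  inner (Ω (rotation h) f) f' = inner f (Ω (rotation (- h)) f').
Proof.
move=> hf hf'; have mh := Omega_mem (rotation h) hf.
rewrite -(Omega_inner (rotation (- h)) mh hf').
apply: (inner_ae w0 mw); [exact: Omega_mem|by []|exact: Omega_mem|].
apply: aeeq_trans (aeeq_sym (Omega_mul (rotation (- h)) (rotation h) hf)) _.
rewrite rotation_mul addNr /rotation gel1; case: hU => _ h1 _ _; exact: h1.
Qed.

(** The rotation is moved to [E c], whose derivative is known, so [f] may be any element of L^2; the
    inverse rotation accounts for the minus sign. *)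
Lemma inner_diff_quot_rotation f n c : memL2 w f -> finite_coefs2 n c ->
  h^-1 * (inner (Ω (rotation h) f) (E c) - inner f (E c)) @[h --> 0^'] --> - inner f (E (A J c)).
Proof.
move=> hf fc; have gc := finite_coefs2_good fc; have mE := cexp_memL2 gc.
have tJ : \tr J = 0 by rewrite /mxtrace big_ord_recl big_ord1 !mxE/= addr0.
have L := infinitesimal_good tJ (one_parameter_J R) gc.
have mA := cexp_memL2 (act_good J gc).
have {}L : cvL w 0^' (fun h => diff_quot rotation (E c) (- h)) (E (A J c)).
  apply/(cvLP w0) => e e0; have /(cvLP w0)/(_ e e0) [d /= d0 H] := L.
  exists d => //= h hb h0; apply: H; rewrite ?oppr_eq0//.
  by move: hb; rewrite /= !sub0r !normrN.
have L2 : inner (diff_quot rotation (E c) (- h)) f @[h --> 0^'] --> inner (E (A J c)) f.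
  exact: (cvL_inner w0 mw (fun h => diff_quot_mem rotation (- h) mE) mA hf L).
have L3 : - inner (diff_quot rotation (E c) (- h)) f @[h --> 0^'] --> - inner (E (A J c)) f by apply: cvgN.
rewrite [inner f (E (A J c))]innerC.
rewrite (_ : (fun h => _) = (fun h => - inner (diff_quot rotation (E c) (- h)) f))//.
apply/funext => h; have mi := increment_mem rotation (- h) mE.
rewrite Omega_rotation_inner// /diff_quot (innerZl w0 mw _ mi hf) invrN mulNr opprK; congr (_ * _).
rewrite /increment (innerBl w0 mw (Omega_mem _ mE) mE hf).
by rewrite [inner f (Ω _ _)]innerC [inner f (E c)]innerC.
Qed.
Lemma Usum_delta b b' l t :
  Usum a (wexp S k a) l.+1 (fun b' l' => ((b' == b) && (l' == l))%:R) b' 0 t =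
  (b' == b)%:R * phi (lm a (wexp S k a) b') l t.
Proof.
rewrite Usum0 big_ord_recr/= eqxx andbT big1 ?add0r// => i _.
by rewrite ltn_eqF// andbF mul0r.
Qed.

Lemma rexp_delta b l x :
  rexp a (wexp S k a) (fun b' l' => ((b' == b) && (l' == l))%:R) x = Phi a (wexp S k a) b l x.
Proof.
have [[h _] _] := delta_finite_coefs b l.
rewrite (rexp_finite_coefs a (wexp S k a) x h) !Usum_delta /Phi /basis.
by case: b {h} => /=; move: (phi _ _ _) (phi _ _ _) => *; ring.
Qed.

Lemma inner_delta b l f :
  inner f (E (delta1 b l)) = integral_line (fun x => re (f x) * Phi a (wexp S k a) b l x * w x) /\
  inner f (E (delta2 b l)) = integral_line (fun x => im (f x) * Phi a (wexp S k a) b l x * w x).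
Proof.
have z x : rexp a (wexp S k a) (fun _ _ => 0) x = 0.
  rewrite (@rexp_finite_coefs _ a (wexp S k a) 0)// /Usum !big_ord0; ring.
split; congr integral_line; apply/funext => x; rewrite /inner_density /cexp /= z rexp_delta.
- by rewrite mulr0 addr0.
- by rewrite mulr0 add0r.
Qed.

Lemma cvg_eq (u : R -> R) (p q : R) : u h @[h --> 0^'] --> p -> u h @[h --> 0^'] --> q -> p = q.
Proof. by move=> h1 h2; rewrite -(cvg_lim (@Rhausdorff R) h1) -(cvg_lim (@Rhausdorff R) h2). Qed.

(** [G n th] is the derivative of order [n] in the angle, taken from the smoothness data. The first
    order is [inner_diff_quot_rotation]; each further order differentiates the identity already
    proved at all angles and compares limits, since the higher derivatives are known only as L^2
    limits of quotients. *)
Lemma smooth_inner_recursion f : smooth_vector w Ω f ->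
  exists G : nat -> R -> R -> R[i], [/\ forall n th, memL2 w (G n th), aeeq (G 0%N 0) f &
   forall b l n th, inner (G n.+1 th) (E (delta1 b l)) = frequency b l * inner (G n th) (E (delta2 b l)) /\
     inner (G n.+1 th) (E (delta2 b l)) = - (frequency b l * inner (G n th) (E (delta1 b l)))].
Proof.
move=> [mf [D [D0 Dm _ Dp]]].
pose i0 := @Ordinal 3 0 isT; pose X th : 'rV[R]_3 := iwasawa (rotation th).
have XE th h : X (th + h) = X th + h *: delta_mx 0 i0.
  by rewrite /X !iwasawa_iwasawa_el; apply/rowP => -[[|[|[|]]]//= hj]; rewrite !mxE/= ?mulr1 ?mulr0 ?addr0.
pose F n th := D (nseq n i0) (X th).
have mF n th : memL2 w (F n th) by exact: Dm.
have F0 th : F 0%N th = Ω (rotation th) f by rewrite /F /X -D0.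
exists F; split => //.
  by rewrite F0 /rotation gel1; case: hU => _ h _ _; exact: h.
have dF n th : cvL w 0^' (fun h => cscale (h^-1)%:C%C (F n (th + h) \- F n th)) (F n.+1 th).
  apply/(L2cvgP w0 mw) => //.
    by move=> h; apply: (memL2Z w0 mw); exact: memL2B.
  have := Dp (nseq n i0) i0 (X th); rewrite /L2partial.
  by rewrite (_ : (fun h => _) = (fun h y => (h^-1)%:C%C * (F n (th + h) y - F n th y)))//; apply/funext => h; rewrite /F XE.
have dip n th Z : memL2 w Z ->
    h^-1 * (inner (F n (th + h)) Z - inner (F n th) Z) @[h --> 0^'] --> inner (F n.+1 th) Z.
  move=> mZ; have mq h : memL2 w (cscale (h^-1)%:C%C (F n (th + h) \- F n th)).
    by apply: (memL2Z w0 mw); exact: memL2B.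
  have := cvL_inner w0 mw mq (mF _ _) mZ (dF n th).
  move=> /(_ ltac:(typeclasses eauto)).
  rewrite (_ : (fun h => inner (cscale _ _) Z) = (fun h => h^-1 * (inner (F n (th + h)) Z - inner (F n th) Z)))//.
  apply/funext => h; rewrite innerZl//; last exact: memL2B.
  by rewrite innerBl.
have base n c th : finite_coefs2 n c -> inner (F 1%N th) (E c) = - inner (F 0%N th) (E (A J c)).
  move=> fc; have mE := cexp_memL2 (finite_coefs2_good fc).
  apply: (cvg_eq (dip 0%N th _ mE)).
  have L := inner_diff_quot_rotation (mF 0%N th) fc.
  have EE : (fun h => h^-1 * (inner (F 0%N (th + h)) (E c) - inner (F 0%N th) (E c))) =
      (fun h => h^-1 * (inner (Ω (rotation h) (F 0%N th)) (E c) - inner (F 0%N th) (E c))).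
    apply/funext => h; congr (_ * (_ - _)); rewrite !F0 addrC.
    have m1 := Omega_mem (rotation h) (Omega_mem (rotation th) mf).
    apply: (inner_ae w0 mw) => //; first exact: Omega_mem.
    by rewrite -rotation_mul; exact: Omega_mul.
  by rewrite EE.
move=> b l; have [f1 f2] := delta_finite_coefs b l; have [A1 A2] := act_J b l.
have [g1 g2] := (finite_coefs2_good f1, finite_coefs2_good f2).
have [m1 m2] := (cexp_memL2 g1, cexp_memL2 g2).
elim=> [|n IH] th.
  split.
  - by rewrite (base _ _ _ f1) A1 (cexp_scal _ g2) innerC (innerZl w0 mw)// innerC; ring.
  - by rewrite (base _ _ _ f2) A2 (cexp_scal _ g1) innerC (innerZl w0 mw)// innerC; ring.
split.
- apply: (cvg_eq (dip n.+1 th _ m1)).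
  rewrite (_ : (fun h => _) = (fun h => frequency b l * (h^-1 * (inner (F n (th + h)) (E (delta2 b l)) - inner (F n th) (E (delta2 b l)))))).
    by apply: cvgMr; exact: dip.
  by apply/funext => h; rewrite !(proj1 (IH _)); ring.
- apply: (cvg_eq (dip n.+1 th _ m2)); rewrite -mulNr.
  rewrite (_ : (fun h => _) = (fun h => - frequency b l * (h^-1 * (inner (F n (th + h)) (E (delta1 b l)) - inner (F n th) (E (delta1 b l)))))).
    by apply: cvgMr; exact: dip.
  by apply/funext => h; rewrite !(proj2 (IH _)); ring.
Qed.

Lemma smooth_inner_rapid f : smooth_vector w Ω f -> forall b P, exists C, forall l,
  `|inner f (E (delta1 b l))| * l.+1%:R ^+ P <= C /\ `|inner f (E (delta2 b l))| * l.+1%:R ^+ P <= C.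
Proof.
move=> sf b P; have [G [mG G0 rec]] := smooth_inner_recursion sf.
have [C [Q [C0 HC]]] := cexp_bound.
have [e e0 He] := eigen_lower a0 (parity_exp_gtN1 s1 b).
(* [P] powers are wanted, and [2 Q] absorb the growth of the squared norm of the basis function. *)
pose n := (P + Q * 2)%N.
pose B := norm2 (G n 0) + C; have B0 : 0 <= B by rewrite addr_ge0 ?norm2_ge0.
exists (2 * B / e ^+ n) => l.
have [f1 f2] := delta_finite_coefs b l.
have [m1 m2] := (cexp_memL2 (finite_coefs2_good f1), cexp_memL2 (finite_coefs2_good f2)).
set q : R := l.+1%:R; have q1 : 1 <= q by rewrite ler1n.
have q0 : 0 <= q by []. 
have fe : e * q <= frequency b l.
  have := He l; rewrite /frequency /lm /eigen -/q; have : 0 <= e * q by rewrite mulr_ge0// ltW.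
  by move: (lam _ _) (e * q) => u v; lra.
have f0 : 0 <= frequency b l by apply: le_trans fe; rewrite mulr_ge0// ltW.
(* A derivative swaps the two pairings up to sign and multiplies them by the frequency, so the sum
   of their squares avoids distinguishing parities of [m]. *)
have sq m : inner (G m 0) (E (delta1 b l)) ^+ 2 + inner (G m 0) (E (delta2 b l)) ^+ 2 =
    (frequency b l ^+ m) ^+ 2 * (inner (G 0%N 0) (E (delta1 b l)) ^+ 2 + inner (G 0%N 0) (E (delta2 b l)) ^+ 2).
  elim: m => [|m IH]; first by rewrite expr0 expr1n mul1r.
  have [-> ->] := rec b l m 0.
  transitivity (frequency b l ^+ 2 * (inner (G m 0) (E (delta1 b l)) ^+ 2 + inner (G m 0) (E (delta2 b l)) ^+ 2)).
    by move: (inner _ _) (inner _ _) (frequency b l) => u v z; ring.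
  by rewrite IH [frequency b l ^+ m.+1]exprS exprMn mulrA.
have dbd : coef_le2 Q (q ^+ Q) (delta1 b l) /\ coef_le2 Q (q ^+ Q) (delta2 b l).
  have qQ : 0 <= q ^+ Q by rewrite exprn_ge0.
  have H : coef_le Q (q ^+ Q) (fun b' l' => ((b' == b) && (l' == l))%:R : R).
    move=> b' l'; have [/andP[_ /eqP->]|_] := boolP ((b' == b) && (l' == l)).
      by rewrite normr1 mul1r.
    by rewrite normr0 mul0r.
  have Z : coef_le Q (q ^+ Q) (fun _ _ => 0 : R) by move=> b' l'; rewrite normr0 mul0r.
  by split; split.
have nle c : finite_coefs2 l.+1 c -> coef_le2 Q (q ^+ Q) c -> `|inner (G n 0) (E c)| <= B * q ^+ (Q * 2).
  move=> fc bc; have mE := cexp_memL2 (finite_coefs2_good fc).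
  apply: le_trans (inner_le w0 mw ltr01 (mG n 0) mE) _; rewrite invr1 !mul1r mulrDl exprM.
  apply: lerD; last exact: HC (finite_coefs2_good fc) bc.
  by rewrite ler_peMr ?norm2_ge0// -exprM exprn_ege1.
have n1 := nle _ f1 (proj1 dbd); have n2 := nle _ f2 (proj2 dbd).
have e1 : inner f (E (delta1 b l)) = inner (G 0%N 0) (E (delta1 b l)).
  by apply: (inner_ae w0 mw) => //; [case: sf|exact: aeeq_sym].
have e2 : inner f (E (delta2 b l)) = inner (G 0%N 0) (E (delta2 b l)).
  by apply: (inner_ae w0 mw) => //; [case: sf|exact: aeeq_sym].
have finite_coefs (u : R) : u ^+ 2 <= inner (G 0%N 0) (E (delta1 b l)) ^+ 2 + inner (G 0%N 0) (E (delta2 b l)) ^+ 2 ->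
    `|u| * q ^+ P <= 2 * B / e ^+ n.
  move=> hu; rewrite ler_pdivlMr ?exprn_gt0//.
  have qp : 0 < q ^+ (Q * 2) by rewrite exprn_gt0// (lt_le_trans ltr01).
  rewrite -(ler_pM2r qp).
  have -> : `|u| * q ^+ P * e ^+ n * q ^+ (Q * 2) = `|u| * (e * q) ^+ n.
    by rewrite exprMn /n (exprD q); ring.
  apply: le_trans (_ : `|u| * frequency b l ^+ n <= _).
    by rewrite ler_wpM2l// lerXn2r ?nnegrE// mulr_ge0// ltW.
  have R0 : 0 <= 2 * B * q ^+ (Q * 2) by rewrite !mulr_ge0// ltW.
  rewrite -(@ler_pXn2r _ 2)// ?nnegrE ?mulr_ge0 ?exprn_ge0//.
  rewrite exprMn real_normK ?num_real// mulrC.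
  apply: le_trans (ler_wpM2l (sqr_ge0 _) hu) _; rewrite -sq.
  move: n1 n2; rewrite -(real_normK (num_real (inner (G n 0) (E (delta1 b l))))) -(real_normK (num_real (inner (G n 0) (E (delta2 b l))))).
  rewrite -mulrA; move: (normr_ge0 (inner (G n 0) (E (delta1 b l)))) (normr_ge0 (inner (G n 0) (E (delta2 b l)))).
  move: `|inner _ _| `|inner _ _| (B * _) => u1 u2 v u10 u20 h1 h2.
  have v0 : 0 <= v := le_trans u10 h1.
  have k1 : u1 ^+ 2 <= v ^+ 2 by rewrite lerXn2r ?nnegrE.
  have k2 : u2 ^+ 2 <= v ^+ 2 by rewrite lerXn2r ?nnegrE.
  by rewrite exprMn; have := sqr_ge0 v; lra.
by rewrite e1 e2; split; apply: finite_coefs; rewrite ?lerDl ?lerDr sqr_ge0.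
Qed.

Lemma smooth_cexp f : smooth_vector w Ω f -> exists2 c, good c & aeeq f (E c).
Proof.
move=> sf; have [mf _] := sf; have /(memL2P w0 mw) [hr hi] := mf.
have key (p : R -> R) : (forall b P, exists C, forall l,
    `|integral_line (fun x => p x * Phi a (wexp S k a) b l x * w x)| * l.+1%:R ^+ P <= C) ->
    rapid2 (fun b l => rcoef a (wexp S k a) (wcst S k) w b l p).
  (* The extra power pays for the division by [nrm], which may decrease like [1 / (l + 1)]. *)
  move=> H b P; have [C HC] := H b P.+1; have [c c0 nc] := nrm_lower a0 (parity_exp_gtN1 s1 b).
  exists (C / (2 * wcst S k * c)) => l.
  have np := nrm_pos a0 s1 b l; have cc : 0 < 2 * wcst S k * c by rewrite !mulr_gt0.
  have dp : 0 < 2 * wcst S k * nrm a (parity_exp (wexp S k a) b) l by rewrite !mulr_gt0.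
  rewrite /rcoef normrM normfV (gtr0_norm dp) mulrAC ler_pdivlMr//.
  apply: le_trans (HC l); rewrite exprS; move: `|integral_line _| (normr_ge0 (integral_line (fun x => p x * Phi a (wexp S k a) b l x * w x))) => X X0.
  have := nc l; move: (nrm _ _ _) np (wcst S k) cw0 => N N0 D D0 {}nc.
  rewrite [leLHS](_ : _ = X * l.+1%:R ^+ P * (c / N)); last by field; rewrite !gt_eqF.
  rewrite [leRHS](_ : _ = X * l.+1%:R ^+ P * l.+1%:R); last by ring.
  by rewrite ler_wpM2l ?mulr_ge0 ?exprn_ge0// ler_pdivrMr// mulrC.
have rr : rapid2 (fun b l => rcoef a (wexp S k a) (wcst S k) w b l (re \o f)).
  apply: key => b P; have [C HC] := smooth_inner_rapid sf b P; exists C => l.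
  by have [h _] := HC l; have [<- _] := inner_delta b l f.
have ri : rapid2 (fun b l => rcoef a (wexp S k a) (wcst S k) w b l (im \o f)).
  apply: key => b P; have [C HC] := smooth_inner_rapid sf b P; exists C => l.
  by have [_ h] := HC l; have [_ <-] := inner_delta b l f.
exists (fun b l => rcoef a (wexp S k a) (wcst S k) w b l (re \o f),
        fun b l => rcoef a (wexp S k a) (wcst S k) w b l (im \o f)) => //.
have h1 := rexp_complete a0 s1 cw0 wE w0 mw hr rr.
have h2 := rexp_complete a0 s1 cw0 wE w0 mw hi ri.
by apply: ae_mono (ae_and h1 h2) => x [H1 H2]; apply: complexP.
Qed.
Lemma L2class_eq f f' : aeeq f f' -> L2class w f = L2class w f'.
Proof.
move=> e; apply/seteqP; split=> u [mu0 h]; split => //.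
- exact: aeeq_trans (aeeq_sym e) h.
- exact: aeeq_trans e h.
Qed.

Lemma schwartz_cexp (u1 u2 v1 v2 : R -> R) :
  real_schwartz u1 -> real_schwartz u2 -> real_schwartz v1 -> real_schwartz v2 ->
  exists2 c, good c & aeeq (fun x => Complex (u1 (tau a `|x|) + x * v1 (tau a `|x|)) (u2 (tau a `|x|) + x * v2 (tau a `|x|))) (E c).
Proof.
move=> su1 su2 sv1 sv2.
have h1 := rexp_complete a0 s1 cw0 wE w0 mw (schwartz_real_L2 a0 s1 cw0 wE w0 mw su1 sv1) (schwartz_rcoef a0 s1 cw0 wE w0 mw su1 sv1).
have h2 := rexp_complete a0 s1 cw0 wE w0 mw (schwartz_real_L2 a0 s1 cw0 wE w0 mw su2 sv2) (schwartz_rcoef a0 s1 cw0 wE w0 mw su2 sv2).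
exists (fun b l => rcoef a (wexp S k a) (wcst S k) w b l (fun x => u1 (tau a `|x|) + x * v1 (tau a `|x|)),
        fun b l => rcoef a (wexp S k a) (wcst S k) w b l (fun x => u2 (tau a `|x|) + x * v2 (tau a `|x|))).
  by split; exact: (schwartz_rcoef a0 s1 cw0 wE w0 mw).
by apply: ae_mono (ae_and h1 h2) => x [H1 H2]; apply: complexP; [exact: H1|exact: H2].
Qed.

Lemma cexp_schwartz c : good c -> exists u1 u2 v1 v2 : R -> R,
  [/\ [/\ real_schwartz u1, real_schwartz u2, real_schwartz v1 & real_schwartz v2] &
   forall x, E c x = Complex (u1 (tau a `|x|) + x * v1 (tau a `|x|)) (u2 (tau a `|x|) + x * v2 (tau a `|x|))].
Proof.
move=> [h1 h2].
have H (e : bool -> nat -> R) b : rapid2 e -> exists U, real_schwartz U /\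
    forall x, expand a (parity_exp (wexp S k a) b) (e b) `|x| = U (tau a `|x|).
  move=> he; have [U [sU HU]] := seeley_extension (phi_series_half_schwartz (lam a (parity_exp (wexp S k a) b)) (he b)).
  by exists U; split => // x; rewrite -HU// tau_ge0.
have [u1 [su1 H1]] := H _ false h1; have [v1 [sv1 H2]] := H _ true h1.
have [u2 [su2 H3]] := H _ false h2; have [v2 [sv2 H4]] := H _ true h2.
exists u1, u2, v1, v2; split => // x.
by rewrite /cexp /rexp H1 H2 H3 H4.
Qed.

End OmegaSmooth.

(** * Real and complex Schwartz functions *)

Section SchwartzConversion.
Variable R : realType.
Local Notation re := (@complex.Re R).
Local Notation im := (@complex.Im R).

Lemma real_schwartz_scale (r : R) (u : R -> R) : r != 0 -> real_schwartz u -> real_schwartz (fun t => u (r * t)).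
Proof.
move=> r0 [U [-> dU bU]]; exists (fun n t => r ^+ n * U n (r * t)); split.
- by apply/funext => t; rewrite expr0 mul1r.
- move=> n x.
  have H := is_deriveZ (r ^+ n) (is_derive1_comp (dU n (r * x)) (is_deriveZ r (is_derive_id x (1 : R)))).
  by apply: (is_derive_eq H); rewrite /GRing.scale/= exprSr; ring.
- move=> m n; have [C hC] := bU m n; exists (`|r ^+ n / r ^+ m| * C) => x.
  rewrite (_ : x ^+ m * _ = (r ^+ n / r ^+ m) * ((r * x) ^+ m * U n (r * x))); last first.
    by rewrite exprMn; move: (U _ _) (x ^+ m) => p q; field; rewrite expf_neq0.
  by rewrite normrM ler_wpM2l.
Qed.

Lemma schwartz_of_real (u v : R -> R) : real_schwartz u -> real_schwartz v ->
  schwartz (fun t => Complex (u t) (v t)).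
Proof.
move=> [U [-> dU bU]] [V [-> dV bV]].
have E n : iter n (@cderive R) (fun t => Complex (U 0%N t) (V 0%N t)) = fun t => Complex (U n t) (V n t).
  elim: n => //= n ->; apply/funext => t; rewrite /cderive/= !derive1E.
  by rewrite (@derive_val _ _ _ _ _ _ _ (dU n t)) (@derive_val _ _ _ _ _ _ _ (dV n t)).
split=> [n x|m n].
  rewrite E /=; split.
  - exact: (@ex_derive _ _ _ _ _ _ _ (dU n x)).
  - exact: (@ex_derive _ _ _ _ _ _ _ (dV n x)).
have [C hC] := bU m n; have [B hB] := bV m n; exists (C + B) => x; rewrite E.
have -> : (x%:C ^+ m * Complex (U n x) (V n x))%C = ((x ^+ m * U n x)%:C + 'i * (x ^+ m * V n x)%:C)%C :> R[i].
  by rewrite -rmorphXn; apply: complexP => /=; ring.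
apply: le_trans (ler_normD _ _) _; rewrite rmorphD lerD//.
  by rewrite normc_def /= expr0n/= addr0 sqrtr_sqr lecR.
by rewrite normrM normc_def /= expr0n/= add0r expr1n sqrtr1 mul1r normc_def /= expr0n/= addr0 sqrtr_sqr lecR.
Qed.

Lemma real_of_schwartz (U : R -> R[i]) : schwartz U ->
  real_schwartz (fun t => re (U t)) /\ real_schwartz (fun t => im (U t)).
Proof.
move=> [dU bU].
have Re_le (x : R) m (z : R[i]) : (`|x ^+ m * re z|%:C <= `|x%:C ^+ m * z| /\ `|x ^+ m * im z|%:C <= `|x%:C ^+ m * z|)%C.
  rewrite -rmorphXn; move: (x ^+ m) => y; case: z => p q.
  have H (s t : R) : `|s|%:C%C <= `|Complex s t| /\ `|t|%:C%C <= `|Complex s t|.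
    rewrite normc_def /= !lecR -!sqrtr_sqr !ler_sqrt ?addr_ge0 ?sqr_ge0//.
    by rewrite lerDl lerDr !sqr_ge0.
  have := H (y * p) (y * q).
  by rewrite (_ : Complex (y * p) (y * q) = (y%:C * Complex p q)%C)//; apply: complexP => /=; ring.
split.
- exists (fun n t => re (iter n (@cderive R) U t)); split => //.
  + by move=> n x; apply: DeriveDef; [case: (dU n x)|rewrite /= /cderive/= derive1E].
  + move=> m n; have [M hM] := bU m n; exists M => x.
    by rewrite -lecR; have [h _] := Re_le x m (iter n (@cderive R) U x); exact: le_trans h (hM x).
- exists (fun n t => im (iter n (@cderive R) U t)); split => //.
  + by move=> n x; apply: DeriveDef; [case: (dU n x)|rewrite /= /cderive/= derive1E].
  + move=> m n; have [M hM] := bU m n; exists M => x.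
    by rewrite -lecR; have [_ h] := Re_le x m (iter n (@cderive R) U x); exact: le_trans h (hM x).
Qed.

End SchwartzConversion.

Local Open Scope complex_scope.

Theorem theoremA (R : realType) (S : {fset R}) (k : R -> R) (a : R)
    (Ω : SL2cover R -> (R -> R[i]) -> R -> R[i])
    (hS : reduced_root_system S) (hk : nonneg_multiplicity S k)
    (ha : 0 < a) (hlambda : -1 < lambda S k a 0)
    (hΩ : is_Omega S k a Ω) :
  ka_schwartz S k a Ω =
  [set L2class (weight S k a)
         (fun x : R => u (`|x| `^ a) + x%:C * v (`|x| `^ a))
    | u in schwartz_half_line (R := R) & v in schwartz_half_line (R := R)].
Proof.
have S0 : 0 \notin S by case: hS.
have [hU _ integral_pos0] := hΩ.
have sc : 2 / a != 0 by rewrite gt_eqF// divr_gt0.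
have sc' : a / 2 != 0 by rewrite gt_eqF// divr_gt0.
apply/seteqP; split=> [_ [f sf <-]|_ [u [U sU uU]] [v [V sV vV]] <-].
  have [c gc fc] := smooth_cexp S0 ha hlambda hU integral_pos0 sf.
  have [u1 [u2 [v1 [v2 [[su1 su2 sv1 sv2] E]]]]] := cexp_schwartz S k ha gc.
  (* The expansions are functions of [tau |x| = (2/a) |x|^a]; the factor is absorbed by rescaling
     the Schwartz functions. *)
  have H (p q : R -> R) : real_schwartz p -> real_schwartz q ->
      schwartz_half_line (fun t => Complex (p (2 / a * t)) (q (2 / a * t))).
    move=> parity_exp sq; exists (fun t => Complex (p (2 / a * t)) (q (2 / a * t))) => //.
    by apply: schwartz_of_real; exact: real_schwartz_scale.
  exists (fun t => Complex (u1 (2 / a * t)) (u2 (2 / a * t))); first exact: H.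
  exists (fun t => Complex (v1 (2 / a * t)) (v2 (2 / a * t))); first exact: H.
  rewrite (L2class_eq S k a fc); congr L2class; apply/funext => x.
  by rewrite E /tau; apply: complexP => /=; ring.
have [s1 s2] := real_of_schwartz sU; have [s3 s4] := real_of_schwartz sV.
have [c gc gE] := schwartz_cexp S0 ha hlambda (real_schwartz_scale sc' s1) (real_schwartz_scale sc' s2)
  (real_schwartz_scale sc' s3) (real_schwartz_scale sc' s4).
exists (cexp S k a c); first exact: cexp_smooth.
apply: L2class_eq; apply: aeeq_sym; apply: ae_mono gE => x <-.
have tE : a / 2 * tau a `|x| = `|x| `^ a by rewrite /tau; field; rewrite gt_eqF.
rewrite tE uU ?powR_ge0// vV ?powR_ge0//.
by case: (U _) => p q; case: (V _) => p' q'; apply: complexP => /=; ring.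
Qed.
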